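(* Let $N=(N_t(A))_{t\in\mathbb R_+,A\in\mathcal B[0,1]}$ be an unmarked linear graphon Hawkes process on $\mathscr X=[0,1]$ and time interval $\mathbb R_+$, starting on an empty history, with parameters $\lambda_\infty,h,W$ satisfying the assumptions listed in the context. Suppose $\rho(T_{\mathrm{hom}})<1$, where $$T_{\mathrm{hom}}:L^1[0,1]\to L^1[0,1],\qquad (T_{\mathrm{hom}}f)(x)=\|h\|_{L^1(\mathbb R_+)}\int_0^1W(x,y)f(y)\,\mathrm dy.$$ Let $\bar\lambda\in L^1[0,1]$ be the solution of $$\bar\lambda(x)=\lambda_\infty(x)+\|h\|_{L^1(\mathbb R_+)}\int_0^1W(x,y)\bar\lambda(y)\,\mathrm dy,$$ and write $\bar\lambda(A):=\int_A\bar\lambda(x)\,\mathrm dx$. Then for every $A\in\mathcal B[0,1]$, $$\sup_{v\in[0,1]}\Big|\frac{N_{Tv}(A)}{T}-v\bar\lambda(A)\Big|\longrightarrow0\quad\text{in probability, as }T\to\infty.$$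
   Context: Unmarked linear graphon Hawkes process on $[0,1]$: the point process of events $(s,y)\in\mathbb R_+\times[0,1]$ with conditional intensity density $\lambda_t(x)=\lambda_\infty(x)+\sum_{(s,y)\in N,\ s<t}W(x,y)h(t-s)$, i.e. given the past, events occur in $\mathrm dt\times\mathrm dx$ at rate $\lambda_t(x)\,\mathrm dt\,\mathrm dx$. $N_t(A)$ is the number of events up to time $t$ with location in $A$. $\rho$ denotes the spectral radius of a bounded operator on $L^1[0,1]$. Assumptions: $\lambda_\infty:[0,1]\to\mathbb R_+$ is in $L^\infty[0,1]$ and has finite total variation; $h:\mathbb R_+\to\mathbb R_+$ is in $L^1(\mathbb R_+)$; $W:[0,1]^2\to\mathbb R_+$ is measurable and bounded by a constant $C_W$, and $W(\cdot,y)$ is of bounded variation for all $y\in[0,1]$ with $\sup_{y\in[0,1]}\|W(\cdot,y)\|_{\mathrm{TV}[0,1]}<\infty$. Here the total variation of an equivalence class of functions is the infimum over representatives of the usual total variation on $(0,1)$. *)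

(* Defs.v *)
From HB Require Import structures.
From mathcomp Require Import all_boot all_order all_algebra complex.
From mathcomp Require Import all_classical all_reals all_analysis measurable_realfun.

Set Implicit Arguments.
Unset Strict Implicit.
Unset Printing Implicit Defensive.
Import Order.TTheory GRing.Theory Num.Theory.
Import numFieldNormedType.Exports.
Local Open Scope classical_set_scope.
Local Open Scope ring_scope.

Notation I01 R := (`[0, 1]%classic : set R).

Section total_variation_of_classes.
Variable R : realType.
Local Notation mu := (@lebesgue_measure R).

Definition TV_open (f : R -> R) : \bar R :=
  ereal_sup [set total_variation ab.1 ab.2 f
            | ab in [set ab : R * R | [/\ 0 < ab.1, ab.1 <= ab.2 & ab.2 < 1]]].

Definition TV01 (f : R -> R) : \bar R :=
  ereal_inf [set TV_open g
            | g in [set g : R -> R | measurable_fun (I01 R) g /\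
                                     f = g %[ae mu in I01 R]]].

End total_variation_of_classes.

(* Spectral theory on L^1[0,1].  An element of L^1[0,1] is represented by a
   function integrable on [0,1]; elements are identified when they are equal
   almost everywhere on [0,1].  As L^1[0,1] is a real Banach space, the spectrum
   is that of the complexified operator on the complex space L^1([0,1]; C). *)
Section spectral_radius.
Variable R : realType.
Local Notation mu := (@lebesgue_measure R).
Local Notation C := R[i].
Local Notation normc := (@ComplexField.Normc.normc R).

Definition L1 (f : R -> R) : Prop := mu.-integrable (I01 R) (EFin \o f).

Definition L1C (F : R -> C) : Prop :=
  L1 (fun x => complex.Re (F x)) /\ L1 (fun x => complex.Im (F x)).

Definition L1C_norm (F : R -> C) : R := \int[mu]_(x in I01 R) normc (F x).

Definition complexify (T : (R -> R) -> (R -> R)) (F : R -> C) (x : R) : C :=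
  Complex (T (fun y => complex.Re (F y)) x) (T (fun y => complex.Im (F y)) x).

(* [z - T] is a bijection of L^1([0,1]; C) whose inverse is bounded. *)
Definition in_resolvent_set (T : (R -> R) -> (R -> R)) (z : C) : Prop :=
  (forall F, L1C F ->
     (fun x => z * F x - complexify T F x) = cst 0 %[ae mu in I01 R] ->
     F = cst 0 %[ae mu in I01 R]) /\
  (exists M : R, forall G, L1C G -> exists F,
     [/\ L1C F,
         (fun x => z * F x - complexify T F x) = G %[ae mu in I01 R] &
         L1C_norm F <= M * L1C_norm G]).

Definition spectrum (T : (R -> R) -> (R -> R)) : set C :=
  [set z | ~ in_resolvent_set T z].

Definition spectral_radius (T : (R -> R) -> (R -> R)) : \bar R :=
  ereal_sup [set (normc z)%:E | z in spectrum T].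

End spectral_radius.

Section hawkes_parameters.
Variable R : realType.
Local Notation mu := (@lebesgue_measure R).

Definition L1_norm_half_line (h : R -> R) : R :=
  \int[mu]_(t in `[0, +oo[) `|h t|.

Definition T_hom (h : R -> R) (W : R -> R -> R) (f : R -> R) (x : R) : R :=
  L1_norm_half_line h * \int[mu]_(y in I01 R) (W x y * f y).

End hawkes_parameters.

(* A point process on R_+ x [0,1] without simultaneous events is encoded by the
   increasing sequence [tau] of its event times and the sequence [xi] of the
   corresponding locations; [tau n w = +oo] means that there are at most [n]
   events, and [xi n w] is then meaningless. *)
Section point_process.
Context (d : measure_display) (Omega : measurableType d) (R : realType).
Variables (P : probability Omega R).
Local Notation mu := (@lebesgue_measure R).
Implicit Types (tau : nat -> Omega -> \bar R) (xi : nat -> Omega -> R).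

Record is_point_process tau xi : Prop := IsPointProcess {
  pp_time_measurable : forall n, measurable_fun setT (tau n) ;
  pp_location_measurable : forall n, measurable_fun setT (xi n) ;
  pp_time_ge0 : forall n w, (0 <= tau n w)%E ;
  pp_time_le : forall n w, (tau n w <= tau n.+1 w)%E ;
  pp_time_lt : forall n w, (tau n w < +oo)%E -> (tau n w < tau n.+1 w)%E ;
  pp_locally_finite : forall w, tau n w @[n --> \oo] --> +oo%E ;
  pp_location01 : forall n w, 0 <= xi n w <= 1 }.

(* N_t(A) *)
Definition N_count tau xi (t : R) (A : set R) (w : Omega) : \bar R :=
  (\sum_(0 <= n <oo) ((tau n w <= t%:E)%E && (xi n w \in A))%:R%:E)%E.

(* The sum of [H] over the events (s, y) of the process. *)
Definition event_sum tau xi (H : R -> R -> \bar R) (w : Omega) : \bar R :=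
  (\sum_(0 <= n <oo)
     (if (tau n w < +oo)%E then H (fine (tau n w)) (xi n w) else 0))%E.

(* The internal history sigma(N_u(A) : 0 <= u <= s, A Borel). *)
Definition history tau xi (s : R) : set (set Omega) :=
  <<s [set E | exists u (A : set R) (B : set (\bar R)),
         [/\ 0 <= u <= s, measurable A, A `<=` (I01 R), measurable B
           & E = N_count tau xi u A @^-1` B]] >>.

(* Generators of the predictable sigma-algebra (times the Borel sets of [0,1])
   on Omega x R_+ x [0,1]. *)
Definition predictable_rectangle tau xi : set (set (Omega * R * R)) :=
  [set E | exists F (A : set R), [/\ measurable A, A `<=` (I01 R) &
     (exists s t, [/\ 0 <= s, s <= t, history tau xi s F
                    & E = (F `*` `]s, t]%classic) `*` A]) \/
     (history tau xi 0 F /\ E = (F `*` [set 0]) `*` A)]].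

Definition predictable tau xi (H : Omega * R * R -> \bar R) : Prop :=
  @measurable_fun _ _ (g_sigma_algebraType (predictable_rectangle tau xi))
    (\bar R) [set z | 0 <= z.1.2 /\ 0 <= z.2 <= 1] H.

(* [lambda t x] is the conditional intensity density, with respect to dt dx and
   given the internal history, of the point process: the measure
   [lambda t x dt dx] is its predictable compensator. *)
Definition has_conditional_intensity tau xi
    (lambda : R -> R -> Omega -> \bar R) : Prop :=
  forall H : Omega * R * R -> \bar R,
    predictable tau xi H -> (forall z, (0 <= H z)%E) ->
    (\int[P]_w event_sum tau xi (fun s y => H (w, s, y)) w =
     \int[P]_w \int[mu]_(t in `[0%R, +oo[) \int[mu]_(x in I01 R)
       (H (w, t, x) * lambda t x w))%E.

Definition hawkes_intensity (linf h : R -> R) (W : R -> R -> R) tau xi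
    (t x : R) (w : Omega) : \bar R :=
  ((linf x)%:E +
   event_sum tau xi
     (fun s y => if (s < t)%R then (W x y * h (t - s)%R)%:E else 0) w)%E.

(* All the events have nonnegative times: the history before time 0 is empty. *)
Definition is_graphon_hawkes (linf h : R -> R) (W : R -> R -> R) tau xi :=
  is_point_process tau xi /\
  has_conditional_intensity tau xi (hawkes_intensity linf h W tau xi).

Definition cvg_in_probability (X : R -> Omega -> \bar R) (l : R) : Prop :=
  forall eps : R, 0 < eps ->
    P [set w | (eps%:E < `| X T w - l%:E |)%E] @[T --> +oo] --> 0%E.

End point_process.

(* Main.v *)
(** Test the process against bounded [phi >= 0]: let [N_T(phi)] be the sum of
    [phi] over the events up to time [T], and [L_T(phi)] the integral of
    [phi * lambda_t] over [0, T] x [0,1]. Write [K] for T_hom and [kap] for its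
    transpose.

    The spectral hypothesis enters through positivity. Say that [r] is good if
    an integrable [f >= 0] with [r f <= K f] vanishes. Large [r] are good, and
    since [r - K] is invertible for all [r >= 1], the resolvent bounds show that
    the good [r >= 1] contain their infimum and have no least element above [1];
    so [1] is good. It follows that [lambda_bar >= 0], that [K^k lambda_bar]
    decreases to [0] (its limit is a fixed point of [K]), and that
    [E N_T(phi) <= T <phi, lambda_bar>]: the mean density [M] of the process
    stopped at the n-th event satisfies [M <= T lambda_infty + K M].

    The predictable integrands [N_{s-}(phi)] and [L_s(phi)] give
    [E (N_T(phi) - L_T(phi))^2 <= E sum phi^2 = O(T)], so that [N_T(phi)] and
    [L_T(phi)] differ by [o(T)] in probability. Integrating the kernel [h] over
    time, for every [delta > 0] and [T] large
      [T <phi, lambda_infty> + (1 - delta) N_{(1-delta)T}(kap phi)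
         <= L_T(phi) <= T <phi, lambda_infty> + N_T(kap phi)].
    Iterating [k] times squeezes [N_T(phi) / T] up to the remainder
    [<kap^k phi, lambda_bar> = <phi, K^k lambda_bar>], which tends to [0].
    Monotonicity in time and a finite grid make the convergence uniform. *)

Require Import Defs.
From HB Require Import structures.
From mathcomp Require Import all_boot all_order all_algebra complex.
From mathcomp Require Import all_classical all_reals all_analysis measurable_realfun.
From mathcomp Require Import ring lra.

Set Implicit Arguments.
Unset Strict Implicit.
Unset Printing Implicit Defensive.
Import Order.TTheory GRing.Theory Num.Theory.
Import numFieldNormedType.Exports.
Local Open Scope classical_set_scope.
Local Open Scope ring_scope.

(** * Positive integral operators *)

Section kernel_operator.
Variable R : realType.
Local Notation mu := (@lebesgue_measure R).
Implicit Types f g : R -> R.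

(** The conditional intensity only equates expectations of nonnegative predictable integrands, both
    sides possibly infinite, and no moment of the process is known beforehand. Means and second
    moments are therefore computed for the process stopped at [tau n], which has at most [n + 1]
    events, with bounds uniform in [n]. Squares are expanded into nonnegative terms, and
    cancellation waits until the mixed terms are known to be finite. The history is generated by
    counts alone. Times and locations of past events have to be recovered from counts at rational
    times before any integrand can be called predictable. On the operator side neither compactness
    nor an eigenfunction is available: of the spectrum only the real points [r >= 1] of the
    resolvent set are used, and order replaces spectral theory through a minimum principle,
    [no_subinvariant_pos]. That principle gives the sign of lambda_bar and the upper bound on the
    mean; the absence of subinvariant functions at 1 also makes the limit of the iterates vanish. *)

Lemma measurable_I01 : measurable (I01 R : set (measurableTypeR R)).
Proof. exact: measurable_itv. Qed.
Hint Resolve measurable_I01 : core.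

Lemma ae_imp (P Q : R -> Prop) : (forall x, P x -> Q x) ->
  (\forall x \ae mu, P x) -> \forall x \ae mu, Q x.
Proof. exact: (@filterS _ _ (ae_filter_ringOfSetsType mu)). Qed.

Lemma ae_imp2 (P Q S : R -> Prop) : (forall x, P x -> Q x -> S x) ->
  (\forall x \ae mu, P x) -> (\forall x \ae mu, Q x) -> \forall x \ae mu, S x.
Proof. exact: (@filterS2 _ _ (ae_filter_ringOfSetsType mu)). Qed.

Lemma measurable_transpose (W : R -> R -> R) :
  measurable_fun setT (fun z : R * R => W z.1 z.2) ->
  measurable_fun setT (fun z : R * R => W z.2 z.1).
Proof.
move=> mW; apply: (@measurableT_comp _ _ _ _ _ _ (fun z : R * R => W z.1 z.2) _
  (fun z => (z.2, z.1))) => //.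
by apply: measurable_fun_pair; [exact: measurable_snd|exact: measurable_fst].
Qed.

Lemma L1_meas f : L1 f -> measurable_fun (I01 R) f.
Proof. by move=> /(measurable_int mu) ?; apply/measurable_EFinP. Qed.

Lemma L1D f g : L1 f -> L1 g -> L1 (fun x => f x + g x).
Proof. by move=> lf lg; have := integrableD measurable_I01 lf lg; apply: eq_integrable. Qed.

Lemma L1Z (k : R) f : L1 f -> L1 (fun x => k * f x).
Proof. by move=> lf; have := integrableZl measurable_I01 k lf; apply: eq_integrable. Qed.

Lemma L1neg f : L1 f -> L1 f^\-.
Proof. exact: integrable_funrneg. Qed.

Lemma L1abs f : L1 f -> L1 (fun x => `|f x|).
Proof. exact: integrable_norm. Qed.

Definition norm1 f : R := \int[mu]_(x in I01 R) `|f x|.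

Lemma norm1_ge0 f : 0 <= norm1 f.
Proof. exact: Rintegral_ge0. Qed.

Definition le_ae f g : Prop := \forall x \ae mu, I01 R x -> f x <= g x.

Lemma le_norm1 f g : L1 f -> L1 g ->
  le_ae (fun x => `|f x|) (fun x => `|g x|) -> norm1 f <= norm1 g.
Proof.
move=> lf lg fg; rewrite /norm1 /Rintegral fine_le//.
- exact: integrable_fin_num (L1abs lf).
- exact: integrable_fin_num (L1abs lg).
- apply: ae_ge0_le_integral => //.
  + exact: measurable_int (L1abs lf).
  + exact: measurable_int (L1abs lg).
Qed.

Lemma norm1D f g : L1 f -> L1 g -> norm1 (fun x => f x + g x) <= norm1 f + norm1 g.
Proof.
move=> lf lg; rewrite /norm1 -RintegralD//; [|exact: L1abs..].
apply: le_Rintegral => //.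
- exact: L1abs (L1D lf lg).
- exact: L1D (L1abs lf) (L1abs lg).
- by move=> x _; exact: ler_normD.
Qed.

Lemma norm1Z k f : L1 f -> norm1 (fun x => k * f x) = `|k| * norm1 f.
Proof.
move=> lf; rewrite /norm1 -RintegralZl//; last exact: L1abs.
by apply: eq_Rintegral => x _; rewrite normrM.
Qed.

Lemma norm1_eq0 f : L1 f -> norm1 f = 0 -> f = cst 0 %[ae mu in I01 R].
Proof.
move=> lf f0; have [+ _] := ae_eq_integral_abs mu measurable_I01 (measurable_int mu lf).
have h : (\int[mu]_(x in I01 R) `|(EFin \o f) x| = 0)%E.
  rewrite -[LHS]fineK//; first by rewrite (_ : fine _ = norm1 f)// f0.
  exact: integrable_fin_num (L1abs lf).
by move=> /(_ h); apply: ae_imp => x + Dx => /(_ Dx) [].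
Qed.

Variables (W : R -> R -> R) (C a : R).
Hypothesis W_meas : measurable_fun setT (fun z : R * R => W z.1 z.2).
Hypothesis W_ge0 : forall x y, 0 <= W x y.
Hypothesis W_le : forall x y, W x y <= C.
Hypothesis a_ge0 : 0 <= a.

(** Separate from [T_hom] because the same lemmas serve the transposed kernel and the factor
    [a = 1]. It is a function defined at every point, not a class. *)
Definition Kop f x : R := a * \int[mu]_(y in I01 R) (W x y * f y).

Lemma W_measr x : measurable_fun setT (W x).
Proof. by apply: (measurableT_comp W_meas (measurable_pair1 x)). Qed.

Lemma L1W x f : L1 f -> L1 (fun y => W x y * f y).
Proof.
move=> lf; have := @integrableMr _ _ _ mu _ measurable_I01 (W x) (EFin \o f).
apply => //; first exact: measurable_funTS (W_measr x).
exists C; split; first exact: num_real.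
move=> M CM y _; rewrite /= ger0_norm//; exact: le_trans (W_le _ _) (ltW CM).
Qed.

Lemma KopD f g x : L1 f -> L1 g ->
  Kop (fun y => f y + g y) x = Kop f x + Kop g x.
Proof.
move=> lf lg; rewrite /Kop -mulrDr -RintegralD//; [|exact: L1W..].
by congr (_ * _); apply: eq_Rintegral => y _; rewrite mulrDr.
Qed.

Lemma KopZ k f x : L1 f -> Kop (fun y => k * f y) x = k * Kop f x.
Proof.
move=> lf; rewrite /Kop mulrCA -[k * _]RintegralZl//; last exact: L1W.
by congr (_ * _); apply: eq_Rintegral => y _; rewrite mulrCA.
Qed.

Lemma Kop_ge0 f x : L1 f -> le_ae (cst 0) f -> 0 <= Kop f x.
Proof.
move=> lf f0; rewrite mulr_ge0//.
have -> : \int[mu]_(y in I01 R) (W x y * f y) = \int[mu]_(y in I01 R) `|W x y * f y|.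
  congr fine; apply: ae_eq_integral => //.
  - exact: measurable_int (L1W x lf).
  - exact: measurable_int (L1abs (L1W x lf)).
  - apply: (ae_imp _ f0) => y + Dy => /(_ Dy) /= fy.
    by rewrite ger0_norm// mulr_ge0.
exact: Rintegral_ge0.
Qed.

(** The kernel integrates null sets away, so a hypothesis almost everywhere yields a conclusion at
    every [x]. This later upgrades equations between classes to equations between functions. *)
Lemma le_Kop f g x : L1 f -> L1 g -> le_ae f g -> Kop f x <= Kop g x.
Proof.
move=> lf lg fg; rewrite -subr_ge0 -mulN1r -KopZ// -KopD//; last exact: L1Z.
apply: Kop_ge0; first by apply: L1D => //; exact: L1Z.
by apply: (ae_imp _ fg) => y + Dy => /(_ Dy) /=; rewrite mulN1r subr_ge0.
Qed.

Lemma Kop_bound f x : L1 f -> `|Kop f x| <= a * C * norm1 f.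
Proof.
move=> lf; rewrite /Kop normrM ger0_norm// -mulrA ler_wpM2l//.
apply: le_trans (le_normr_Rintegral _ (L1W x lf)) _ => //.
rewrite /norm1 -RintegralZl//; last exact: L1abs.
apply: le_Rintegral => //.
- exact: L1abs (L1W x lf).
- by apply: L1Z; exact: L1abs.
- by move=> y _; rewrite normrM ger0_norm// ler_wpM2r.
Qed.

Lemma measurable_Kop f : L1 f -> measurable_fun setT (Kop f).
Proof.
move=> lf.
have mf : measurable_fun setT (f \_ (I01 R)).
  apply/(measurable_restrictT f measurable_I01).
  exact: L1_meas.
pose F z := (W z.1 z.2 * (f \_ (I01 R)) z.2)%:E.
have mF : measurable_fun setT F.
  apply/measurable_EFinP/measurable_funM => //.
  exact: measurableT_comp mf measurable_snd.
apply: measurable_funM => //.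
rewrite (_ : (fun x => _) =
  (fun x => fine (fubini_F mu (F^\+)%E x - fubini_F mu (F^\-)%E x)%E)); last first.
  apply/funext => x; rewrite /Rintegral integral_mkcond integralE; congr (fine (_ - _)%E);
    apply: eq_integral => y _; rewrite ?funeposE ?funenegE /F /= !patchE /=;
    by case: ifP => //; rewrite mulr0.
apply: measurableT_comp => //; apply: emeasurable_funB;
  apply: measurable_fun_fubini_tonelli_F.
- exact: measurable_funepos.
- by move=> z; exact: funepos_ge0.
- exact: measurable_funeneg.
- by move=> z; exact: funeneg_ge0.
Qed.

Lemma L1_bounded f (M : R) : measurable_fun (I01 R) f ->
  (forall x, 0 <= x <= 1 -> `|f x| <= M) -> L1 f.
Proof.
move=> mf fM; apply: measurable_bounded_integrable => //.
  by rewrite [X in (X < _)%E]lebesgue_measure_itv/= lte01 oppr0 adde0 ltry.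
exists M; split; first exact: num_real.
move=> N MN y /=; rewrite in_itv/= => /fM h; exact: le_trans h (ltW MN).
Qed.

Lemma L1_Kop f : L1 f -> L1 (Kop f).
Proof.
move=> lf; apply: (@L1_bounded _ (a * C * norm1 f)).
  exact: measurable_funTS (measurable_Kop lf).
by move=> x _; exact: Kop_bound.
Qed.

Lemma norm1_Kop f : L1 f -> norm1 (Kop f) <= a * C * norm1 f.
Proof.
move=> lf; have C0 : 0 <= C := le_trans (W_ge0 0 0) (W_le 0 0).
have c0 : 0 <= a * C * norm1 f by rewrite mulr_ge0 ?norm1_ge0// mulr_ge0.
apply: (@le_trans _ _ (\int[mu]_(x in I01 R) (a * C * norm1 f))).
  apply: le_Rintegral => //.
  - exact: L1abs (L1_Kop lf).
  - by apply: (@L1_bounded _ (a * C * norm1 f)) => // x _; rewrite ger0_norm.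
  - by move=> x _; exact: Kop_bound.
rewrite Rintegral_cst// [X in fine X]lebesgue_measure_itv/= lte01 oppr0 adde0/=.
by rewrite mulr1.
Qed.

End kernel_operator.

(** * Subinvariant functions and the minimum principle *)

Section subinvariant.
Variable R : realType.
Local Notation mu := (@lebesgue_measure R).
Variables (W : R -> R -> R) (C a : R).
Hypothesis W_meas : measurable_fun setT (fun z : R * R => W z.1 z.2).
Hypothesis W_ge0 : forall x y, 0 <= W x y.
Hypothesis W_le : forall x y, W x y <= C.
Hypothesis a_ge0 : 0 <= a.
Local Notation K := (Kop W a).
Implicit Types f g : R -> R.

Let LK f : L1 f -> L1 (K f) := @L1_Kop _ _ _ _ W_meas W_ge0 W_le a_ge0 f.
Let KD f g x : L1 f -> L1 g -> K (fun y => f y + g y) x = K f x + K g x :=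
  @KopD _ _ _ a W_meas W_ge0 W_le f g x.
Let KZ k f x : L1 f -> K (fun y => k * f y) x = k * K f x :=
  @KopZ _ _ _ a W_meas W_ge0 W_le k f x.
Let leK f g x : L1 f -> L1 g -> le_ae f g -> K f x <= K g x :=
  @le_Kop _ _ _ _ W_meas W_ge0 W_le a_ge0 f g x.

Definition no_subinvariant (r : R) : Prop := forall f, L1 f ->
  le_ae (cst 0) f -> le_ae (fun x => r * f x) (K f) -> f = cst 0 %[ae mu in I01 R].

Lemma no_subinvariant_le r s : r <= s -> no_subinvariant r -> no_subinvariant s.
Proof.
move=> rs h f lf f0 sf; apply: h => //; apply: ae_imp2 f0 sf => x + + Dx.
by move=> /(_ Dx) fx /(_ Dx); apply: le_trans; rewrite ler_wpM2r.
Qed.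

Lemma no_subinvariant_large r : a * C < r -> no_subinvariant r.
Proof.
move=> Cr f lf f0 rf; apply: norm1_eq0 => //.
have C0 : 0 <= C := le_trans (W_ge0 0 0) (W_le 0 0).
have r0 : 0 < r by apply: le_lt_trans Cr; rewrite mulr_ge0.
have : r * norm1 f <= a * C * norm1 f.
  apply: le_trans (norm1_Kop W_meas W_ge0 W_le a_ge0 lf).
  rewrite -[in leLHS](gtr0_norm r0) -norm1Z//; apply: le_norm1 => //.
  - exact: L1Z.
  - exact: LK.
  - apply: ae_imp2 f0 rf => x + + Dx => /(_ Dx) fx /(_ Dx) h.
    have rfx : 0 <= r * f x by rewrite mulr_ge0// ltW.
    by rewrite !ger0_norm// (le_trans rfx).
have := norm1_ge0 f; rewrite le_eqVlt => /predU1P[//|fp].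
by rewrite ler_pM2r// leNgt Cr.
Qed.

(** A minimum principle: the negative part of [g] is subinvariant. Where [g < 0],
    [r g^- = - r g <= - K g <= K g^-], and elsewhere [r g^- = 0 <= K g^-]. *)
Lemma no_subinvariant_pos r g : 0 < r -> no_subinvariant r -> L1 g ->
  le_ae (K g) (fun x => r * g x) -> le_ae (cst 0) g.
Proof.
move=> r0 h lg Kg; have lgn := L1neg lg.
have : g^\- = cst 0 %[ae mu in I01 R].
  apply: h => //; first by apply: aeW => x _; exact: funrneg_ge0.
  apply: ae_imp Kg => x + Dx => /(_ Dx) Kgx.
  have Kn0 : 0 <= K g^\- x.
    apply: (Kop_ge0 W_meas W_ge0 W_le a_ge0) => //.
    by apply: aeW => y _; exact: funrneg_ge0.
  rewrite /funrneg maxEle; case: ifPn => gx; first by rewrite mulr0.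
  have -> : r * - g x = - (r * g x) by rewrite mulrN.
  apply: (@le_trans _ _ (- K g x)); first by rewrite lerN2.
  rewrite -mulN1r -KZ//; apply: leK => //; first exact: L1Z.
  by apply: aeW => y _; rewrite mulN1r /funrneg le_max lexx.
apply: ae_imp => x + Dx => /(_ Dx) /=; rewrite /funrneg maxEle.
by case: ifPn => [|_ gx]; [rewrite oppr_le0|rewrite -oppr_le0 gx].
Qed.

Hypothesis res : forall r, 1 <= r ->
  (forall g, L1 g -> (fun x => r * g x - K g x) = cst 0 %[ae mu in I01 R] ->
     g = cst 0 %[ae mu in I01 R]) /\
  (exists M, forall g, L1 g -> exists f,
     [/\ L1 f, (fun x => r * f x - K f x) = g %[ae mu in I01 R] &
         norm1 f <= M * norm1 g]).

(** The hypothesis bounds some preimage of each [g]. By injectivity the preimage of [r f - K f] is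
    [f] itself, so the bound holds for every [f]. *)
Lemma resolvent_bound r : 1 <= r -> exists M, 0 <= M /\ forall f, L1 f ->
  norm1 f <= M * norm1 (fun x => r * f x - K f x).
Proof.
move=> r1; have [inj [M surj]] := res r1; exists `|M|; split => // f lf.
have lg : L1 (fun x => r * f x - K f x).
  have := L1D (L1Z r lf) (L1Z (-1) (LK lf)); apply: eq_integrable => //= x _.
  by rewrite mulN1r.
have [u [lu ug uM]] := surj _ lg.
have ldiff : L1 (fun x => u x + -1 * f x) by exact: L1D lu (L1Z _ lf).
have uf : (fun x => u x + -1 * f x) = cst 0 %[ae mu in I01 R].
  apply: inj => //; apply: ae_imp ug => x + Dx => /(_ Dx) ux.
  rewrite (KD _ lu (L1Z _ lf)) KZ// /cst; lra.
have -> : norm1 f = norm1 u.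
  apply/eqP; rewrite eq_le; apply/andP; split; apply: le_norm1 => //;
  by apply: ae_imp uf => x + Dx => /(_ Dx) /= h; rewrite (_ : u x = f x)//; lra.
by apply: (le_trans uM); rewrite ler_wpM2r ?norm1_ge0 ?ler_norm.
Qed.

(* Compare [f] with the solution [u] of [(r + e) u - K u = f]: positivity gives
   [f <= e u], and for small [e] the resolvent bound at [r] makes the norm of
   [u] at most [2 M] times that of [f]. *)
Lemma no_subinvariant_limit r : 1 <= r ->
  (forall s, r < s -> no_subinvariant s) -> no_subinvariant r.
Proof.
move=> r1 hs f lf f0 rf; apply: norm1_eq0 => //.
have [M [M0 hM]] := resolvent_bound r1.
(* With this choice [M e <= 1/2], whence [norm1 u <= 2 M * norm1 f], while [f <= e u] gives
   [2 (M + 1) * norm1 f <= norm1 u]. Together they force [norm1 f = 0]. *)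
pose e := (2 * (M + 1))^-1; have e0 : 0 < e by rewrite invr_gt0; lra.
have Me : 2 * (M + 1) * e = 1 by rewrite mulfV//; lra.
have s1 : 1 <= r + e by lra.
have [_ [M' /(_ _ lf)[u [lu uf _]]]] := res s1.
have hse : no_subinvariant (r + e) by apply: hs; lra.
have fu : le_ae (cst 0) (fun x => u x + - e^-1 * f x).
  apply: (@no_subinvariant_pos (r + e)) => //; first lra.
    exact: L1D lu (L1Z _ lf).
  apply: ae_imp2 uf rf => x + + Dx => /(_ Dx) ux /(_ Dx) fx.
  rewrite (KD _ lu (L1Z _ lf)) KZ//.
  have -> : (r + e) * (u x + - e^-1 * f x) = (r + e) * u x - e^-1 * (r * f x) - f x.
    by field; lra.
  have : e^-1 * (r * f x) <= e^-1 * K f x by rewrite ler_wpM2l// invr_ge0 ltW.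
  lra.
have Nfu : e^-1 * norm1 f <= norm1 u.
  have ei : e^-1 = `|e^-1| by rewrite ger0_norm// invr_ge0 ltW.
  rewrite ei -norm1Z//; apply: le_norm1 => //; first exact: L1Z.
  apply: ae_imp2 f0 fu => x + + Dx => /(_ Dx) fx /(_ Dx) /= ux.
  have fe : 0 <= e^-1 * f x by rewrite mulr_ge0// invr_ge0 ltW.
  by rewrite !ger0_norm//; lra.
have Nu : norm1 u <= M * (norm1 f + e * norm1 u).
  apply: (le_trans (hM _ lu)); rewrite ler_wpM2l//.
  apply: (@le_trans _ _ (norm1 (fun x => f x + - e * u x))).
    apply: le_norm1.
    - have := L1D (L1Z r lu) (L1Z (-1) (LK lu)); apply: eq_integrable => //= x _.
      by rewrite mulN1r.
    - exact: L1D lf (L1Z _ lu).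
    - by apply: ae_imp uf => x + Dx => /(_ Dx) <-; rewrite [leLHS](_ : _ = `|(r + e) * u x - K u x + - e * u x|)//; congr `|_|; ring.
  apply: (le_trans (norm1D lf (L1Z _ lu))).
  by rewrite norm1Z// normrN gtr0_norm.
have nu0 := norm1_ge0 u; have nf0 := norm1_ge0 f.
have ei : e^-1 = 2 * (M + 1) by rewrite invrK.
rewrite ei in Nfu.
have Meu : M * e * norm1 u <= 2^-1 * norm1 u.
  rewrite ler_wpM2r//; nra.
have : norm1 u <= 2 * M * norm1 f by nra.
nra.
Qed.

(* The solution [u] of [r u - K u = e f] satisfies [f <= u], but its norm is at
   most [M e < 1] times that of [f]. *)
Lemma no_subinvariant_open r : 1 < r -> no_subinvariant r ->
  exists s, [/\ 1 <= s, s < r & no_subinvariant s].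
Proof.
move=> r1 hr; have [M [M0 hM]] := resolvent_bound (ltW r1).
pose e := (2 * (M + 1))^-1; have e0 : 0 < e by rewrite invr_gt0; lra.
have Me : M * e < 1.
  have : 2 * (M + 1) * e = 1 by rewrite mulfV//; lra.
  nra.
(* The argument works at [r - e]; the maximum only keeps the witness in the range [1 <= s], and
   being good is inherited by larger numbers. *)
exists (Num.max 1 (r - e)); split.
- by rewrite le_max lexx.
- by rewrite gt_max r1/= ltrBlDr ltrDl.
apply: (@no_subinvariant_le (r - e)); first by rewrite le_max lexx orbT.
move=> f lf f0 rf; apply: norm1_eq0 => //.
have [_ [_ /(_ _ (L1Z e lf))[u [lu uf _]]]] := res (ltW r1).
have fu : le_ae (cst 0) (fun x => u x + -1 * f x).
  apply: (@no_subinvariant_pos r) => //; first lra.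
    exact: L1D lu (L1Z _ lf).
  apply: ae_imp2 uf rf => x + + Dx => /(_ Dx) ux /(_ Dx) fx.
  rewrite (KD _ lu (L1Z _ lf)) KZ//; nra.
have Nfu : norm1 f <= norm1 u.
  apply: le_norm1 => //; apply: ae_imp2 f0 fu => x + + Dx => /(_ Dx) /= fx /(_ Dx) /= ux.
  by rewrite !ger0_norm//; lra.
have Nu : norm1 u <= M * (e * norm1 f).
  apply: (le_trans (hM _ lu)); rewrite ler_wpM2l//.
  have <- : norm1 (fun x => e * f x) = e * norm1 f by rewrite norm1Z// gtr0_norm.
  apply: le_norm1; last by apply: ae_imp uf => x + Dx => /(_ Dx) ->.
  - have := L1D (L1Z r lu) (L1Z (-1) (LK lu)); apply: eq_integrable => //= x _.
    by rewrite mulN1r.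
  - exact: L1Z.
have nf0 := norm1_ge0 f.
nra.
Qed.

Lemma no_subinvariant1 : no_subinvariant 1.
Proof.
pose E := [set r : R | 1 <= r /\ no_subinvariant r].
have hE : has_inf E.
  split; last by exists 1 => r [].
  exists (Num.max 1 (a * C + 1)); split; first by rewrite le_max lexx.
  by apply: no_subinvariant_large; rewrite lt_max ltrDl ltr01 orbT.
have r1 : 1 <= inf E by apply: lb_le_inf; [exact: hE.1|move=> r []].
have hr : no_subinvariant (inf E).
  apply: no_subinvariant_limit => // s rs.
  have [t [t1 ht] ts] := inf_lt hE.1 rs.
  exact: no_subinvariant_le (ltW ts) ht.
move: r1; rewrite le_eqVlt => /predU1P[->//|r1].
have [s [s1 sr hs]] := no_subinvariant_open r1 hr.
have : inf E <= s by apply: ge_inf => //; exact: hE.2.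
by rewrite leNgt sr.
Qed.

End subinvariant.

(** * From the spectral radius to real resolvents *)

Section spectral_gap.
Variable R : realType.
Local Notation mu := (@lebesgue_measure R).
Local Notation C := R[i].
Local Notation normc := (@ComplexField.Normc.normc R).
Implicit Types (f g : R -> R) (F : R -> C).

Lemma L1_0 : L1 (cst 0 : R -> R).
Proof. exact: integrable0. Qed.

Lemma norm1_Re F : L1C F -> norm1 (fun x => complex.Re (F x)) <= L1C_norm F.
Proof.
(* Comparing real-valued integrals requires the modulus to be integrable; it is dominated by
   [|Re F| + |Im F|]. *)
move=> [lr li]; have L1F : L1 (fun x => normc (F x)).
  apply: (le_integrable (@measurable_I01 R) _ _
    (integrableD (@measurable_I01 R) (L1abs lr) (L1abs li))).
  - apply/measurable_EFinP; apply: (@eq_measurable_fun _ _ _ _ _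
      (fun x => Num.sqrt (complex.Re (F x) ^+ 2 + complex.Im (F x) ^+ 2))).
      by move=> x _; case: (F x).
    apply: measurableT_comp.
      exact: (continuous_measurable_fun (@sqrt_continuous R)).
    by apply: measurable_funD; apply: measurable_funX; exact: L1_meas.
  - move=> x _ /=; rewrite lee_fin (ger0_norm (addr_ge0 _ _))//.
    case: (F x) => u v /=; rewrite ger0_norm ?sqrtr_ge0//.
    rewrite -(@ger0_norm _ (`|u| + `|v|)) ?addr_ge0// -sqrtr_sqr ler_sqrt ?sqr_ge0//.
    rewrite sqrrD !real_normK ?num_real// -addrA lerD2l lerDr.
    by rewrite mulrn_wge0// mulr_ge0.
apply: le_Rintegral => //; first exact: L1abs.
move=> x _; case: (F x) => u v /=.
by rewrite -sqrtr_sqr ler_sqrt ?addr_ge0 ?sqr_ge0// lerDl sqr_ge0.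
Qed.

Variables (T K : (R -> R) -> R -> R).
Hypothesis TK : forall f x, 0 <= x <= 1 -> T f x = K f x.
Hypothesis K0 : forall x, K (cst 0) x = 0.

(** A real [r >= 1] in the spectrum would push its supremum to at least 1. At a real point the
    complexified operator acts separately on real and imaginary parts: injectivity is tested on
    functions with imaginary part 0 (where [K0] is needed), and the real part of a complex solution
    solves the real equation. *)
Lemma real_resolvent r : (spectral_radius T < 1)%E -> 1 <= r ->
  (forall g, L1 g -> (fun x => r * g x - K g x) = cst 0 %[ae mu in I01 R] ->
     g = cst 0 %[ae mu in I01 R]) /\
  (exists M, forall g, L1 g -> exists f,
     [/\ L1 f, (fun x => r * f x - K f x) = g %[ae mu in I01 R] &
         norm1 f <= M * norm1 g]).
Proof.
move=> rho r1; have [inj [M surj]] : in_resolvent_set T (Complex r 0).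
  apply: contrapT => nr; have : ((normc (Complex r 0))%:E <= spectral_radius T)%E.
    by apply: ereal_sup_ubound; exists (Complex r 0).
  rewrite /= expr0n/= addr0 sqrtr_sqr ger0_norm ?(le_trans ler01)//.
  by move=> /le_lt_trans/(_ rho); rewrite lte_fin ltNge r1.
split=> [g lg gK|].
  have := inj (fun x => Complex (g x) 0); move=> /(_ (conj lg L1_0)) h.
  have {}h := h _; have : (fun x : R => Complex (g x) 0) = cst 0 %[ae mu in I01 R].
    apply: h; apply: ae_imp gK => x + Dx => /(_ Dx).
    have xI : 0 <= x <= 1 by move: Dx; rewrite /= in_itv.
    rewrite /complexify /= !TK// K0 /cst => E.
    by apply/eqP; rewrite eq_complex/= !mul0r !mulr0 !subr0 addr0 E eqxx.
  by apply: ae_imp => x + Dx => /(_ Dx) [].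
exists M => g lg.
have [F [[lr li] FG FM]] := surj (fun x => Complex (g x) 0) (conj lg L1_0).
exists (fun x => complex.Re (F x)); split => //.
  apply: ae_imp FG => x + Dx => /(_ Dx).
  have xI : 0 <= x <= 1 by move: Dx; rewrite /= in_itv.
  rewrite /complexify TK//; case: (F x) => u v [+ _] /=.
  by rewrite mul0r subr0.
apply: (le_trans (norm1_Re (conj lr li))); apply: (le_trans FM).
rewrite le_eqVlt; apply/orP; left; apply/eqP; congr (_ * _).
apply: eq_Rintegral => x _ /=.
by rewrite expr0n/= addr0 sqrtr_sqr.
Qed.

End spectral_gap.

(** * Duality with test functions and comparison with lambda_bar *)

Section pairing.
Variable R : realType.
Local Notation mu := (@lebesgue_measure R).
Variables (W : R -> R -> R) (C a : R).
Hypothesis W_meas : measurable_fun setT (fun z : R * R => W z.1 z.2).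
Hypothesis W_ge0 : forall x y, 0 <= W x y.
Hypothesis W_le : forall x y, W x y <= C.
Hypothesis a_ge0 : 0 <= a.
Local Notation K := (Kop W a).
Local Notation kap := (Kop (fun x y => W y x) a).
Implicit Types f g phi : R -> R.

Definition pairing phi f : R := \int[mu]_(x in I01 R) (phi x * f x).

(** Posed on the whole line rather than on [0,1], so that composition with [xi n] is measurable at
    once. The class contains indicators of Borel sets and is stable under the transposed operator
    ([test_kap]). *)
Record test_fun phi : Prop := TestFun {
  test_meas : measurable_fun setT phi ;
  test_ge0 : forall x, 0 <= phi x ;
  test_bnd : exists B, forall x, phi x <= B }.

Lemma L1_test phi : test_fun phi -> L1 phi.
Proof.
move=> [m p [B b]]; apply: (@L1_bounded _ _ B) => [|x x01].
  exact: measurable_funTS.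
by rewrite ger0_norm ?p ?b.
Qed.

Lemma L1_testM phi f : test_fun phi -> L1 f -> L1 (fun x => phi x * f x).
Proof.
move=> [m p [B b]] lf.
apply: (@integrableMr _ _ _ mu _ (@measurable_I01 R) phi (EFin \o f)) => //.
  exact: measurable_funTS.
exists B; split; first exact: num_real.
move=> M BM x /= Dx.
by rewrite ger0_norm ?p// (le_trans (b _))// ltW.
Qed.

Let W_meas' := measurable_transpose W_meas.

Lemma test_kap phi : test_fun phi -> test_fun (kap phi).
Proof.
move=> tp; have lp := L1_test tp; case: tp => m p [B b]; split.
- exact: measurable_Kop.
- move=> x; apply: (Kop_ge0 W_meas') => //.
  by apply: aeW => y Dy; exact: p.
- exists (a * C * norm1 phi) => x; apply: le_trans (ler_norm _) _.
  exact: Kop_bound.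
Qed.

Lemma pairing_ge0 phi f : test_fun phi -> (forall x, 0 <= x <= 1 -> 0 <= f x) ->
  0 <= pairing phi f.
Proof.
move=> tp f0; apply: Rintegral_ge0 => x; rewrite /= in_itv/= => x01.
by rewrite mulr_ge0 ?f0// (test_ge0 tp).
Qed.

Lemma pairingD phi f g : test_fun phi -> L1 f -> L1 g ->
  pairing phi (fun x => f x + g x) = pairing phi f + pairing phi g.
Proof.
move=> tp lf lg; rewrite /pairing -RintegralD//; [|exact: L1_testM..].
by apply: eq_Rintegral => x _; rewrite mulrDr.
Qed.

Lemma pairingZ phi k f : test_fun phi -> L1 f ->
  pairing phi (fun x => k * f x) = k * pairing phi f.
Proof.
move=> tp lf; rewrite /pairing -RintegralZl//; last exact: L1_testM.
by apply: eq_Rintegral => x _; rewrite mulrCA.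
Qed.

Lemma EFin_Rintegral f : L1 f -> (\int[mu]_(x in I01 R) f x)%:E =
  (\int[mu]_(x in I01 R) (f x)%:E)%E.
Proof. by move=> lf; rewrite /Rintegral fineK// integrable_fin_num. Qed.

Lemma EFin_pairing phi f : test_fun phi -> L1 f ->
  (pairing phi f)%:E = (\int[mu]_(x in I01 R) (phi x * f x)%:E)%E.
Proof. by move=> tp lf; rewrite EFin_Rintegral//; exact: L1_testM. Qed.

Lemma EFin_Kop f x : L1 f ->
  (K f x)%:E = (a%:E * \int[mu]_(y in I01 R) (W x y * f y)%:E)%E.
Proof. by move=> lf; rewrite EFinM EFin_Rintegral//; exact: (L1W W_meas W_ge0 W_le x lf). Qed.

End pairing.

Section duality.
Variable R : realType.
Local Notation mu := (@lebesgue_measure R).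
Variables (W : R -> R -> R) (C a : R).
Hypothesis W_meas : measurable_fun setT (fun z : R * R => W z.1 z.2).
Hypothesis W_ge0 : forall x y, 0 <= W x y.
Hypothesis W_le : forall x y, W x y <= C.
Hypothesis a_ge0 : 0 <= a.
Local Notation K := (Kop W a).
Local Notation kap := (Kop (fun x y => W y x) a).
Implicit Types f g phi : R -> R.

Let W_meas' := measurable_transpose W_meas.

(** Tonelli for the nonnegative function [W x y * phi x * f y]. Both factors are cut off outside
    [0,1], where the sign of [f] is unknown, so that the integrals can run over the whole line. *)
Lemma pairing_adjoint phi f : test_fun phi -> L1 f ->
  (forall x, 0 <= x <= 1 -> 0 <= f x) ->
  pairing (kap phi) f = pairing phi (K f).
Proof.
move=> tp lf f0; have lp := L1_test tp.
have tk := test_kap W_meas W_ge0 W_le a_ge0 tp.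
have lK : L1 (K f) by exact: (@L1_Kop _ W C).
apply: EFin_inj; rewrite (EFin_pairing tk lf) (EFin_pairing tp lK).
pose pI := phi \_ (I01 R); pose fI := f \_ (I01 R).
have pI0 x : 0 <= pI x.
  rewrite /pI patchE; case: ifPn => // _; exact: (test_ge0 tp).
have fI0 x : 0 <= fI x by rewrite /fI patchE; case: ifPn => //; rewrite inE/= in_itv/=; exact: f0.
have mp : measurable_fun setT pI.
  apply/(measurable_restrictT phi (@measurable_I01 R)); apply: measurable_funTS; exact: (test_meas tp).
have mf : measurable_fun setT fI.
  apply/(measurable_restrictT f (@measurable_I01 R)); exact: L1_meas.
pose F (z : R * R) := (W z.1 z.2 * pI z.1 * fI z.2)%:E.
have F0 z : (0 <= F z)%E by rewrite lee_fin !mulr_ge0.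
have mF : measurable_fun setT F.
  apply/measurable_EFinP; apply: measurable_funM; first apply: measurable_funM => //.
    exact: (measurableT_comp mp measurable_fst).
  exact: (measurableT_comp mf measurable_snd).
have mFG := measurable_fun_fubini_tonelli_G (m1 := mu) F mF F0.
have mFF := measurable_fun_fubini_tonelli_F (m2 := mu) F mF F0.
have H := fubini_tonelli (m1 := mu) (m2 := mu) F mF F0.
have iy y : (0 <= \int[mu]_x F (x, y))%E by apply: integral_ge0 => x _; exact: F0.
have ix x : (0 <= \int[mu]_y F (x, y))%E by apply: integral_ge0 => y _; exact: F0.
clear mF F0.
transitivity (a%:E * \int[mu]_y \int[mu]_x F (x, y))%E.
  rewrite integral_mkcond -ge0_integralZl; last 4 first.
  - exact: measurableT.
  - exact: mFG.
  - by move=> y _; exact: iy.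
  - by rewrite lee_fin.
  clear H mFF mFG ix iy.
  apply: eq_integral => y _; rewrite patchE /F /fI /= patchE.
  case: ifPn => yI; last by rewrite integral0_eq ?mule0// => x _; rewrite mulr0.
  rewrite EFinM (EFin_Kop (C := C) a W_meas' (fun x y => W_ge0 y x) (fun x y => W_le y x) y lp) -muleA; congr (_ * _)%E.
  rewrite muleC -ge0_integralZl; last 4 first.
  - exact: measurable_I01.
  - exact: measurable_int (L1W (C := C) W_meas' (fun x y => W_ge0 y x) (fun x y => W_le y x) y lp).
  - by move=> x; rewrite /= in_itv/= => xI; rewrite lee_fin mulr_ge0// (test_ge0 tp).
  - by rewrite lee_fin; move: yI; rewrite inE/= in_itv/=; exact: f0.
  rewrite integral_mkcond; apply: eq_integral => x _; rewrite /pI !patchE.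
  by case: ifPn => xI; rewrite ?mulr0 ?mul0r// -EFinM; congr (_%:E); ring.
rewrite -H [RHS]integral_mkcond -ge0_integralZl; last 4 first.
- exact: measurableT.
- exact: mFF.
- by move=> x _; exact: ix.
- by rewrite lee_fin.
clear H mFF mFG ix iy.
apply: eq_integral => x _; rewrite patchE /F /pI /= patchE.
case: ifPn => xI; last by rewrite integral0_eq ?mule0// => y _; rewrite mulr0 mul0r.
rewrite EFinM (EFin_Kop (C := C) a W_meas W_ge0 W_le x lf) muleCA; congr (_ * _)%E.
rewrite -ge0_integralZl; last 4 first.
- exact: measurable_I01.
- exact: measurable_int (L1W W_meas W_ge0 W_le x lf).
- by move=> y; rewrite /= in_itv/= => yI; rewrite lee_fin mulr_ge0// f0.
- by rewrite lee_fin (test_ge0 tp).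
rewrite [RHS]integral_mkcond; apply: eq_integral => y _; rewrite /fI !patchE.
by case: ifPn => yI; rewrite ?mulr0 ?mul0r// -EFinM; congr (_%:E); ring.
Qed.

Variables l lb : R -> R.
Hypothesis l_L1 : L1 l.
Hypothesis l_ge0 : forall x, 0 <= x <= 1 -> 0 <= l x.
Hypothesis lb_L1 : L1 lb.
Hypothesis lb_ge0 : forall x, 0 <= x <= 1 -> 0 <= lb x.
Hypothesis lb_eq : forall x, 0 <= x <= 1 -> lb x = l x + K lb x.
Hypothesis hK : no_subinvariant W a 1.

Lemma pairing_fixpoint phi : test_fun phi ->
  pairing phi lb = pairing phi l + pairing (kap phi) lb.
Proof.
move=> tp; have lK : L1 (K lb) by exact: (@L1_Kop _ W C).
rewrite pairing_adjoint// -pairingD//; apply: eq_Rintegral => x.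
by rewrite inE/= in_itv/= => x01; rewrite lb_eq.
Qed.

Lemma iter_test phi k : test_fun phi -> test_fun (iter k kap phi).
Proof. by move=> tp; elim: k => //= k; exact: (test_kap W_meas W_ge0 W_le a_ge0). Qed.

Lemma iter_Kop k : [/\ L1 (iter k K lb),
  (forall x, 0 <= x <= 1 -> 0 <= iter k K lb x) &
  (forall x, 0 <= x <= 1 -> iter k.+1 K lb x <= iter k K lb x)].
Proof.
have KL f : L1 f -> L1 (K f) by exact: (@L1_Kop _ W C).
elim: k => [|k [Lk k0 kS]].
  by split => //= x x01; rewrite (lb_eq x01) lerDr l_ge0.
have LS : L1 (iter k.+1 K lb) by exact: KL.
split => //.
- move=> x x01; apply: (Kop_ge0 W_meas W_ge0 W_le) => //.
  by apply: aeW => y; rewrite /= in_itv/= => y01; exact: k0.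
- move=> x x01; apply: (le_Kop W_meas W_ge0 W_le) => //.
  by apply: aeW => y; rewrite /= in_itv/= => y01; exact: kS.
Qed.

Lemma pairing_iter phi k : test_fun phi ->
  pairing (iter k kap phi) lb = pairing phi (iter k K lb).
Proof.
elim: k phi => // k IH phi tp.
have [Lk k0 _] := iter_Kop k.
rewrite iterSr IH; last exact: (test_kap W_meas W_ge0 W_le).
by rewrite pairing_adjoint.
Qed.

Lemma norm1_iter_cvg : norm1 (iter k K lb) @[k --> \oo] --> 0.
Proof.
pose g x := limn (fun k => iter k K lb x).
have gc x : 0 <= x <= 1 -> iter k K lb x @[k --> \oo] --> g x.
  move=> x01; apply: nonincreasing_is_cvgn.
    by apply/nonincreasing_seqP => k; case: (iter_Kop k) => _ _; exact.
  by exists 0 => _ [k _ <-]; case: (iter_Kop k) => _ + _; exact.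
have gle k x : 0 <= x <= 1 -> iter k K lb x <= lb x.
  move=> x01; elim: k => // k; apply: le_trans.
  by case: (iter_Kop k) => _ _; exact.
have g0 x : 0 <= x <= 1 -> 0 <= g x.
  move=> x01; apply: limr_ge; first exact: (cvgP _ (gc _ x01)).
  by apply: nearW => k; case: (iter_Kop k) => _ + _; exact.
have mg : measurable_fun (I01 R) g.
  apply: (measurable_fun_cvg (h := fun k => iter k K lb)).
    by move=> k; apply: L1_meas; case: (iter_Kop k).
  by move=> x; rewrite /= in_itv/=; exact: gc.
(* Dominated convergence, used twice: for the iterates themselves, dominated by [lb], and at fixed
   [x] for [W x y * iter k K lb y], which makes the limit a fixed point of [K]. *)
have dom (u : R -> R) (v : nat -> R -> R) (w : R -> R) : L1 u ->
    (forall (k : nat) x, 0 <= x <= 1 -> 0 <= v k x <= u x) ->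
    (forall k, L1 (v k)) -> measurable_fun (I01 R) w ->
    (forall x, 0 <= x <= 1 -> v k x @[k --> \oo] --> w x) ->
    L1 w /\ \int[mu]_(x in I01 R) v k x @[k --> \oo] --> \int[mu]_(x in I01 R) w x.
  move=> Lu vu Lv mw vw.
  have [|||||] := @dominated_convergence _ _ _ mu _ (@measurable_I01 R)
    (fun k x => (v k x)%:E) (EFin \o w) (EFin \o u).
  - by move=> k; exact: measurable_int (Lv k).
  - by apply/measurable_EFinP.
  - apply: aeW => x; rewrite /= in_itv/= => x01.
    by apply: cvg_EFin; [exact: nearW|exact: vw].
  - exact: Lu.
  - apply: aeW => x k; rewrite /= in_itv/= => x01; have /andP[p q] := vu k x x01.
    by rewrite lee_fin ger0_norm.
  move=> Lw _ cw; split=> //; apply: fine_cvg; rewrite EFin_Rintegral//.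
have iL k : L1 (iter k K lb) by case: (iter_Kop k).
have i0 k x : 0 <= x <= 1 -> 0 <= iter k K lb x by case: (iter_Kop k) => _ + _; exact.
have [Lg cg] : L1 g /\ \int[mu]_(x in I01 R) iter k K lb x @[k --> \oo] --> \int[mu]_(x in I01 R) g x.
  apply: (dom lb (fun k => iter k K lb)) => //.
  by move=> k x x01; rewrite gle// i0.
have gK x : 0 <= x <= 1 -> g x = K g x.
  move=> x01; apply: (@cvg_unique _ _ (iter k.+1 K lb x @[k --> \oo])) => //.
    have := gc _ x01; rewrite -(cvg_shiftS (fun k => iter k K lb x)); exact.
  have [|||||_ cW] := dom (fun y => W x y * lb y) (fun k y => W x y * iter k K lb y)
    (fun y => W x y * g y).
  - exact: (L1W W_meas W_ge0 W_le x lb_L1).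
  - by move=> k y y01; rewrite mulr_ge0 ?i0//= ler_wpM2l// gle.
  - by move=> k; exact: (L1W W_meas W_ge0 W_le x (iL k)).
  - by apply: measurable_funM => //; apply: measurable_funTS; exact: W_measr.
  - by move=> y y01; apply: cvgM; [exact: cvg_cst|exact: gc].
  by apply: cvgM; [exact: cvg_cst|exact: cW].
have gz : g = cst 0 %[ae mu in I01 R].
  apply: hK => //.
    by apply: aeW => x; rewrite /= in_itv/=; exact: g0.
  by apply: aeW => x; rewrite /= in_itv/= mul1r => x01; rewrite -gK.
have -> : (fun k => norm1 (iter k K lb)) = (fun k => \int[mu]_(x in I01 R) iter k K lb x).
  apply/funext => k; apply: eq_Rintegral => x; rewrite inE/= in_itv/= => x01.
  by rewrite ger0_norm// i0.
suff h : \int[mu]_(x in I01 R) g x = 0 by move: cg; rewrite h.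
have -> : \int[mu]_(x in I01 R) g x = \int[mu]_(x in I01 R) (cst 0 x).
  congr fine; apply: ae_eq_integral => //; first exact: measurable_int Lg.
    exact: measurable_int (@L1_0 R).
  by apply: (ae_imp _ gz) => x + Dx => /(_ Dx) ->.
by rewrite Rintegral_cst// mul0r.
Qed.

Lemma pairing_iter_cvg phi : test_fun phi ->
  pairing (iter k kap phi) lb @[k --> \oo] --> 0.
Proof.
move=> tp; have [B b] := test_bnd tp.
apply: (@squeeze_cvgr _ _ _ _ (cst 0) (fun k => B * norm1 (iter k K lb))).
- apply: nearW => k; apply/andP; split.
    by apply: pairing_ge0 => //; exact: iter_test.
  have [Lk k0 _] := iter_Kop k.
  rewrite pairing_iter// /norm1 -RintegralZl//; last exact: L1abs.
  apply: le_Rintegral => //.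
  + exact: L1_testM.
  + by apply: L1Z; exact: L1abs.
  + move=> x; rewrite /= in_itv/= => x01.
    by rewrite ger0_norm ?k0// ler_wpM2r ?k0// b.
- exact: cvg_cst.
- by rewrite -[X in _ --> X](mulr0 B); apply: cvgM; [exact: cvg_cst|exact: norm1_iter_cvg].
Qed.

(** Since [c lb] satisfies the relation with equality, the difference [u = c lb - M] satisfies
    [K u <= u], and the minimum principle at [r = 1] makes it nonnegative. The finite integral of
    [M] is what allows the subtraction; [M] may still be infinite on a null set, hence the passage
    to [f = fine M]. *)
Lemma comparison (c : R) (M : R -> \bar R) phi : 0 <= c -> test_fun phi ->
  measurable_fun (I01 R) M -> (forall x, 0 <= x <= 1 -> (0 <= M x)%E) ->
  (\int[mu]_(x in I01 R) M x < +oo)%E ->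
  (forall x, 0 <= x <= 1 -> (M x <= (c * l x)%:E +
     a%:E * \int[mu]_(y in I01 R) ((W x y)%:E * M y))%E) ->
  (\int[mu]_(x in I01 R) ((phi x)%:E * M x) <= (c * pairing phi lb)%:E)%E.
Proof.
move=> c0 tp mM M0 Mfin Mle.
have iM : mu.-integrable (I01 R) M.
  apply/integrableP; split => //; apply: le_lt_trans Mfin.
  rewrite le_eqVlt; apply/orP; left; apply/eqP; apply: eq_integral => x.
  by rewrite inE/= in_itv/= => x01; rewrite gee0_abs// M0.
pose f x := fine (M x).
have fM : (EFin \o f) = M %[ae mu in I01 R].
  have := integrable_ae (@measurable_I01 R) iM.
  by apply: ae_imp => x + Dx => /(_ Dx) h; rewrite /f /= fineK.
have mf : measurable_fun (I01 R) f by apply: measurableT_comp mM.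
have Lf : L1 f.
  apply: (le_integrable (@measurable_I01 R) _ _ iM); first exact/measurable_EFinP.
  move=> x; rewrite /= in_itv/= => /M0; rewrite /f; case: (M x) => [r _|_|] //=.
  by rewrite leey.
have intM (u : R -> R) : measurable_fun (I01 R) u ->
    (\int[mu]_(y in I01 R) ((u y)%:E * M y) = \int[mu]_(y in I01 R) (u y * f y)%:E)%E.
  move=> mu_; apply: ae_eq_integral => //.
  - by apply: emeasurable_funM => //; exact/measurable_EFinP.
  - by apply/measurable_EFinP; exact: measurable_funM.
  - by apply: (ae_imp _ fM) => x + Dx => /(_ Dx) /= <-.
have f0 x : 0 <= x <= 1 -> 0 <= f x by move=> x01; rewrite fine_ge0// M0.
have LcL : L1 (fun x => c * lb x) by exact: L1Z.
have LK g : L1 g -> L1 (K g) by exact: (@L1_Kop _ W C).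
have fc : le_ae (cst 0) (fun x => c * lb x + -1 * f x).
  have LD : L1 (fun x => c * lb x + -1 * f x) by exact: L1D LcL (L1Z _ Lf).
  apply: (no_subinvariant_pos (r := 1) W_meas W_ge0 W_le a_ge0) => //.
  apply: (ae_imp _ fM) => x + Dx => /(_ Dx) /= fMx.
  have x01 : 0 <= x <= 1 by move: Dx; rewrite /= in_itv.
  rewrite (KopD _ W_meas W_ge0 W_le x LcL (L1Z _ Lf)) !(KopZ _ W_meas W_ge0 W_le)//.
  have : f x <= c * l x + K f x.
    rewrite -lee_fin fMx EFinD (EFin_Kop a W_meas W_ge0 W_le x Lf).
    by rewrite -intM; [exact: Mle|apply: measurable_funTS; exact: W_measr].
  rewrite (lb_eq x01); nra.
rewrite intM; last by apply: measurable_funTS; exact: (test_meas tp).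
rewrite -(EFin_pairing tp Lf) lee_fin -pairingZ//.
rewrite /pairing /Rintegral fine_le//.
- exact: integrable_fin_num (L1_testM tp Lf).
- exact: integrable_fin_num (L1_testM tp LcL).
- apply: ae_ge0_le_integral => //.
  + by move=> x; rewrite /= in_itv/= => x01; rewrite lee_fin mulr_ge0 ?f0 ?(test_ge0 tp).
  + exact: measurable_int (L1_testM tp Lf).
  + move=> x; rewrite /= in_itv/= => x01; rewrite lee_fin mulr_ge0 ?(test_ge0 tp)//.
    by rewrite mulr_ge0 ?lb_ge0.
  + exact: measurable_int (L1_testM tp LcL).
  + apply: (ae_imp _ fc) => x + Dx => /(_ Dx) /= h.
    rewrite lee_fin ler_wpM2l//; last lra.
    exact: (test_ge0 tp).
Qed.

End duality.

(** * Translation invariance of Lebesgue integrals *)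

Section translation.
Variable R : realType.
Local Notation mu := (@lebesgue_measure R).

Lemma lebesgue_measure_shift (u : R) (A : set R) : measurable A ->
  pushforward mu (fun t : measurableTypeR R => t - u : measurableTypeR R) A = mu A.
Proof.
have ms : measurable_fun [set: measurableTypeR R]
    (fun t : measurableTypeR R => t - u : measurableTypeR R).
  by apply: measurable_funB => //; exact: measurable_cst.
move=> mA; apply/esym/lebesgue_measure_unique => //= _ [[a b]] _ <-.
rewrite /pushforward.
have -> : (fun t : measurableTypeR R => t - u : measurableTypeR R) @^-1` `]a, b]%classic
   = `](a + u), (b + u)]%classic.
  by apply/seteqP; split => t /=; rewrite !in_itv/= ltrBrDr lerBlDr.
rewrite !lebesgue_measure_itv/= !lte_fin ltrD2r; case: ifP => // _.
by rewrite -!EFinB; congr (_%:E); ring.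
Qed.

Lemma integral_shift (u : R) (f : R -> \bar R) : measurable_fun setT f ->
  (forall t, (0 <= f t)%E) -> (\int[mu]_t f (t - u)%R = \int[mu]_t f t)%E.
Proof.
move=> mf f0.
have ms : measurable_fun [set: measurableTypeR R]
    (fun t : measurableTypeR R => t - u : measurableTypeR R).
  by apply: measurable_funB => //; exact: measurable_cst.
have := @ge0_integral_pushforward _ _ _ _ R _ ms mu setT f measurableT mf (fun t _ => f0 t).
rewrite preimage_setT => <-.
by apply: eq_measure_integral => A mA _; exact: lebesgue_measure_shift.
Qed.

End translation.

(** * Predictability *)

Section point_process_basics.
Context (d : measure_display) (Omega : measurableType d) (R : realType).
Variables (tau : nat -> Omega -> \bar R) (xi : nat -> Omega -> R).
Hypothesis pp : is_point_process tau xi.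

Lemma tau_mono m n w : (m <= n)%N -> (tau m w <= tau n w)%E.
Proof.
elim: n => [|n IH]; first by rewrite leqn0 => /eqP ->.
rewrite leq_eqVlt => /predU1P[->//|]; rewrite ltnS => /IH h.
exact: le_trans h (pp_time_le pp n w).
Qed.

Lemma tau_lt m n w : (m < n)%N -> (tau m w < +oo)%E -> (tau m w < tau n w)%E.
Proof. by move=> mn h; apply: lt_le_trans (tau_mono w mn); exact: (pp_time_lt pp). Qed.

Lemma tau_le_iff m n w : (tau m w < +oo)%E -> (tau m w <= tau n w)%E = (m <= n)%N.
Proof.
move=> h; apply/idP/idP => [|mn]; last exact: tau_mono.
apply: contraTT; rewrite -ltnNge -ltNge => nm.
by apply: tau_lt => //; apply: le_lt_trans h; apply: tau_mono; exact: ltnW.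
Qed.

Lemma tau_gt t w : exists n, (t%:E < tau n w)%E.
Proof.
have [n _ h] := cvgey_gt (pp_locally_finite pp w) t.
by exists n; exact: h (leqnn n).
Qed.

Lemma fine_tau n w : (tau n w < +oo)%E -> (fine (tau n w))%:E = tau n w.
Proof. by move=> h; rewrite fineK// ge0_fin_numE// (pp_time_ge0 pp). Qed.

Lemma N_count_sum n t (A : set R) w : (t%:E < tau n w)%E ->
  N_count tau xi t A w =
  (\sum_(m < n) (((tau m w <= t%:E)%E && (xi m w \in A))%:R : R))%:E.
Proof.
move=> nt; rewrite /N_count (nneseries_split 0 n)//.
rewrite add0n eseries0 ?adde0; first by rewrite big_mkord sumEFin.
move=> k nk _ /=; suff -> : (tau k w <= t%:E)%E = false by [].
by apply/negbTE; rewrite -ltNge; apply: lt_le_trans nt (tau_mono w nk).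
Qed.

Lemma N_count_mono n t (A : set R) w :
  ((\sum_(m < n) (((tau m w <= t%:E)%E && (xi m w \in A))%:R : R))%:E <=
   N_count tau xi t A w)%E.
Proof.
rewrite -sumEFin; have := big_mkord xpredT (fun m =>
  ((((tau m w <= t%:E)%E && (xi m w \in A))%:R : R)%:E)) => <-.
exact: nneseries_lim_ge.
Qed.

Lemma xi_I01 n w : xi n w \in I01 R.
Proof. by rewrite inE/= in_itv/= (pp_location01 pp). Qed.

(** This is how event times enter the history, which knows only counts. The index starts at 0, so
    event [n] is the event number [n.+1]. *)
Lemma tau_le_count n t w :
  (tau n w <= t%:E)%E = (n.+1%:R%:E <= N_count tau xi t (I01 R) w)%E.
Proof.
apply/idP/idP => h.
  apply: le_trans (N_count_mono n.+1 t (I01 R) w).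
  rewrite lee_fin -[n.+1 in leLHS]card_ord -sumr_const; apply: ler_sum => m _.
  by rewrite xi_I01 andbT (le_trans (tau_mono _ _) h)// -ltnS.
apply: contraTT h; rewrite -!ltNge => h; rewrite (N_count_sum _ h) lte_fin.
apply: (@le_lt_trans _ _ (\sum_(m < n) 1)); last by rewrite sumr_const card_ord ltr_nat.
by apply: ler_sum => m _; case: (_ && _).
Qed.

(** The constant value of the count on [A] between [tau n] and [tau n.+1]. It depends on the
    locations alone, which lets [pmeas_xi] recover them from counts. *)
Definition loc_count n (A : set R) w : nat := \sum_(m < n.+1) (xi m w \in A).

Lemma N_count_loc n t (A : set R) w : (tau n w <= t%:E)%E -> (t%:E < tau n.+1 w)%E ->
  N_count tau xi t A w = (loc_count n A w)%:R%:E.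
Proof.
move=> h1 h2; rewrite (N_count_sum _ h2) natr_sum; congr (_%:E).
apply: eq_bigr => m _; rewrite (le_trans (tau_mono _ _) h1)// -ltnS.
exact: ltn_ord.
Qed.

End point_process_basics.

Section predictability.
Context (d : measure_display) (Omega : measurableType d) (R : realType).
Variables (tau : nat -> Omega -> \bar R) (xi : nat -> Omega -> R).
Hypothesis pp : is_point_process tau xi.

Notation PT := (g_sigma_algebraType (predictable_rectangle tau xi)).
Notation pmeas := (@measurable _ PT).
Notation Dom := ([set z : Omega * R * R | 0 <= z.1.2 /\ 0 <= z.2 <= 1]).

Lemma history_N t s (A : set R) (B : set (\bar R)) : 0 <= t <= s ->
  measurable A -> A `<=` I01 R -> measurable B ->
  history tau xi s (N_count tau xi t A @^-1` B).
Proof. by move=> ts mA AI mB; apply: sub_sigma_algebra; exists t, A, B. Qed.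

(** Names the generators of [history], so that the general sigma-algebra lemmas apply to it through
    [g_sigma_algebraType]. *)
Definition history_gen s : set (set Omega) :=
  [set E | exists u (A : set R) (B : set (\bar R)),
         [/\ 0 <= u <= s, measurable A, A `<=` (I01 R), measurable B
           & E = N_count tau xi u A @^-1` B]].

Lemma history_T s : history tau xi s setT.
Proof. exact: (@measurableT _ (g_sigma_algebraType (history_gen s))). Qed.

Lemma history_I s E F : history tau xi s E -> history tau xi s F -> history tau xi s (E `&` F).
Proof. exact: (@measurableI _ (g_sigma_algebraType (history_gen s))). Qed.

Lemma pmeas_ray (q : R) F : 0 <= q -> history tau xi q F ->
  pmeas (Dom `&` [set z | F z.1.1 /\ q < z.1.2]).
Proof.
move=> q0 hF; rewrite (_ : _ `&` _ =
    \bigcup_n ((F `*` `]q, q + n%:R]%classic) `*` I01 R)).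
  apply: bigcupT_measurable => n; apply: sub_sigma_algebra.
  exists F, (I01 R); split; [exact: measurable_itv|by []|left].
  by exists q, (q + n%:R); split => //; rewrite lerDl.
apply/seteqP; split => [[[w s] x] /= [[s0 x01] [Fw qs]]|[[w s] x] [n _] /= [[Fw]]].
  exists (Num.truncn (s - q)).+1 => //=; rewrite !in_itv/= x01 qs/=; split => //; split => //.
  by rewrite -lerBlDl ltW// truncnS_gt.
by rewrite !in_itv/= => /andP[qs _] x01; split=> //; split => //; rewrite ltW// (le_lt_trans q0).
Qed.


Lemma pmeas_line0 (B : set R) : measurable B ->
  pmeas (Dom `&` [set z | z.1.2 = 0 /\ B z.2]).
Proof.
move=> mB; apply: sub_sigma_algebra; exists setT, (B `&` I01 R); split.
- by apply: measurableI => //; exact: measurable_itv.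
- by move=> x [].
- right; split; first exact: history_T.
  apply/seteqP; split => [[[w s] x] /= [[s0 x01] [-> Bx]]|[[w s] x] /= [[_ ->] [Bx x01]]].
    by rewrite in_itv/= x01.
  by move: x01; rewrite in_itv/= => x01.
Qed.

Lemma pmeas_loc (B : set R) : measurable B -> pmeas (Dom `&` [set z | B z.2]).
Proof.
move=> mB; rewrite (_ : _ `&` _ = (Dom `&` [set z | z.1.2 = 0 /\ B z.2]) `|`
    \bigcup_n ((setT `*` `]0, n%:R]%classic) `*` (B `&` I01 R))).
  apply: measurableU; first exact: pmeas_line0.
  apply: bigcupT_measurable => n; apply: sub_sigma_algebra.
  exists setT, (B `&` I01 R); split.
  - by apply: measurableI => //; exact: measurable_itv.
  - by move=> x [].
  - by left; exists 0, n%:R; split => //; exact: history_T.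
apply/seteqP; split => [[[w s] x] /= [[s0 x01] Bx]|[[w s] x]].
  have [sp|sn] := ltP 0 s; last first.
    have s_0 : s = 0 by apply/eqP; rewrite eq_le sn s0.
    by left; do ![split].
  right; exists (Num.truncn s).+1 => //=; rewrite !in_itv/= x01 sp/=; split => //.
  by split=> //; rewrite ltW// truncnS_gt.
move=> [[[s0 x01] [_ Bx]]//|[n _] /= [[_ +] [Bx +]]].
by rewrite !in_itv/= => /andP[s0 _] x01; rewrite ltW.
Qed.

Lemma pmeas_Dom : pmeas Dom.
Proof.
have := pmeas_loc (@measurableT _ R); congr pmeas.
by apply/seteqP; split => z //= [].
Qed.

Lemma pmeas_time : measurable_fun (Dom : set PT) (fun z => z.1.2).
Proof.
apply: (measurability (@RGenOInfty.G R)); first exact: RGenOInfty.measurableE.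
move=> _ [_ [q ->] <-].
have [q0|q0] := leP 0 q.
  have := pmeas_ray q0 (@history_T q); congr pmeas.
  by apply/seteqP; split => z /=; rewrite in_itv/= andbT => -[? []].
have := pmeas_Dom; congr pmeas; apply/seteqP; split => z /=; rewrite in_itv/= andbT.
  by move=> [s0 x01]; split => //; exact: lt_le_trans q0 s0.
by case.
Qed.

Lemma history_tau_le n (b q : R) : 0 <= b <= q ->
  history tau xi q [set w | (tau n w <= b%:E)%E].
Proof.
move=> bq; rewrite (_ : [set w | _] =
   N_count tau xi b (I01 R) @^-1` `[n.+1%:R%:E, +oo%E]%classic).
  by apply: history_N => //; exact: emeasurable_itv.
by apply/seteqP; split => w /=; rewrite in_itv/= leey andbT (tau_le_count pp).
Qed.

Lemma history_tau_gt n (b q : R) : 0 <= b <= q ->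
  history tau xi q [set w | (b%:E < tau n w)%E].
Proof.
move=> bq; rewrite (_ : [set w | _] = ~` [set w | (tau n w <= b%:E)%E]).
  exact: (@measurableC _ (g_sigma_algebraType (history_gen q)) _ (history_tau_le n bq)).
by apply/seteqP; split => w /=; rewrite ltNge => /negP.
Qed.

(* A property decided at every rational time between [tau n] and [tau n.+1]
   is predictable after [tau n]. *)
Lemma pmeas_after n (Q : Omega -> Prop) (F : R -> set Omega) :
  (forall q, 0 <= q -> history tau xi q (F q)) ->
  (forall q w, (tau n w <= q%:E)%E -> (q%:E < tau n.+1 w)%E -> F q w <-> Q w) ->
  pmeas (Dom `&` [set z | (tau n z.1.1 < z.1.2%:E)%E /\ Q z.1.1]).
Proof.
move=> hF FQ; rewrite (_ : _ `&` _ = \bigcup_(q : rat) (Dom `&` [set z |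
    (0 <= (ratr q : R) /\ [set w | (tau n w <= (ratr q)%:E)%E] z.1.1 /\
     [set w | ((ratr q)%:E < tau n.+1 w)%E] z.1.1 /\ F (ratr q) z.1.1) /\ ratr q < z.1.2])).
  apply: bigcupT_measurable_rat => q.
  have [q0|q0] := leP 0 (ratr q : R); last first.
    rewrite (_ : _ `&` _ = set0); first exact: measurable0.
    by apply/seteqP; split => // z /= [_ [[]]].
  have qq : 0 <= (ratr q : R) <= ratr q by rewrite q0 lexx.
  have := pmeas_ray q0 (history_I (history_tau_le n qq) (history_I (history_tau_gt n.+1 qq) (hF _ q0))).
  congr pmeas; apply/seteqP; split => z /=.
    by move=> [? [[? [? ?]] ?]].
  by move=> [? [[? [? [? ?]]] ?]].
apply/seteqP; split => [[[w s] x] /= [[s0 x01] [ts Qw]]|z [q _] /= [zD [[q0 [tq [qt Fq]]] qs]]].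
  have tfin : (tau n w < +oo)%E by apply: lt_trans ts _; exact: ltry.
  have tf := fine_tau pp tfin.
  (* Here [u] is the smaller of [s] and the next event time. A rational strictly between [tau n] and
     [u] is then below both, so [F] decides [Q] there and the ray beyond it contains [s]. *)
  have [u [tu us ut]] : exists u : R, [/\ fine (tau n w) < u, u <= s & (u%:E <= tau n.+1 w)%E].
    have [h|h] := leP (s%:E) (tau n.+1 w).
      by exists s; rewrite -lte_fin tf; split.
    have h' : (tau n.+1 w < +oo)%E by apply: lt_trans h _; exact: ltry.
    exists (fine (tau n.+1 w)); rewrite -lte_fin -lee_fin tf (fine_tau pp h'); split => //.
      exact: (pp_time_lt pp).
    exact: ltW.
  have [q] := rat_in_itvoo tu; rewrite in_itv/= => /andP[tq qu].
  exists q => //=.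
  have tq' : (tau n w <= (ratr q)%:E)%E by rewrite -tf lee_fin ltW.
  have qt : ((ratr q)%:E < tau n.+1 w)%E by apply: lt_le_trans ut; rewrite lte_fin.
  have q0 : 0 <= (ratr q : R) by rewrite -lee_fin (le_trans _ tq')// (pp_time_ge0 pp).
  do ![split] => //; first exact/(FQ _ _ tq' qt).
  exact: lt_le_trans qu us.
split => //; split; last exact/(FQ _ _ tq qt).
by apply: le_lt_trans tq _; rewrite lte_fin.
Qed.

Lemma pmeas_tau_lt n : pmeas (Dom `&` [set z | (tau n z.1.1 < z.1.2%:E)%E]).
Proof.
have := @pmeas_after n (fun=> True) (fun=> setT) (fun q _ => @history_T q) (fun _ _ _ _ => conj id id).
by congr pmeas; apply/seteqP; split => z /=; [move=> [? []]|case].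
Qed.

Lemma pmeas_tau_lt_le n (b : R) :
  pmeas (Dom `&` [set z | (tau n z.1.1 < z.1.2%:E)%E /\ (tau n z.1.1 <= b%:E)%E]).
Proof.
have [b0|b0] := leP 0 b; last first.
  rewrite (_ : _ `&` _ = set0); first exact: measurable0.
  apply/seteqP; split => // z [_ [_ h]].
  by have := le_trans (pp_time_ge0 pp _ _) h; rewrite lee_fin leNgt b0.
(* The minimum keeps this event in the history at [q] even when [b > q]. Nothing is lost, because
   [tau n <= q] already holds wherever the test is made. *)
apply: (@pmeas_after n (fun w => (tau n w <= b%:E)%E) (fun q => [set w | (tau n w <= (Num.min q b)%:E)%E])).
  by move=> q q0; apply: history_tau_le; rewrite le_min q0 b0 ge_min lexx.
move=> q w tq _ /=; rewrite EFin_min le_min tq; split => //.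
Qed.

Lemma pmeas_loc_count n (A : set R) c : measurable A -> A `<=` I01 R ->
  pmeas (Dom `&` [set z | (tau n z.1.1 < z.1.2%:E)%E /\ loc_count xi n A z.1.1 = c]).
Proof.
move=> mA AI; apply: (@pmeas_after n (fun w => loc_count xi n A w = c) (fun q => N_count tau xi q A @^-1` [set c%:R%:E])).
  by move=> q q0; apply: history_N => //; rewrite ?q0 ?lexx.
move=> q w h1 h2 /=; rewrite (N_count_loc pp A h1 h2); split => [[]/eqP|->//].
by rewrite eqr_nat => /eqP.
Qed.

(** The location of event [n] lies in [A] exactly when [loc_count] of [A] gains one at index [n].
    The union runs over the value [c] taken before the gain. *)
Lemma pmeas_xi n (A : set R) : measurable A -> A `<=` I01 R ->
  pmeas (Dom `&` [set z | (tau n z.1.1 < z.1.2%:E)%E /\ A (xi n z.1.1)]).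
Proof.
move=> mA AI; case: n => [|n].
  have := pmeas_loc_count 0 1 mA AI; congr pmeas.
  apply/seteqP; split => z /= [zD [h]]; rewrite /loc_count big_ord_recl big_ord0 addn0/=.
    by case: (boolP (xi 0%N z.1.1 \in A)) => // /set_mem.
  by move=> /mem_set ->.
rewrite (_ : _ `&` _ = \bigcup_c
   ((Dom `&` [set z | (tau n.+1 z.1.1 < z.1.2%:E)%E /\ loc_count xi n.+1 A z.1.1 = c.+1]) `&`
    (Dom `&` [set z | (tau n z.1.1 < z.1.2%:E)%E /\ loc_count xi n A z.1.1 = c]))).
  by apply: bigcupT_measurable => c; apply: measurableI; exact: pmeas_loc_count.
apply/seteqP; split => [z [zD [h Az]]|z [c _] [[zD [h E1]] [_ [_ E2]]]].
  exists (loc_count xi n A z.1.1) => //; split; split => //; split => //.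
    by rewrite /loc_count big_ord_recr/= mem_set// addn1.
  by apply: le_lt_trans h; exact: (pp_time_le pp).
split => //; split => //; move: E1 E2.
rewrite /loc_count big_ord_recr/= => + E2; rewrite E2 => /eqP; rewrite -[c.+1]addn1 eqn_add2l.
by case: (boolP (xi n.+1 z.1.1 \in A)) => // /set_mem.
Qed.

(** Predictable stand-ins for [tau n] and [xi n]: the default 0 is kept until the event lies
    strictly in the past, so nothing about the future is revealed. *)
Definition past_time n (z : Omega * R * R) : R :=
  if (tau n z.1.1 < z.1.2%:E)%E then fine (tau n z.1.1) else 0.
Definition past_loc n (z : Omega * R * R) : R :=
  if (tau n z.1.1 < z.1.2%:E)%E then xi n z.1.1 else 0.

Lemma pmeas_past n : measurable_fun (Dom : set PT) (fun z => (tau n z.1.1 < z.1.2%:E)%E).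
Proof.
apply: (measurable_fun_bool true).
by have := pmeas_tau_lt n; congr pmeas; apply/seteqP; split => z /=.
Qed.

Lemma pmeas_past_time n : measurable_fun (Dom : set PT) (past_time n).
Proof.
apply: (measurability (@RGenOInfty.G R)); first exact: RGenOInfty.measurableE.
move=> _ [_ [b ->] <-].
have [b0|b0] := leP 0 b; last first.
  have := pmeas_Dom; congr pmeas; apply/seteqP; split => z /=; rewrite in_itv/= andbT; last by case.
  move=> zD; split => //; apply: lt_le_trans b0 _; rewrite /past_time.
  by case: ifP => // _; rewrite fine_ge0// (pp_time_ge0 pp).
have := measurableD (pmeas_tau_lt n) (pmeas_tau_lt_le n b); congr pmeas.
apply/seteqP; split => z /=; rewrite in_itv/= andbT /past_time.
  move=> [[zD h] nb]; split => //; rewrite h ltNge; apply/negP => nb'; apply: nb.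
  split => //; split => //; rewrite -(fine_tau pp) ?lee_fin//.
  by apply: lt_trans h _; exact: ltry.
case: ifPn => h [zD bt]; last by move: bt; rewrite ltNge b0.
split => // -[_ [_]]; rewrite -(fine_tau pp).
  by rewrite lee_fin leNgt bt.
by apply: lt_trans h _; exact: ltry.
Qed.

Lemma pmeas_past_loc n : measurable_fun (Dom : set PT) (past_loc n).
Proof.
move=> _ B mB.
have mB' : measurable (B `&` I01 R) by apply: measurableI => //; exact: measurable_itv.
have m1 := pmeas_xi n mB' (@subIsetr _ _ _).
have m2 : pmeas (Dom `\` (Dom `&` [set z | (tau n z.1.1 < z.1.2%:E)%E])).
  by apply: measurableD; [exact: pmeas_Dom|exact: pmeas_tau_lt].
(* If [B] contains the default value 0, the preimage also includes all points at which event [n] has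
   not yet occurred. *)
have [B0|B0] := pselect (B 0).
  have := measurableU _ _ m1 m2; congr pmeas; apply/seteqP; split => z /=; rewrite /past_loc.
    by move=> [[zD [-> []]]//|[zD nz]]; split=> //; case: ifPn => // h; case: nz.
  case: ifPn => h [zD Bz]; [left|right]; split => //.
    by split => //; split => //; have := xi_I01 pp n z.1.1; rewrite inE.
  by move=> [_]; apply/negP.
move: m1; congr pmeas; apply/seteqP; split => z /=; rewrite /past_loc.
  by move=> [zD [-> []]].
case: ifPn => h [zD Bz] //; split => //; split => //; split => //.
by have := xi_I01 pp n z.1.1; rewrite inE.
Qed.

(** Term by term, the summand is a measurable function of the current time, [past_time n] and
    [past_loc n]. The dependence of [f] on the current time is what allows kernels such as the
    accumulated mass of [h] at the present. *)
Lemma predictable_past_sum (f : R * (R * R) -> \bar R) : measurable_fun setT f ->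
  (forall z, (0 <= f z)%E) ->
  predictable tau xi (fun z => event_sum tau xi
    (fun u y => if (u < z.1.2)%R then f (z.1.2, (u, y)) else 0%E) z.1.1).
Proof.
move=> mf f0.
pose g n (z : Omega * R * R) := if (tau n z.1.1 < z.1.2%:E)%E
   then f (z.1.2, (past_time n z, past_loc n z)) else 0%E.
rewrite /predictable (_ : (fun z => _) = (fun z => \sum_(0 <= n <oo | n \in xpredT) g n z)%E).
  apply: (@ge0_emeasurable_sum _ PT R) => [n z _ _|n _]; first by rewrite /g; case: ifP.
  pose T : set PT := Dom.
  have mT : measurable T by exact: pmeas_Dom.
  have ms : measurable_fun setT ((fun z : PT => z.1.2) \_ T).
    by apply/(measurable_restrictT _ mT); exact: pmeas_time.
  have mt : measurable_fun setT ((past_time n : PT -> R) \_ T).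
    by apply/(measurable_restrictT _ mT); exact: pmeas_past_time.
  have mx : measurable_fun setT ((past_loc n : PT -> R) \_ T).
    by apply/(measurable_restrictT _ mT); exact: pmeas_past_loc.
  have := measurableT_comp mf (measurable_fun_pair ms (measurable_fun_pair mt mx)) => mg.
  apply: measurable_fun_if => //; first exact: pmeas_past.
  have mTt : measurable (T `&` (fun z => (tau n z.1.1 < z.1.2%:E)%E) @^-1` [set true]).
    by have := pmeas_tau_lt n; congr pmeas; apply/seteqP; split => z.
  apply: (@eq_measurable_fun _ _ PT _ _ _ _ _ (measurable_funTS mg)).
  by move=> z; rewrite inE => -[zT _]; rewrite /= !patchE mem_set.
apply/funext => z; rewrite /event_sum; apply: eq_eseriesr => n _; rewrite /g /past_time /past_loc.
have [h|h] := ltP (tau n z.1.1) (+oo)%E; last first.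
  by rewrite ltNge (le_trans _ h)// leey.
have -> : (tau n z.1.1 < z.1.2%:E)%E = (fine (tau n z.1.1) < z.1.2).
  by rewrite -{1}(fine_tau pp h) lte_fin.
by case: ifP.
Qed.

End predictability.

(** * Tonelli on measurable rectangles *)

Section tonelli.
Local Open Scope ereal_scope.
Context d1 d2 (T1 : measurableType d1) (T2 : measurableType d2) (R : realType).
Variable m1 : {sigma_finite_measure set T1 -> \bar R}.
Variable m2 : {sigma_finite_measure set T2 -> \bar R}.
Variables (D1 : set T1) (D2 : set T2).
Hypotheses (mD1 : measurable D1) (mD2 : measurable D2).
Variable f : T1 * T2 -> \bar R.
Hypothesis mf : measurable_fun setT f.
Hypothesis f0 : forall z, 0 <= f z.

Let g : T1 * T2 -> \bar R := f \_ (D1 `*` D2).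

Let mg : measurable_fun setT g.
Proof.
apply/(measurable_restrictT _ (measurableX mD1 mD2)); exact: measurable_funTS.
Qed.

Let g0 z : 0 <= g z.
Proof. by rewrite /g patchE; case: ifP. Qed.

Lemma tonelli_in : \int[m1]_(x in D1) \int[m2]_(y in D2) f (x, y) =
  \int[m2]_(y in D2) \int[m1]_(x in D1) f (x, y).
Proof.
have H := fubini_tonelli (m1 := m1) (m2 := m2) g mg g0.
transitivity (\int[m1]_x \int[m2]_y g (x, y)).
  rewrite integral_mkcond; apply: eq_integral => x _; rewrite patchE.
  case: ifPn => xD.
    rewrite integral_mkcond; apply: eq_integral => y _; rewrite /g !patchE.
    by rewrite in_setX xD.
  by rewrite integral0_eq// => y _; rewrite /g patchE in_setX (negbTE xD).
rewrite H [RHS]integral_mkcond; apply: eq_integral => y _; rewrite patchE.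
case: ifPn => yD.
  rewrite [RHS]integral_mkcond; apply: eq_integral => x _; rewrite /g !patchE.
  by rewrite in_setX yD andbT.
by rewrite integral0_eq// => x _; rewrite /g patchE in_setX (negbTE yD) andbF.
Qed.

Lemma measurable_integral_in : measurable_fun setT (fun x => \int[m2]_(y in D2) f (x, y)).
Proof.
pose k : T1 * T2 -> \bar R := f \_ (setT `*` D2).
have mk : measurable_fun setT k.
  by apply/(measurable_restrictT _ (measurableX measurableT mD2)); exact: measurable_funTS.
have k0 z : 0 <= k z by rewrite /k patchE; case: ifP.
have H := measurable_fun_fubini_tonelli_F (m2 := m2) k mk k0.
apply: (eq_measurable_fun _ _ H) => x _; rewrite /fubini_F [RHS]integral_mkcond.
by apply: eq_integral => y _; rewrite /k !patchE in_setX in_setT.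
Qed.

End tonelli.
Arguments tonelli_in {d1 d2 T1 T2 R m1 m2 D1 D2} mD1 mD2 f mf f0.
Arguments measurable_integral_in {d1 d2 T1 T2 R m2 D2} mD2 f mf f0.

(** * Sums over events *)

Section event_sums.
Local Open Scope ereal_scope.
Context (d : measure_display) (Omega : measurableType d) (R : realType).
Variables (tau : nat -> Omega -> \bar R) (xi : nat -> Omega -> R).
Hypothesis pp : is_point_process tau xi.
Local Notation es := (event_sum tau xi).
Implicit Types f g : R -> R -> \bar R.

Definition nsum (n : nat) (f : R -> R -> \bar R) (w : Omega) : \bar R :=
  \sum_(m < n.+1) (if tau m w < +oo then f (fine (tau m w)) (xi m w) else 0).

Lemma event_sum_ge0 f w : (forall s y, 0 <= f s y) -> 0 <= es f w.
Proof. by move=> f0; apply: nneseries_ge0 => n _ _; case: ifP. Qed.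

Lemma le_event_sum f g w : (forall s y, 0 <= f s y) ->
  (forall n, tau n w < +oo -> f (fine (tau n w)) (xi n w) <= g (fine (tau n w)) (xi n w)) ->
  es f w <= es g w.
Proof.
move=> f0 fg; apply: lee_nneseries => n _; first by case: ifP.
by case: ifP => // h; exact: fg.
Qed.

Lemma eq_event_sum f g w :
  (forall n, tau n w < +oo -> f (fine (tau n w)) (xi n w) = g (fine (tau n w)) (xi n w)) ->
  es f w = es g w.
Proof.
by move=> fg; apply: eq_eseriesr => n _; case: ifP => // h; exact: fg.
Qed.

Lemma event_sumZ (k : R) f w : (forall s y, 0 <= f s y) ->
  es (fun s y => k%:E * f s y) w = k%:E * es f w.
Proof.
move=> f0; rewrite -nneseriesZl; last by move=> n _; case: ifP.
by apply: eq_eseriesr => n _; case: ifP; rewrite ?mule0.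
Qed.

Lemma event_sum_trunc n f w :
  (forall m, (n < m)%N -> tau m w < +oo -> f (fine (tau m w)) (xi m w) = 0) ->
  (forall s y, 0 <= f s y) ->
  es f w = nsum n f w.
Proof.
move=> fn f0; rewrite /event_sum (nneseries_split 0 n.+1); last first.
  by move=> m _; case: ifP.
rewrite add0n eseries0 ?adde0 ?big_mkord// => m nm _.
by case: ifP => // h; exact: fn.
Qed.

(** Links two ways of stopping: cutting at the time [tau n], which is predictable, and keeping the
    first [n + 1] terms, which is a finite sum. They agree because finite event times increase
    strictly. *)
Lemma event_sum_stop n f w : (forall s y, 0 <= f s y) ->
  es (fun s y => if s%:E <= tau n w then f s y else 0) w = nsum n f w.
Proof.
move=> f0; rewrite (@event_sum_trunc n).
- apply: eq_bigr => m _; case: ifP => // h; rewrite (fine_tau pp h).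
  by rewrite (tau_le_iff pp)// -ltnS ltn_ord.
- move=> m nm h; rewrite (fine_tau pp h) (tau_le_iff pp)//.
  by rewrite leqNgt nm.
- by move=> s y; case: ifP.
Qed.

(** The parameter ranges over any measurable space with a map [om] to [Omega], so one statement
    yields measurability jointly in outcome, time and location, or along a fixed path. *)
Lemma measurable_event_sum dT (T : measurableType dT) (om : T -> Omega)
    (f : T * (R * R) -> \bar R) : measurable_fun setT om ->
  measurable_fun setT f -> (forall z, 0 <= f z) ->
  measurable_fun setT (fun z => es (fun s y => f (z, (s, y))) (om z)).
Proof.
move=> mom mf f0; pose g n z :=
  if tau n (om z) < +oo then f (z, (fine (tau n (om z)), xi n (om z))) else 0.
rewrite (_ : (fun z => _) = (fun z => \sum_(0 <= n <oo | n \in xpredT) g n z)) //.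
apply: ge0_emeasurable_sum => [n z _ _|n _]; first by rewrite /g; case: ifP.
have mt : measurable_fun setT (tau n \o om).
  exact: measurableT_comp (pp_time_measurable pp n) mom.
apply: measurable_fun_ifT => //.
  by apply: measurable_fun_lte => //.
apply: (measurableT_comp mf); apply: measurable_fun_pair => //.
apply: measurable_fun_pair; first exact: measurableT_comp mt.
exact: measurableT_comp (pp_location_measurable pp n) mom.
Qed.

Lemma integral_event_sum dT (T : measurableType dT) (m : {measure set T -> \bar R})
    (D : set T) (f : T -> R -> R -> \bar R) w : measurable D ->
  (forall s y, measurable_fun D (fun x => f x s y)) -> (forall x s y, 0 <= f x s y) ->
  \int[m]_(x in D) es (f x) w = es (fun s y => \int[m]_(x in D) f x s y) w.
Proof.
move=> mD mf f0; rewrite /event_sum integral_nneseries//.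
- apply: eq_eseriesr => n _; case: ifP => h; first by apply: eq_integral => x _.
  by apply: integral0_eq => x _.
- by move=> n; case: (tau n w < +oo) => //; exact: measurable_cst.
- by move=> n x _; case: ifP.
Qed.

End event_sums.

(** * Mean of the process *)

Section parameters.
Variable R : realType.
Local Notation mu := (@lebesgue_measure R).

(** Parameters given on the whole line. The kernel [h] vanishes on nonpositive times, which encodes
    causality, and [a] is its total mass. *)
Record hawkes_params (l h : R -> R) (W : R -> R -> R) (C a : R) : Prop := HawkesParams {
  par_l_meas : measurable_fun setT l ;
  par_l_ge0 : forall x, 0 <= l x ;
  par_l_L1 : L1 l ;
  par_h_meas : measurable_fun setT h ;
  par_h_ge0 : forall t, 0 <= h t ;
  par_h_neg : forall t, t <= 0 -> h t = 0 ;
  par_h_int : (\int[mu]_t (h t)%:E = a%:E)%E ;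
  par_W_meas : measurable_fun setT (fun z : R * R => W z.1 z.2) ;
  par_W_ge0 : forall x y, 0 <= W x y ;
  par_W_le : forall x y, W x y <= C }.

End parameters.

(** * The intensity tested against functions and stopped at an event *)

Section stopped_intensity.
Local Open Scope ereal_scope.
Context (d : measure_display) (Omega : measurableType d) (R : realType).
Variable P : probability Omega R.
Variables (tau : nat -> Omega -> \bar R) (xi : nat -> Omega -> R).
Hypothesis pp : is_point_process tau xi.
Local Notation es := (event_sum tau xi).
Local Notation nsum := (nsum tau xi).
Local Notation mu := (@lebesgue_measure R).
Variables (l h : R -> R) (W : R -> R -> R) (C a : R).
Hypothesis par : hawkes_params l h W C a.
Let l_meas := par_l_meas par.
Let l_ge0 := par_l_ge0 par.
Let l_L1 := par_l_L1 par.
Let h_meas := par_h_meas par.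
Let h_ge0 := par_h_ge0 par.
Let W_meas := par_W_meas par.
Let W_ge0 := par_W_ge0 par.
Let W_le := par_W_le par.

(** The test [s < t] of [hawkes_intensity] is absorbed by the vanishing of [h] on nonpositive times;
    [lam_patch] makes the comparison. *)
Definition lam (t x : R) (w : Omega) : \bar R :=
  (l x)%:E + es (fun s y => (W x y * h (t - s))%:E) w.

Hypothesis intensity : has_conditional_intensity P tau xi lam.

(** The transposed kernel without the factor [a], because time has not been integrated yet;
    integrating [h] turns it into [kap] (see [kapE]). *)
Definition vphi (phi : R -> R) : R -> R := Kop (fun x y => W y x) 1 phi.

(* [ell phi t] is the integral of [phi * lam t] (see [ell_lam]), with the sum
   over events outermost so that it is visibly predictable. *)
Definition ell (phi : R -> R) (t : R) (w : Omega) : \bar R :=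
  (pairing phi l)%:E + es (fun u y => (vphi phi y * h (t - u))%:E) w.

(** The inequality is not strict: event [n] itself is kept, and the indicator is left-continuous in
    time, hence predictable. *)
Definition ind (n : nat) (t : R) (w : Omega) : \bar R :=
  if t%:E <= tau n w then 1 else 0.

Lemma ind_ge0 n t w : 0 <= ind n t w.
Proof. by rewrite /ind; case: ifP. Qed.

Let Wh0 x y t s : 0 <= (W x y * h (t - s))%:E.
Proof. by rewrite lee_fin mulr_ge0. Qed.

Lemma lam_ge0 t x w : 0 <= lam t x w.
Proof. by apply: adde_ge0; [rewrite lee_fin|apply: event_sum_ge0 => s y]. Qed.

Let W_meas' := measurable_transpose W_meas.

Lemma test_vphi phi : test_fun phi -> test_fun (vphi phi).
Proof. exact: (test_kap W_meas W_ge0 W_le ler01). Qed.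

Lemma ell_ge0 phi t w : test_fun phi -> 0 <= ell phi t w.
Proof.
move=> tp; apply: adde_ge0; first by rewrite lee_fin pairing_ge0.
by apply: event_sum_ge0 => s y; rewrite lee_fin mulr_ge0// (test_ge0 (test_vphi tp)).
Qed.

Lemma measurable_lam : measurable_fun setT
  (fun z : Omega * R * R => lam z.1.2 z.2 z.1.1).
Proof.
apply: emeasurable_funD.
  by apply/measurable_EFinP; exact: measurableT_comp l_meas measurable_snd.
apply: (measurable_event_sum pp (om := fun z : Omega * R * R => z.1.1)
  (f := fun q : (Omega * R * R) * (R * R) => (W q.1.2 q.2.2 * h (q.1.1.2 - q.2.1))%:E)).
- exact: measurableT_comp measurable_fst.
- apply/measurable_EFinP; apply: measurable_funM.
    apply: (@measurableT_comp _ _ _ _ _ _ (fun z : R * R => W z.1 z.2) _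
      (fun q : (Omega * R * R) * (R * R) => (q.1.2, q.2.2))) => //.
    by apply: measurable_fun_pair; apply: measurableT_comp.
  apply: measurableT_comp => //; apply: measurable_funB.
    by apply: measurableT_comp => //; apply: measurableT_comp.
  by apply: measurableT_comp.
- by move=> z.
Qed.

Lemma measurable_ell phi : test_fun phi -> measurable_fun setT
  (fun z : Omega * R => ell phi z.2 z.1).
Proof.
move=> tp; apply: emeasurable_funD; first exact: measurable_cst.
apply: (measurable_event_sum pp (om := fun z : Omega * R => z.1)
  (f := fun q : (Omega * R) * (R * R) => (vphi phi q.2.2 * h (q.1.2 - q.2.1))%:E)).
- exact: measurable_fst.
- apply/measurable_EFinP; apply: measurable_funM.
    apply: (measurableT_comp (test_meas (test_vphi tp))).
    by apply: measurableT_comp.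
  apply: measurableT_comp => //; apply: measurable_funB.
    by apply: measurableT_comp.
  by apply: measurableT_comp.
- by move=> z; rewrite lee_fin mulr_ge0// (test_ge0 (test_vphi tp)).
Qed.

Lemma measurable_ind n : measurable_fun setT (fun z : Omega * R => ind n z.2 z.1).
Proof.
rewrite /ind (_ : (fun z => _) =
  (fun z : Omega * R => if tau n z.1 < z.2%:E then 0 else 1)); last first.
  by apply/funext => z; rewrite ltNge; case: ifP.
apply: measurable_fun_ifT => //; apply: measurable_fun_lte.
  apply: (measurableT_comp (pp_time_measurable pp n)); exact: measurable_fst.
by apply/measurable_EFinP; exact: measurable_snd.
Qed.

Lemma ell_lam phi t w : test_fun phi ->
  \int[mu]_(x in I01 R) ((phi x)%:E * lam t x w) = ell phi t w.
Proof.
move=> tp.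
have mW y : measurable_fun setT (fun x => W x y).
  by apply: (measurableT_comp W_meas (measurable_pair2 y)).
under eq_integral => x _ do rewrite /lam ge0_muleDr ?lee_fin// ?event_sum_ge0// -EFinM
   -event_sumZ//.
rewrite ge0_integralD//; last 4 first.
- by move=> x _; rewrite lee_fin mulr_ge0// (test_ge0 tp).
- by apply: measurable_funTS; apply/measurable_EFinP; apply: measurable_funM => //; exact: test_meas tp.
- move=> x _; apply: event_sum_ge0 => s y.
  by rewrite -EFinM lee_fin mulr_ge0 ?(test_ge0 tp)// mulr_ge0.
- apply: measurable_funTS.
  apply: (measurable_event_sum pp (om := fun z : R => w)
   (f := fun q : R * (R * R) => ((phi q.1)%:E * (W q.1 q.2.2 * h (t - q.2.1))%:E))) => //.
    apply: emeasurable_funM; apply/measurable_EFinP.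
      by apply: (measurableT_comp (test_meas tp)); exact: measurable_fst.
    apply: measurable_funM.
      apply: (@measurableT_comp _ _ _ _ _ _ (fun z : R * R => W z.1 z.2) _
        (fun q : R * (R * R) => (q.1, q.2.2))) => //.
      by apply: measurable_fun_pair => //; apply: measurableT_comp.
    apply: measurableT_comp => //; apply: measurable_funB => //.
    by apply: measurableT_comp.
  by move=> z; rewrite -EFinM lee_fin mulr_ge0 ?(test_ge0 tp)// mulr_ge0.
rewrite -(EFin_pairing tp l_L1); congr (_ + _).
rewrite integral_event_sum//; last 2 first.
- move=> s y; apply: measurable_funTS; apply: emeasurable_funM; apply/measurable_EFinP.
    exact: test_meas tp.
  by apply: measurable_funM => //; exact: mW.
- by move=> x s y; rewrite -EFinM lee_fin mulr_ge0 ?(test_ge0 tp)// mulr_ge0.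
apply: eq_event_sum => n _; set s := fine _; set y := xi n w.
have lp := L1_test tp.
rewrite EFinM (EFin_Kop (C := C) 1 W_meas' (fun x y => W_ge0 y x) (fun x y => W_le y x) y lp).
rewrite mul1e muleC -ge0_integralZl//.
- by apply: eq_integral => x _; rewrite -!EFinM; congr (_%:E); ring.
- exact: measurable_int (L1W (C := C) W_meas' (fun x y => W_ge0 y x) (fun x y => W_le y x) y lp).
- by move=> x _; rewrite lee_fin mulr_ge0// (test_ge0 tp).
- by rewrite lee_fin.
Qed.

Notation PT := (g_sigma_algebraType (predictable_rectangle tau xi)).
Notation Dom := ([set z : Omega * R * R | (0 <= z.1.2 /\ 0 <= z.2 <= 1)%R]).

Lemma predictable_stop n (H : Omega * R * R -> \bar R) : predictable tau xi H ->
  predictable tau xi (fun z => if z.1.2%:E <= tau n z.1.1 then H z else 0).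
Proof.
move=> pH; rewrite /predictable (_ : (fun z => _) =
  (fun z => if tau n z.1.1 < z.1.2%:E then 0 else H z)); last first.
  by apply/funext => z; rewrite ltNge; case: ifP.
have mT := @pmeas_Dom _ _ _ tau xi.
have m1 : @measurable _ PT (Dom `&` (fun z => tau n z.1.1 < z.1.2%:E) @^-1` [set true]).
  have := pmeas_tau_lt pp n; congr (@measurable _ PT).
have m2 : @measurable _ PT (Dom `&` (fun z => tau n z.1.1 < z.1.2%:E) @^-1` [set false]).
  have := measurableD mT m1; congr (@measurable _ PT).
  apply/seteqP; split => z /=.
    by move=> [zD nz]; split => //; apply/negP => z1; apply: nz.
  by move=> [zD nz]; split => // -[_]; rewrite nz.
apply: (@measurable_fun_if _ _ PT _ _ _ _ mT) => //.
- exact: (pmeas_past pp n).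
- exact: (@measurable_funS _ _ PT _ _ _ _ _ _ pH).
Qed.

Lemma predictable_time (g : R -> \bar R) : measurable_fun setT g ->
  predictable tau xi (fun z => g z.1.2).
Proof. by move=> mg; exact: (@measurableT_comp _ _ _ PT _ _ g _ _ mg (@pmeas_time _ _ _ tau xi)). Qed.

Lemma predictable_loc (g : R -> \bar R) : measurable_fun setT g ->
  predictable tau xi (fun z => g z.2).
Proof.
move=> mg; apply: (@measurableT_comp _ _ _ PT _ _ g _ (fun z => z.2) mg) => _ B mB.
exact: pmeas_loc.
Qed.

Lemma predictableM (G H : Omega * R * R -> \bar R) : predictable tau xi G ->
  predictable tau xi H -> predictable tau xi (fun z => G z * H z).
Proof. exact: (@emeasurable_funM _ PT). Qed.

Lemma predictableD (G H : Omega * R * R -> \bar R) : predictable tau xi G ->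
  predictable tau xi H -> predictable tau xi (fun z => G z + H z).
Proof. exact: (@emeasurable_funD _ PT). Qed.

(** The defining identity of the intensity for [phi y * G (w, s)] cut at [T] and at [tau n]. As [G]
    does not see the location, the integral over locations collapses to [ell phi]. The choice
    [G = 1] gives means; [past] and [cumul] give second moments. *)
Lemma intensity_stop n (phi : R -> R) (G : Omega * R -> \bar R) (T : R) :
  test_fun phi -> predictable tau xi (fun z => G z.1) -> (forall z, 0 <= G z) ->
  \int[P]_w nsum n (fun s y => if (s <= T)%R then (phi y)%:E * G (w, s) else 0) w =
  \int[P]_w \int[mu]_(t in `[0%R, T]) (ind n t w * (G (w, t) * ell phi t w)).
Proof.
move=> tp pG G0.
pose H (z : Omega * R * R) := if z.1.2%:E <= tau n z.1.1 then
  (if (z.1.2 <= T)%R then 1 else 0) * ((phi z.2)%:E * G z.1) else 0.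
have pH : predictable tau xi H.
  apply: predictable_stop; apply: predictableM.
    apply: (@predictable_time (fun t => if (t <= T)%R then 1 else 0)).
    by apply: measurable_fun_ifT => //; apply: measurable_fun_ler.
  apply: predictableM => //; apply: (predictable_loc (g := EFin \o phi)).
  by apply/measurable_EFinP; exact: test_meas tp.
have phi0 y : 0 <= (phi y)%:E by rewrite lee_fin (test_ge0 tp).
have H0 z : 0 <= H z.
  by rewrite /H; case: ifP => // _; rewrite mule_ge0 ?mule_ge0//; case: ifP.
transitivity (\int[P]_w es (fun s y => H (w, s, y)) w).
  apply: eq_integral => w _; rewrite -(event_sum_stop pp); last first.
    by move=> s y; case: ifP => // _; rewrite mule_ge0.
  apply: eq_event_sum => m _; rewrite /H /=; case: ifP => // _.
  by case: ifP; rewrite ?mul1e ?mul0e.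
rewrite (intensity pH H0); clear intensity pH; apply: eq_integral => w _.
rewrite [RHS]integral_mkcond [LHS]integral_mkcond; apply: eq_integral => t _.
rewrite !patchE /H /=; case: ifPn => t0; last first.
  rewrite ifF//; apply/negbTE; apply: contra t0.
  by rewrite !inE/= !in_itv/= andbT => /andP[].
move: t0; rewrite inE/= in_itv/= andbT => t0.
have -> : (t \in (`[0%R, T]%classic : set R)) = (t <= T)%R.
  by apply/idP/idP; rewrite inE/= in_itv/= t0.
rewrite /ind; case: ifPn => tT; last first.
  by rewrite integral0_eq// => x _; case: ifP; rewrite ?mul0e.
case: ifPn => tn; last by rewrite mul0e integral0_eq// => x _; rewrite mul0e.
rewrite mul1e -(ell_lam t w tp) -ge0_integralZl//.
- by apply: eq_integral => x _; rewrite mul1e [(phi x)%:E * _]muleC muleA.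
- apply: measurable_funTS; apply: emeasurable_funM.
    by apply/measurable_EFinP; exact: test_meas tp.
  exact: (measurableT_comp measurable_lam (measurable_pair1 (w, t))).
- by move=> x _; rewrite mule_ge0// lam_ge0.
Qed.

End stopped_intensity.

(** * Mean density of the stopped process *)

Section mean_density.
Local Open Scope ereal_scope.
Context (d : measure_display) (Omega : measurableType d) (R : realType).
Variable P : probability Omega R.
Variables (tau : nat -> Omega -> \bar R) (xi : nat -> Omega -> R).
Hypothesis pp : is_point_process tau xi.
Local Notation nsum := (nsum tau xi).
Local Notation ind := (ind tau).
Local Notation mu := (@lebesgue_measure R).
Variables (l h : R -> R) (W : R -> R -> R) (C a : R).
Hypothesis par : hawkes_params l h W C a.
Local Notation lam := (lam tau xi l h W).
Hypothesis intensity : has_conditional_intensity P tau xi lam.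

(* Stopping at [tau n] makes the mean finite a priori, as [comparison] requires. *)
Definition mean_density n (T x : R) : \bar R :=
  \int[P]_w \int[mu]_(t in `[0%R, T]) (ind n t w * lam t x w).

Let lam0 t x w : 0 <= lam t x w := lam_ge0 tau xi par t x w.
Let ind0 n t w : 0 <= ind n t w := ind_ge0 tau n t w.

Let measurable_indlam n : measurable_fun setT
  (fun z : Omega * R * R => ind n z.2 z.1.1 * lam z.2 z.1.2 z.1.1).
Proof.
apply: emeasurable_funM.
  apply: (@measurableT_comp _ _ _ _ _ _ (fun z : Omega * R => ind n z.2 z.1) _
    (fun z : Omega * R * R => (z.1.1, z.2)) (measurable_ind pp n)).
  by apply: measurable_fun_pair => //; apply: measurableT_comp.
apply: (@measurableT_comp _ _ _ _ _ _ (fun z : Omega * R * R => lam z.1.2 z.2 z.1.1) _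
    (fun z : Omega * R * R => (z.1.1, z.2, z.1.2)) (measurable_lam pp par)).
by do ![apply: measurable_fun_pair => //; do ?apply: measurableT_comp => //].
Qed.

Let measurable_inner n T : measurable_fun setT
  (fun z : Omega * R => \int[mu]_(t in `[0%R, T]) (ind n t z.1 * lam t z.2 z.1)).
Proof.
apply: (measurable_integral_in (m2 := mu) (measurable_itv `[0%R, T])
  (fun z : Omega * R * R => ind n z.2 z.1.1 * lam z.2 z.1.2 z.1.1)) => //.
  exact: measurable_indlam.
by move=> z; rewrite mule_ge0.
Qed.

Lemma mean_density_ge0 n T x : 0 <= mean_density n T x.
Proof.
by apply: integral_ge0 => w _; apply: integral_ge0 => t _; rewrite mule_ge0.
Qed.

Lemma measurable_mean_density n T : measurable_fun setT (mean_density n T).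
Proof.
have := measurable_integral_in (m2 := P) measurableT (fun z : R * Omega => \int[mu]_(t in `[0%R, T]) (ind n t z.2 * lam t z.1 z.2)).
apply => //.
  apply: (@measurableT_comp _ _ _ _ _ _ (fun z : Omega * R => \int[mu]_(t in `[0%R, T]) (ind n t z.1 * lam t z.2 z.1)) _
    (fun z : R * Omega => (z.2, z.1)) (measurable_inner n T)).
  by apply: measurable_fun_pair.
by move=> z; apply: integral_ge0 => t _; rewrite mule_ge0.
Qed.

(** This is [intensity_stop] with [G = 1], followed by two applications of Tonelli that bring the
    location outermost. *)
Lemma mean_densityE n (g : R -> R) (T : R) : test_fun g ->
  \int[P]_w nsum n (fun s y => if (s <= T)%R then (g y)%:E else 0) w =
  \int[mu]_(x in I01 R) ((g x)%:E * mean_density n T x).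
Proof.
move=> tg; have g0 x : 0 <= (g x)%:E by rewrite lee_fin (test_ge0 tg).
have mg : measurable_fun setT (EFin \o g) by apply/measurable_EFinP; exact: test_meas tg.
pose F (z : Omega * R * R) := (g z.2)%:E * (ind n z.1.2 z.1.1 * lam z.1.2 z.2 z.1.1).
have F0 z : 0 <= F z by rewrite /F !mule_ge0.
have mindlam : measurable_fun setT (fun z : Omega * R * R => ind n z.1.2 z.1.1 * lam z.1.2 z.2 z.1.1).
  apply: emeasurable_funM; last exact: (measurable_lam pp par).
  exact: (measurableT_comp (measurable_ind pp n) measurable_fst).
have mF : measurable_fun setT F.
  apply: emeasurable_funM; last exact: mindlam.
  exact: (measurableT_comp mg measurable_snd).
have := @intensity_stop _ _ _ P _ _ pp _ _ _ _ _ par intensity n g (cst 1) T tg.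
move=> /(_ (@measurable_cst _ _ (g_sigma_algebraType (predictable_rectangle tau xi)) _ _ _)) /(_ (fun _ => lee01)) H.
transitivity (\int[P]_w \int[mu]_(t in `[0%R, T]) \int[mu]_(x in I01 R) F (w, t, x)).
  transitivity (\int[P]_w nsum n (fun s y => if (s <= T)%R then (g y)%:E * cst 1 (w, s) else 0) w).
    apply: eq_integral => w _; apply: eq_bigr => m _; case: ifP => // _; case: ifP => // _.
    by rewrite mule1.
  rewrite H; apply: eq_integral => w _; apply: eq_integral => t _.
  rewrite mul1e -(ell_lam pp par t w tg) -ge0_integralZl//.
  - by apply: eq_integral => x _; rewrite /F muleCA.
  - apply: measurable_funTS; apply: emeasurable_funM => //.
    exact: (measurableT_comp (measurable_lam pp par) (measurable_pair1 (w, t))).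
  - by move=> x _; rewrite mule_ge0.
transitivity (\int[P]_w \int[mu]_(x in I01 R) \int[mu]_(t in `[0%R, T]) F (w, t, x)).
  apply: eq_integral => w _.
  apply: (tonelli_in (m1 := mu) (m2 := mu) (measurable_itv _) (measurable_itv _) (fun z : R * R => F (w, z.1, z.2))) => //.
  apply: (measurableT_comp mF).
  by do ![apply: measurable_fun_pair => //].
have inner w x : \int[mu]_(t in `[0%R, T]) F (w, t, x) =
    (g x)%:E * \int[mu]_(t in `[0%R, T]) (ind n t w * lam t x w).
  rewrite /F /= ge0_integralZl//.
    apply: measurable_funTS.
    apply: (@measurableT_comp _ _ _ _ _ _ (fun z : Omega * R * R => ind n z.1.2 z.1.1 * lam z.1.2 z.2 z.1.1) _ (fun t => (w, t, x)) mindlam).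
    by do ![apply: measurable_fun_pair => //].
  by move=> t _; rewrite mule_ge0.
under eq_integral => w _ do under eq_integral => x _ do rewrite inner.
have int0 x w : 0 <= \int[mu]_(t in `[0%R, T]) (ind n t w * lam t x w).
  by apply: integral_ge0 => t _; rewrite mule_ge0.
rewrite (tonelli_in (m1 := P) (m2 := mu) measurableT (measurable_itv _) (fun z : Omega * R =>
  (g z.2)%:E * \int[mu]_(t in `[0%R, T]) (ind n t z.1 * lam t z.2 z.1)))//.
- apply: eq_integral => x _; rewrite /= ge0_integralZl//.
  exact: (measurableT_comp (measurable_inner n T) (measurable_pair2 x)).
- apply: emeasurable_funM; last exact: measurable_inner.
  exact: (measurableT_comp mg measurable_snd).
- by move=> z; rewrite mule_ge0.
Qed.

End mean_density.

Section mean_density_bound.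
Local Open Scope ereal_scope.
Context (d : measure_display) (Omega : measurableType d) (R : realType).
Variable P : probability Omega R.
Variables (tau : nat -> Omega -> \bar R) (xi : nat -> Omega -> R).
Hypothesis pp : is_point_process tau xi.
Local Notation es := (event_sum tau xi).
Local Notation nsum := (nsum tau xi).
Local Notation ind := (ind tau).
Local Notation mu := (@lebesgue_measure R).
Variables (l h : R -> R) (W : R -> R -> R) (C a : R).
Hypothesis par : hawkes_params l h W C a.
Local Notation lam := (lam tau xi l h W).
Hypothesis intensity : has_conditional_intensity P tau xi lam.

Let h0 t u : 0 <= (h (t - u))%:E.
Proof. by rewrite lee_fin (par_h_ge0 par). Qed.

Lemma measurable_hshift u : measurable_fun setT (fun t : R => (h (t - u))%:E).
Proof.
apply/measurable_EFinP; apply: (measurableT_comp (par_h_meas par)).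
by apply: measurable_funB.
Qed.

Lemma integral_hshift u : \int[mu]_t (h (t - u))%:E = a%:E.
Proof.
rewrite (integral_shift u (f := fun t => (h t)%:E)) ?(par_h_int par)//.
  by apply/measurable_EFinP; exact: par_h_meas par.
by move=> t; rewrite lee_fin (par_h_ge0 par).
Qed.

Lemma a_ge0 : (0 <= a)%R.
Proof. by rewrite -lee_fin -(integral_hshift 0); exact: integral_ge0. Qed.

Lemma integral_hshift_le D u : measurable D -> \int[mu]_(t in D) (h (t - u))%:E <= a%:E.
Proof.
move=> mD; rewrite -(integral_hshift u); apply: ge0_subset_integral => //.
exact: measurable_hshift.
Qed.

Lemma test_Wx x : test_fun (W x).
Proof.
split; [by apply: W_measr; exact: (par_W_meas par)|exact: (par_W_ge0 par)|].
by exists C => y; exact: (par_W_le par).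
Qed.

(** Over all time an event at [y] adds at most [a * W x y] to the integrated intensity at [x]. This
    bounds each path by a stopped sum of [W x] over events, whose mean is again an integral against
    the mean density by [mean_densityE]. *)
Lemma mean_density_le n (T x : R) : (0 <= T)%R ->
  mean_density P tau xi l h W n T x <= (T * l x)%:E +
    a%:E * \int[mu]_(y in I01 R) ((W x y)%:E * mean_density P tau xi l h W n T y).
Proof.
move=> T0; have W0 y : 0 <= (W x y)%:E by rewrite lee_fin (par_W_ge0 par).
rewrite -(mean_densityE pp par intensity n T (test_Wx x)).
have ns0 w : 0 <= nsum n (fun s y => if (s <= T)%R then (W x y)%:E else 0) w.
  by apply: sume_ge0 => m _; case: ifP => // _; case: ifP.
have path w : \int[mu]_(t in `[0%R, T]) (ind n t w * lam t x w) <= (T * l x)%:E +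
    a%:E * nsum n (fun s y => if (s <= T)%R then (W x y)%:E else 0) w.
  have Wh0 t u y : 0 <= (W x y * h (t - u))%:E.
    by rewrite lee_fin mulr_ge0 ?(par_W_ge0 par) ?(par_h_ge0 par).
  have i0 t u y : 0 <= ind n t w * (W x y * h (t - u))%:E by rewrite mule_ge0 ?ind_ge0.
  have mi u y : measurable_fun setT (fun t => ind n t w * (W x y * h (t - u))%:E).
    apply: emeasurable_funM.
      exact: (measurableT_comp (measurable_ind pp n) (measurable_pair1 w)).
    apply/measurable_EFinP; apply: measurable_funM => //; apply/measurable_EFinP.
    exact: measurable_hshift.
  have mes : measurable_fun setT (fun t => es (fun u y => ind n t w * (W x y * h (t - u))%:E) w).
    apply: (measurable_event_sum pp (om := fun _ : R => w) (f := fun q : R * (R * R) =>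
      ind n q.1 w * (W x q.2.2 * h (q.1 - q.2.1))%:E)) => //.
    apply: emeasurable_funM.
      apply: (@measurableT_comp _ _ _ _ _ _ (fun z : Omega * R => ind n z.2 z.1) _
        (fun q : R * (R * R) => (w, q.1)) (measurable_ind pp n)).
      by apply: measurable_fun_pair.
    apply/measurable_EFinP; apply: measurable_funM.
      apply: (measurableT_comp (test_meas (test_Wx x))).
      by apply: measurableT_comp.
    apply: (measurableT_comp (par_h_meas par)); apply: measurable_funB => //.
    by apply: measurableT_comp.
  apply: (@le_trans _ _ (\int[mu]_(t in `[0%R, T])
      ((l x)%:E + es (fun u y => ind n t w * (W x y * h (t - u))%:E) w))).
    apply: ge0_le_integral => //.
    - by move=> t _; rewrite mule_ge0 ?ind_ge0// (lam_ge0 _ _ par).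
    - apply: measurable_funTS; apply: emeasurable_funM.
        exact: (measurableT_comp (measurable_ind pp n) (measurable_pair1 w)).
      apply: (@measurableT_comp _ _ _ _ _ _ (fun z : Omega * R * R => lam z.1.2 z.2 z.1.1) _
        (fun t => (w, t, x)) (measurable_lam pp par)).
      by do ![apply: measurable_fun_pair => //].
    - by apply: measurable_funTS; apply: emeasurable_funD.
    - move=> t _; rewrite /ind; case: ifP => _.
        rewrite mul1e /lam leeD2l// le_eqVlt; apply/orP; left; apply/eqP.
        by apply: eq_event_sum => m _; rewrite mul1e.
      rewrite mul0e adde_ge0 ?lee_fin ?(par_l_ge0 par)//.
      by apply: event_sum_ge0 => s y; rewrite mul0e.
  rewrite ge0_integralD//; last 3 first.
  - by move=> t _; rewrite lee_fin (par_l_ge0 par).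
  - by move=> t _; exact: event_sum_ge0.
  - exact: measurable_funTS.
  apply: leeD.
    rewrite integral_cst// [X in _ * X]lebesgue_measure_itv/= lte_fin.
    case: ltP => T0'; first by rewrite oppr0 adde0 EFinM muleC.
    by rewrite mule0 lee_fin mulr_ge0 ?(par_l_ge0 par).
  rewrite integral_event_sum//; last by move=> s y; apply: measurable_funTS; exact: mi.
  rewrite -(event_sum_stop pp); last by move=> s y; case: ifP.
  rewrite -event_sumZ; last by move=> s y; case: ifP => // _; case: ifP.
  apply: le_event_sum => [s y|m _]; first exact: integral_ge0.
  set u := fine _; set y := xi m w.
  (* An event later than [tau n] or than [T] contributes nothing, because [h] is then evaluated at
     nonpositive times. Any other event contributes at most the full mass [a]. *)
  case: (leP u%:E (tau n w)) => un; last first.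
    rewrite mule0 integral0_eq// => t _; rewrite /ind; case: ifP; rewrite ?mul0e// mul1e => tn.
    rewrite (par_h_neg par) ?mulr0// subr_le0 -lee_fin; apply: le_trans tn _.
    exact: ltW.
  case: (leP u T) => uT; last first.
    rewrite mule0 integral0_eq// => t; rewrite /= in_itv/= => /andP[_ tT].
    by rewrite (par_h_neg par) ?mulr0 ?mule0// subr_le0 (le_trans tT)// ltW.
  apply: (@le_trans _ _ (\int[mu]_(t in `[0%R, T]) ((W x y)%:E * (h (t - u))%:E))).
    apply: ge0_le_integral => //.
    - by apply: measurable_funTS; exact: mi.
    - by apply: measurable_funTS; apply: emeasurable_funM; [exact: measurable_cst|exact: measurable_hshift].
    - move=> t _; rewrite EFinM /ind; case: ifP; rewrite ?mul1e// mul0e => _.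
      by rewrite mule_ge0.
  rewrite ge0_integralZl//; last by apply: measurable_funTS; exact: measurable_hshift.
  by rewrite muleC lee_wpmul2r//; exact: integral_hshift_le.
have mns : measurable_fun setT (nsum n (fun s y => if (s <= T)%R then (W x y)%:E else 0)).
  apply: emeasurable_sum => m.
  have mt := pp_time_measurable pp m; have mx := pp_location_measurable pp m.
  apply: measurable_fun_ifT => //; first by apply: measurable_fun_lte.
  apply: measurable_fun_ifT => //; last first.
    by apply/measurable_EFinP; exact: (measurableT_comp (test_meas (test_Wx x))).
  by apply: measurable_fun_ler => //; exact: measurableT_comp mt.
rewrite /mean_density.
apply: (@le_trans _ _ (\int[P]_w ((T * l x)%:E +
    a%:E * nsum n (fun s y => if (s <= T)%R then (W x y)%:E else 0) w))).
  apply: ge0_le_integral => //.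
  - by move=> w _; apply: integral_ge0 => t _; rewrite mule_ge0 ?ind_ge0// (lam_ge0 _ _ par).
  - apply: (measurable_integral_in (m2 := mu) (measurable_itv `[0%R, T])
     (fun z : Omega * R => ind n z.2 z.1 * lam z.2 x z.1)).
      apply: emeasurable_funM; first exact: (measurable_ind pp n).
      apply: (@measurableT_comp _ _ _ _ _ _ (fun z : Omega * R * R => lam z.1.2 z.2 z.1.1) _
        (fun z : Omega * R => (z.1, z.2, x)) (measurable_lam pp par)).
      by do ![apply: measurable_fun_pair => //].
    by move=> z; rewrite mule_ge0 ?ind_ge0// (lam_ge0 _ _ par).
  - apply: emeasurable_funD => //; apply: emeasurable_funM => //; exact: measurable_cst.
have aE : 0 <= a%:E by rewrite lee_fin a_ge0.
rewrite ge0_integralD//; last 3 first.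
- by move=> w _; rewrite lee_fin mulr_ge0// (par_l_ge0 par).
- by move=> w _; rewrite mule_ge0.
- by apply: emeasurable_funM => //; exact: measurable_cst.
rewrite integral_cst// [X in _ * X + _](_ : _ = 1) ?mule1; last exact: probability_setT.
by rewrite leeD2l// ge0_integralZl//.
Qed.

End mean_density_bound.

Section mean_rate.
Local Open Scope ereal_scope.
Context (d : measure_display) (Omega : measurableType d) (R : realType).
Variable P : probability Omega R.
Variables (tau : nat -> Omega -> \bar R) (xi : nat -> Omega -> R).
Hypothesis pp : is_point_process tau xi.
Local Notation es := (event_sum tau xi).
Local Notation nsum := (nsum tau xi).
Variables (l h : R -> R) (W : R -> R -> R) (C a : R).
Hypothesis par : hawkes_params l h W C a.
Local Notation lam := (lam tau xi l h W).
Hypothesis intensity : has_conditional_intensity P tau xi lam.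

Variable lb : R -> R.
Hypothesis lb_L1 : L1 lb.
Hypothesis lb_ge0 : (forall x, 0 <= x <= 1 -> 0 <= lb x)%R.
Hypothesis lb_eq : (forall x, 0 <= x <= 1 -> lb x = l x + Kop W a lb x)%R.
Hypothesis hK : no_subinvariant W a 1.

Lemma test_cst1 : test_fun (cst (1%R : R)).
Proof. by split => [||]; [exact: measurable_cst|move=> x|exists 1%R => x]. Qed.

Lemma nsum_ge0 n f w : (forall s y, 0 <= f s y) -> 0 <= nsum n f w.
Proof. by move=> f0; apply: sume_ge0 => m _; case: ifP. Qed.

Lemma measurable_count_term phi T m : test_fun phi -> measurable_fun setT
  (fun w => if tau m w < +oo then
    if (fine (tau m w) <= T)%R then (phi (xi m w))%:E else 0 else 0).
Proof.
move=> tp; have mt := pp_time_measurable pp m; have mx := pp_location_measurable pp m.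
apply: measurable_fun_ifT => //; first by apply: measurable_fun_lte.
apply: measurable_fun_ifT => //; last first.
  by apply/measurable_EFinP; exact: (measurableT_comp (test_meas tp)).
by apply: measurable_fun_ler => //; exact: measurableT_comp mt.
Qed.

Lemma nsum_mean_le n (T : R) phi : (0 <= T)%R -> test_fun phi ->
  \int[P]_w nsum n (fun s y => if (s <= T)%R then (phi y)%:E else 0) w <=
  (T * pairing phi lb)%:E.
Proof.
move=> T0 tp; rewrite (mean_densityE pp par intensity)//.
have M0 x : 0 <= mean_density P tau xi l h W n T x by exact: (mean_density_ge0 P tau xi par).
have mM := measurable_mean_density P pp par n T.
apply: (comparison (par_W_meas par) (par_W_ge0 par) (par_W_le par) (a_ge0 par)
  lb_L1 lb_ge0 lb_eq hK) => //.
- exact: measurable_funTS mM.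
(* A priori finiteness: tested against 1, the density integrates to the mean number of events of the
   stopped process up to [T], at most [n + 1]. *)
- have := mean_densityE pp par intensity n T test_cst1.
  under [X in _ = X -> _]eq_integral do rewrite mul1e.
  move=> <-; apply: (@le_lt_trans _ _ (\int[P]_w n.+1%:R%:E)).
    apply: ge0_le_integral => //.
    + by move=> w _; apply: nsum_ge0 => s y; case: ifP => // _; rewrite lee_fin.
    + by apply: emeasurable_sum => m; exact: (measurable_count_term _ _ test_cst1).
    + move=> w _; rewrite /nsum -[n.+1 in leRHS]card_ord -sumr_const -sumEFin.
      by apply: lee_sum => m _; case: ifP => [_|_]; first (case: ifP => _); rewrite lee_fin.
  rewrite integral_cst// [X in _ * X](_ : _ = 1) ?mule1 ?ltry//; exact: probability_setT.
- move=> x x01; exact: (mean_density_le pp par intensity).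
Qed.

Definition ecount (phi : R -> R) (T : R) (w : Omega) : \bar R :=
  es (fun s y => if (s <= T)%R then (phi y)%:E else 0) w.

Lemma ecount_ge0 phi T w : test_fun phi -> 0 <= ecount phi T w.
Proof.
by move=> tp; apply: event_sum_ge0 => s y; case: ifP => // _; rewrite lee_fin (test_ge0 tp).
Qed.

Lemma measurable_ecount phi T : test_fun phi -> measurable_fun setT (ecount phi T).
Proof.
move=> tp; rewrite /ecount.
apply: (measurable_event_sum pp (om := id)
  (f := fun q : Omega * (R * R) => if (q.2.1 <= T)%R then (phi q.2.2)%:E else 0)) => //.
  apply: measurable_fun_ifT => //.
    by apply: measurable_fun_ler => //; apply: measurableT_comp.
  apply/measurable_EFinP; apply: (measurableT_comp (test_meas tp)).
  by apply: measurableT_comp.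
by move=> z; case: ifP => // _; rewrite lee_fin (test_ge0 tp).
Qed.

(** The bound of [nsum_mean_le] does not involve [n], so it passes to the limit of the partial
    sums. *)
Lemma ecount_mean_le (T : R) phi : (0 <= T)%R -> test_fun phi ->
  \int[P]_w ecount phi T w <= (T * pairing phi lb)%:E.
Proof.
move=> T0 tp; rewrite /ecount /event_sum.
have f0 m w : 0 <= (if tau m w < +oo then
    if (fine (tau m w) <= T)%R then (phi (xi m w))%:E else 0 else 0).
  by case: ifP => // _; case: ifP => // _; rewrite lee_fin (test_ge0 tp).
rewrite integral_nneseries//; last by move=> m; exact: measurable_count_term.
apply: lime_le.
  by apply: is_cvg_nneseries => m _ _; exact: integral_ge0.
apply: nearW => n; apply: le_trans (nsum_mean_le n T0 tp).
rewrite -ge0_integral_sum//; last by move=> m; exact: measurable_count_term.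
apply: ge0_le_integral => //.
- by move=> w _; apply: sume_ge0.
- by apply: emeasurable_sum => m; exact: measurable_count_term.
- by apply: emeasurable_sum => m; exact: measurable_count_term.
- move=> w _; rewrite big_mkord /nsum big_ord_recr/= leeDl//.
Qed.

End mean_rate.

(** * Fluctuations around the compensator *)

Section compensator.
Local Open Scope ereal_scope.
Context (d : measure_display) (Omega : measurableType d) (R : realType).
Variable P : probability Omega R.
Variables (tau : nat -> Omega -> \bar R) (xi : nat -> Omega -> R).
Hypothesis pp : is_point_process tau xi.
Local Notation es := (event_sum tau xi).
Local Notation ind := (ind tau).
Local Notation mu := (@lebesgue_measure R).
Variables (l h : R -> R) (W : R -> R -> R) (C a : R).
Hypothesis par : hawkes_params l h W C a.
Local Notation lam := (lam tau xi l h W).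
Local Notation ell := (ell tau xi l h W).
Local Notation vphi := (vphi W).
Hypothesis intensity : has_conditional_intensity P tau xi lam.

Variable phi : R -> R.
Hypothesis tp : test_fun phi.
Local Notation elp := (ell phi).

Let l0 t w : 0 <= elp t w := ell_ge0 tau xi par t w tp.
Let tv : test_fun (vphi phi) := test_vphi par tp.
Let h0 t u : 0 <= (h (t - u))%:E.
Proof. by rewrite lee_fin (par_h_ge0 par). Qed.
Let v0 y : 0 <= (vphi phi y)%:E.
Proof. by rewrite lee_fin (test_ge0 tv). Qed.
Let phi0 y : 0 <= (phi y)%:E.
Proof. by rewrite lee_fin (test_ge0 tp). Qed.
Let ind0 n t w : 0 <= ind n t w := ind_ge0 tau n t w.

(** The compensator [L_s(phi)] of the count tested against [phi]. *)
Definition cumul (s : R) (w : Omega) : \bar R := \int[mu]_(t in `[0%R, s]) elp t w.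

Definition hcum (s u : R) : \bar R := \int[mu]_(t in `[0%R, s]) (h (t - u))%:E.

Lemma hcum_ge0 s u : 0 <= hcum s u.
Proof. exact: integral_ge0. Qed.

Lemma hcum_le s u : hcum s u <= a%:E.
Proof. exact: (integral_hshift_le par). Qed.

Lemma hcum_eq0 s u : (s <= u)%R -> hcum s u = 0.
Proof.
move=> su; apply: integral0_eq => t; rewrite /= in_itv/= => /andP[_ ts].
by rewrite (par_h_neg par)// subr_le0 (le_trans ts).
Qed.

Lemma cumul_ge0 s w : 0 <= cumul s w.
Proof. exact: integral_ge0. Qed.

Lemma measurable_ell_time w : measurable_fun setT (elp ^~ w).
Proof. exact: (measurableT_comp (measurable_ell pp par tp) (measurable_pair1 w)). Qed.

Lemma measurable_ind_time n w : measurable_fun setT ((ind n) ^~ w).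
Proof. exact: (measurableT_comp (measurable_ind pp n) (measurable_pair1 w)). Qed.

(** Exchanging sum and integral leaves, for each event, the kernel mass released by time [s].
    Predictability and both comparisons with [kap] are read off this form. *)
Lemma cumulE s w : (0 <= s)%R -> cumul s w =
  (s * pairing phi l)%:E + es (fun u y => (vphi phi y)%:E * hcum s u) w.
Proof.
move=> s0; rewrite /cumul /ell.
have vh0 t u y : 0 <= (vphi phi y * h (t - u))%:E by rewrite EFinM mule_ge0.
have mvh u y : measurable_fun setT (fun t : R => (vphi phi y * h (t - u))%:E).
  apply/measurable_EFinP; apply: measurable_funM => //; apply/measurable_EFinP.
  exact: (measurable_hshift par).
rewrite ge0_integralD//; last 3 first.
- by move=> t _; rewrite lee_fin pairing_ge0// => x _; exact: (par_l_ge0 par).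
- by move=> t _; apply: event_sum_ge0.
- apply: measurable_funTS.
  apply: (measurable_event_sum pp (om := fun _ : R => w)
   (f := fun q : R * (R * R) => (vphi phi q.2.2 * h (q.1 - q.2.1))%:E)) => //.
  apply/measurable_EFinP; apply: measurable_funM.
    by apply: (measurableT_comp (test_meas tv)); apply: measurableT_comp.
  apply: (measurableT_comp (par_h_meas par)); apply: measurable_funB => //.
  by apply: measurableT_comp.
congr (_ + _).
  rewrite integral_cst// [X in _ * X]lebesgue_measure_itv/= lte_fin.
  case: ltP => s0'; first by rewrite oppr0 adde0 EFinM muleC.
  have -> : s = 0%R by apply/eqP; rewrite eq_le s0 s0'.
  by rewrite mule0 mul0r.
rewrite integral_event_sum//; last by move=> u y; apply: measurable_funTS; exact: mvh.
apply: eq_event_sum => m _; rewrite /hcum -ge0_integralZl//.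
by apply: measurable_funTS; exact: (measurable_hshift par).
Qed.

Lemma measurable_hcum : measurable_fun setT (fun z : R * R => hcum z.1 z.2).
Proof.
pose f (q : R * R * R) := if (0 <= q.2)%R && (q.2 <= q.1.1)%R then (h (q.2 - q.1.2))%:E else 0.
have f0 z : 0 <= f z by rewrite /f; case: ifP.
have mf : measurable_fun setT f.
  apply: measurable_fun_ifT => //.
    apply: measurable_and; apply: measurable_fun_ler => //.
    by apply: measurableT_comp.
  apply/measurable_EFinP; apply: (measurableT_comp (par_h_meas par)).
  by apply: measurable_funB => //; apply: measurableT_comp.
apply: (eq_measurable_fun _ _ (measurable_integral_in (m2 := mu) measurableT f mf f0)).
move=> z _; rewrite /hcum [RHS]integral_mkcond.
apply: eq_integral => t _; rewrite patchE /f/=.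
by rewrite mem_setE in_itv.
Qed.

(** The left limit [N_{s-}(phi)]; the strict inequality makes it predictable. *)
Definition past (s : R) (w : Omega) : \bar R :=
  es (fun u y => if (u < s)%R then (phi y)%:E else 0) w.

Lemma past_ge0 s w : 0 <= past s w.
Proof. by apply: event_sum_ge0 => u y; case: ifP. Qed.

Lemma predictable_past : predictable tau xi (fun z => past z.1.2 z.1.1).
Proof.
apply: (predictable_past_sum pp (f := fun q : R * (R * R) => (phi q.2.2)%:E)) => //.
apply/measurable_EFinP; apply: (measurableT_comp (test_meas tp)).
by apply: measurableT_comp.
Qed.

Notation PT := (g_sigma_algebraType (predictable_rectangle tau xi)).

Lemma predictable_cumul : predictable tau xi (fun z => cumul z.1.2 z.1.1).
Proof.
pose f (q : R * (R * R)) := (vphi phi q.2.2)%:E * hcum q.1 q.2.1.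
(* Inserting the test [u < s] changes nothing, since [hcum s u] vanishes for [u >= s], and it puts
   the sum in the form covered by [predictable_past_sum]. *)
have pf : predictable tau xi (fun z => (z.1.2 * pairing phi l)%:E + es
    (fun u y => if (u < z.1.2)%R then f (z.1.2, (u, y)) else 0%E) z.1.1).
  apply: (@predictableD _ _ _ tau xi).
    apply: (@predictable_time _ _ _ tau xi (fun s => (s * pairing phi l)%:E)).
    by apply/measurable_EFinP; apply: measurable_funM.
  apply: (predictable_past_sum pp).
    apply: emeasurable_funM.
      apply/measurable_EFinP; apply: (measurableT_comp (test_meas tv)).
      by apply: measurableT_comp.
    apply: (@measurableT_comp _ _ _ _ _ _ (fun z : R * R => hcum z.1 z.2) _
      (fun q : R * (R * R) => (q.1, q.2.1)) measurable_hcum).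
    by apply: measurable_fun_pair => //; apply: measurableT_comp.
  by move=> z; rewrite mule_ge0 ?hcum_ge0.
apply: (@eq_measurable_fun _ _ PT _ _ _ _ _ pf) => z; rewrite inE => -[z0 _].
rewrite cumulE//; congr (_ + _); apply: eq_event_sum => m _.
by case: ltP => // zu; rewrite hcum_eq0// mule0.
Qed.

End compensator.

Section integral_square.
Variable R : realType.
Local Notation mu := (@lebesgue_measure R).

(** The square splits along the diagonal into two triangles with equal integrals by symmetry. Both
    triangles are closed, so the diagonal is covered twice and an inequality suffices. *)
Lemma integral_square_le (T : R) (k : R -> \bar R) :
  measurable_fun setT k -> (forall t, 0 <= k t)%E ->
  ((\int[mu]_(t in `[0%R, T]) k t) * (\int[mu]_(t in `[0%R, T]) k t) <=
   2%:E * \int[mu]_(s in `[0%R, T])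
     (k s * \int[mu]_(r in `[0%R, T]) (if (r <= s)%R then k r else 0%E)))%E.
Proof.
move=> mk k0; set D := (X in integral _ X).
have mD : measurable D by exact: measurable_itv.
have mkD : measurable_fun D k by exact: measurable_funTS.
have ik : (0 <= \int[mu]_(t in D) k t)%E by exact: integral_ge0.
have mkk : measurable_fun setT (fun z : R * R => (k z.1 * k z.2)%E).
  by apply: emeasurable_funM; apply: measurableT_comp.
pose F (z : R * R) : \bar R := if (z.2 <= z.1)%R then (k z.1 * k z.2)%E else 0%E.
pose G (z : R * R) : \bar R := if (z.1 <= z.2)%R then (k z.1 * k z.2)%E else 0%E.
have F0 z : (0 <= F z)%E by rewrite /F; case: ifP => // _; rewrite mule_ge0.
have G0 z : (0 <= G z)%E by rewrite /G; case: ifP => // _; rewrite mule_ge0.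
have mF : measurable_fun setT F.
  by apply: measurable_fun_ifT => //; apply: measurable_fun_ler.
have mG : measurable_fun setT G.
  by apply: measurable_fun_ifT => //; apply: measurable_fun_ler.
have mFs s : measurable_fun D (fun r => F (s, r)).
  by apply: measurable_funTS; exact: (measurableT_comp mF (measurable_pair1 s)).
have mGs s : measurable_fun D (fun r => G (s, r)).
  by apply: measurable_funTS; exact: (measurableT_comp mG (measurable_pair1 s)).
have mFi : measurable_fun D (fun s => \int[mu]_(r in D) F (s, r))%E.
  exact: measurable_funTS (measurable_integral_in (m2 := mu) mD F mF F0).
have mGi : measurable_fun D (fun s => \int[mu]_(r in D) G (s, r))%E.
  exact: measurable_funTS (measurable_integral_in (m2 := mu) mD G mG G0).
have Gsym : (\int[mu]_(s in D) \int[mu]_(r in D) G (s, r) =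
    \int[mu]_(s in D) \int[mu]_(r in D) F (s, r))%E.
  rewrite (tonelli_in (m1 := mu) (m2 := mu) mD mD G mG G0).
  by apply: eq_integral => s _; apply: eq_integral => r _; rewrite /F /G/= muleC.
have iF s : (0 <= \int[mu]_(r in D) F (s, r))%E by apply: integral_ge0 => r _; exact: F0.
have iG s : (0 <= \int[mu]_(r in D) G (s, r))%E by apply: integral_ge0 => r _; exact: G0.
have kFG s r : (k s * k r <= F (s, r) + G (s, r))%E.
  rewrite /F /G/=; have [rs|rs] := leP r s.
    by apply: leeDl; exact: (G0 (s, r)).
  by rewrite (ltW rs) add0e.
have kF s : (\int[mu]_(r in D) F (s, r) =
    k s * \int[mu]_(r in D) (if (r <= s)%R then k r else 0%E))%E.
  rewrite -ge0_integralZl; last 4 first.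
  - exact: mD.
  - apply: measurable_funTS.
    by apply: measurable_fun_ifT; [exact: measurable_fun_ler|exact: mk|exact: measurable_cst].
  - by move=> r _; case: ifP => // _; exact: k0.
  - exact: k0.
  by apply: eq_integral => r _; rewrite /F/=; case: ifP; rewrite ?mule0.
have mFGs s : measurable_fun D (fun r => F (s, r) + G (s, r))%E.
  exact: emeasurable_funD (mFs s) (mGs s).
have sFG s : (\int[mu]_(r in D) (F (s, r) + G (s, r)) =
    \int[mu]_(r in D) F (s, r) + \int[mu]_(r in D) G (s, r))%E.
  rewrite ge0_integralD; last 5 first.
  - exact: mD.
  - by move=> r _; exact: F0.
  - exact: mFs.
  - by move=> r _; exact: G0.
  - exact: mGs.
  by [].
have FG0 s r : (0 <= F (s, r) + G (s, r))%E by exact: adde_ge0 (F0 _) (G0 _).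
have main s : (k s * \int[mu]_(r in D) k r <=
    \int[mu]_(r in D) F (s, r) + \int[mu]_(r in D) G (s, r))%E.
  clear - mD mkD k0 kFG sFG mFGs FG0.
  rewrite -sFG -ge0_integralZl; last 4 first.
  - exact: mD.
  - exact: mkD.
  - by move=> r _; exact: k0.
  - exact: k0.
  apply: ge0_le_integral.
  - exact: mD.
  - by move=> r _; exact: mule_ge0.
  - by apply: emeasurable_funM; [exact: measurable_cst|exact: mkD].
  - exact: mFGs.
  - by move=> r _; exact: kFG.
under [in leRHS]eq_integral => s _ do rewrite -kF.
rewrite mule_natl mule2n -{2}Gsym.
have -> : (\int[mu]_(s in D) \int[mu]_(r in D) F (s, r) +
    \int[mu]_(s in D) \int[mu]_(r in D) G (s, r) =
    \int[mu]_(s in D) (\int[mu]_(r in D) F (s, r) + \int[mu]_(r in D) G (s, r)))%E.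
  rewrite [RHS]ge0_integralD; last 5 first.
  - exact: mD.
  - by move=> s _; exact: iF.
  - exact: mFi.
  - by move=> s _; exact: iG.
  - exact: mGi.
  by [].
clear - main mD mkD k0 ik mFi mGi iF iG.
rewrite -ge0_integralZr; last 4 first.
- exact: mD.
- exact: mkD.
- by move=> s _; exact: k0.
- exact: ik.
apply: ge0_le_integral.
- exact: mD.
- by move=> s _; exact: mule_ge0.
- by apply: emeasurable_funM; [exact: mkD|exact: measurable_cst].
- exact: emeasurable_funD mFi mGi.
- by move=> s _; exact: main.
Qed.

End integral_square.

(** * Pathwise calculus for the stopped count and its compensator *)

Section second_moment.
Local Open Scope ereal_scope.
Context (d : measure_display) (Omega : measurableType d) (R : realType).
Variable P : probability Omega R.
Variables (tau : nat -> Omega -> \bar R) (xi : nat -> Omega -> R).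
Hypothesis pp : is_point_process tau xi.
Local Notation nsum := (nsum tau xi).
Local Notation ind := (ind tau).
Local Notation mu := (@lebesgue_measure R).
Variables (l h : R -> R) (W : R -> R -> R) (C a : R).
Hypothesis par : hawkes_params l h W C a.
Local Notation lam := (lam tau xi l h W).
Local Notation ell := (ell tau xi l h W).
Hypothesis intensity : has_conditional_intensity P tau xi lam.

Variable phi : R -> R.
Hypothesis tp : test_fun phi.
Local Notation elp := (ell phi).
Local Notation cumul := (cumul tau xi l h W phi).
Local Notation past := (past tau xi phi).

Let l0 t w : 0 <= elp t w := ell_ge0 tau xi par t w tp.
Let phi0 y : 0 <= (phi y)%:E.
Proof. by rewrite lee_fin (test_ge0 tp). Qed.
Let ind0 n t w : 0 <= ind n t w := ind_ge0 tau n t w.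
Let past0 s w : 0 <= past s w := past_ge0 tau xi tp s w.
Let cumul0 s w : 0 <= cumul s w := cumul_ge0 tau xi par tp s w.

Variables (n : nat) (T : R).
Hypothesis T0 : (0 <= T)%R.

Definition jump m w : R := if tau m w <= T%:E then phi (xi m w) else 0%R.
(** Real-valued, because the stopped count is a finite sum bounded in terms of [n] and [phi]. Its
    compensator [compens] may be infinite on some paths and stays extended-valued. *)
Definition jumps w : R := (\sum_(m < n.+1) jump m w)%R.
Definition compens w : \bar R := \int[mu]_(t in `[0%R, T]) (ind n t w * elp t w).

Lemma fine_tau_le m w : tau m w < +oo ->
  (fine (tau m w) <= T)%R = (tau m w <= T%:E).
Proof. by move=> ht; rewrite -lee_fin (fine_tau pp ht). Qed.

Lemma jump_ge0 m w : (0 <= jump m w)%R.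
Proof. by rewrite /jump; case: ifP => // _; exact: (test_ge0 tp). Qed.

Lemma jumps_ge0 w : (0 <= jumps w)%R.
Proof. by apply: sumr_ge0 => m _; exact: jump_ge0. Qed.

Lemma comp_ge0 w : 0 <= compens w.
Proof. by apply: integral_ge0 => t _; rewrite mule_ge0. Qed.

Lemma nsum_jump (f : R -> R -> R) w :
  nsum n (fun s y => if (s <= T)%R then (f s y)%:E else 0) w =
  (\sum_(m < n.+1) if (tau m w <= T%:E)%E then f (fine (tau m w)) (xi m w) else 0)%R%:E.
Proof.
rewrite -sumEFin; apply: eq_bigr => m _.
have [ht|ht] := ltP (tau m w) +oo; last first.
  by rewrite leNgt (lt_le_trans _ ht)// ltry.
by rewrite fine_tau_le//; case: ifP.
Qed.

Lemma past_tau m w : tau m w < +oo ->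
  past (fine (tau m w)) w = (\sum_(j < m) phi (xi j w))%R%:E.
Proof.
move=> ht; rewrite -sumEFin /past /event_sum (nneseries_split 0 m); last first.
  by move=> k _; case: ifP => // _; case: ifP.
have lt k : (tau k w < +oo) -> (fine (tau k w) < fine (tau m w))%R = (k < m)%N.
  move=> hk; rewrite -lte_fin !(fine_tau pp)// ltNge (tau_le_iff pp)//.
  by rewrite -ltnNge.
rewrite add0n [X in _ + X]eseries0 ?adde0; last first.
  move=> k mk _; case: ifP => // hk.
  by rewrite lt// ltnNge mk.
rewrite big_mkord; apply: eq_bigr => k _.
have hk : tau k w < +oo by apply: le_lt_trans ht; apply: (tau_mono pp); exact: ltnW.
by rewrite hk lt// ltn_ord.
Qed.

Lemma sum_square (N : nat) (c : nat -> R) :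
  ((\sum_(m < N) c m) ^+ 2 = \sum_(m < N) (c m) ^+ 2 +
    2 * \sum_(m < N) (c m * \sum_(j < m) c j))%R.
Proof.
elim: N => [|N IH]; first by rewrite !big_ord0 expr0n/= mulr0 addr0.
by rewrite !big_ord_recr/= sqrrD IH; ring.
Qed.

(** The Ito formula [J^2 = sum (dJ)^2 + 2 int J_- dJ] for a pure jump path: the partial sum before
    jump [m] is the left limit [past] at that time. *)
Lemma jumps_square w : ((jumps w) ^+ 2)%:E =
  (\sum_(m < n.+1) (jump m w) ^+ 2)%R%:E +
  2%:E * nsum n (fun s y => if (s <= T)%R then (phi y)%:E * past s w else 0) w.
Proof.
rewrite /jumps (sum_square n.+1 (fun m => jump m w)) EFinD EFinM; congr (_ + _ * _).
rewrite -sumEFin; apply: eq_bigr => m _; rewrite /jump.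
have [ht|ht] := ltP (tau m w) +oo; last first.
  by rewrite leNgt (lt_le_trans _ ht) ?ltry//= mul0r.
rewrite past_tau// fine_tau_le//.
case: ifP => mT; last by rewrite mul0r.
rewrite -EFinM; congr (_ * _)%:E; apply: eq_bigr => j _.
by rewrite (le_trans _ mT)//; apply: (tau_mono pp); exact: ltnW.
Qed.

Let mE w : measurable_fun setT (elp ^~ w) := measurable_ell_time pp par tp w.
Let mI w : measurable_fun setT ((ind n) ^~ w) := measurable_ind_time pp n w.
Let mk w : measurable_fun setT (fun t => ind n t w * elp t w).
Proof. exact: emeasurable_funM. Qed.
Let k0 t w : 0 <= ind n t w * elp t w.
Proof. exact: mule_ge0. Qed.

(** For [m <= n] the stopping is not felt before [tau m], so that part of the stopped compensator is
    the full [cumul]. *)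
Lemma comp_split m w : (m <= n)%N -> tau m w <= T%:E ->
  compens w = cumul (fine (tau m w)) w +
    \int[mu]_(t in `[0%R, T]) (if (fine (tau m w) < t)%R then ind n t w * elp t w else 0).
Proof.
move=> mn mT; have ht : tau m w < +oo by apply: le_lt_trans mT _; exact: ltry.
set u := fine (tau m w); have uT : (u <= T)%R by rewrite -lee_fin (fine_tau pp ht).
have mless : measurable_fun setT (fun t : R => (u < t)%R) by exact: measurable_fun_ltr.
transitivity (\int[mu]_(t in `[0%R, T]) ((if (u < t)%R then 0 else ind n t w * elp t w) +
   (if (u < t)%R then ind n t w * elp t w else 0))).
  by apply: eq_integral => t _; case: ifP => _; rewrite ?add0e ?adde0.
rewrite ge0_integralD//.
- congr (_ + _); rewrite [LHS]integral_mkcond /cumul [RHS]integral_mkcond.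
  apply: eq_integral => t _; rewrite !patchE !mem_setE !in_itv/=.
  have [t0|t0] := leP 0%R t => //=.
  have [ut|ut] := ltP u t; first by rewrite if_same.
  rewrite (le_trans ut uT) /ind (_ : t%:E <= tau n w) ?mul1e//.
  by rewrite (le_trans _ (tau_mono pp w mn))// -(fine_tau pp ht) lee_fin.
- by move=> t _; case: ifP.
- by apply: measurable_funTS; apply: measurable_fun_ifT => //; exact: mk.
- by move=> t _; case: ifP.
- by apply: measurable_funTS; apply: measurable_fun_ifT => //; exact: mk.
Qed.

Lemma past_ind t w : (t <= T)%R -> ind n t w * past t w =
  ind n t w * (\sum_(m < n.+1) (if (fine (tau m w) < t)%R then (jump m w)%:E else 0)).
Proof.
move=> tT; rewrite /ind; case: ifP => [tn|_]; last by rewrite !mul0e.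
rewrite !mul1e /past (@event_sum_trunc _ _ _ _ _ n); last 2 first.
- move=> m nm ht; rewrite ltNge -lee_fin (fine_tau pp ht).
  by rewrite (le_trans tn)// (tau_mono pp)// ltnW.
- by move=> s y; case: ifP.
apply: eq_bigr => m _; rewrite /jump.
have [ht|ht] := ltP (tau m w) +oo; last first.
  by rewrite [_ <= T%:E]leNgt (lt_le_trans _ ht) ?ltry//= if_same.
case: ifP => // mt; rewrite ifT// -(fine_tau pp ht) lee_fin (le_trans _ tT)//.
exact: ltW.
Qed.

(** Integration by parts, [J C = int C dJ + int J_- dC]: each jump multiplies the compensator, which
    is split at the time of that jump. *)
Lemma jumps_comp w : (jumps w)%:E * compens w =
  nsum n (fun s y => if (s <= T)%R then (phi y)%:E * cumul s w else 0) w +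
  \int[mu]_(t in `[0%R, T]) (ind n t w * (past t w * elp t w)).
Proof.
rewrite /jumps -sumEFin ge0_sume_distrl; last by move=> m _; rewrite lee_fin jump_ge0.
have mless u : measurable_fun setT (fun t : R => (u < t)%R) by exact: measurable_fun_ltr.
pose F m t := (if (fine (tau m w) < t)%R then (jump m w)%:E else 0) * (ind n t w * elp t w).
have F0 m t : 0 <= F m t.
  by rewrite /F mule_ge0//; case: ifP => // _; rewrite lee_fin jump_ge0.
have mF m : measurable_fun setT (F m).
  by apply: emeasurable_funM; [apply: measurable_fun_ifT|exact: mk].
transitivity (\sum_(m < n.+1) ((if tau m w < +oo then
   if (fine (tau m w) <= T)%R then (phi (xi m w))%:E * cumul (fine (tau m w)) w else 0 else 0) +
   \int[mu]_(t in `[0%R, T]) F m t)).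
  apply: eq_bigr => m _; have [ht|ht] := ltP (tau m w) +oo; last first.
    rewrite /F /jump leNgt (lt_le_trans _ ht) ?ltry//= mul0e add0e.
    by rewrite integral0_eq// => t _; rewrite if_same mul0e.
  rewrite fine_tau_le// /F /jump.
  case: ifP => mT; last first.
    by rewrite mul0e add0e integral0_eq// => t _; rewrite if_same mul0e.
  have mn : (m <= n)%N by rewrite -ltnS.
  rewrite (comp_split mn mT) ge0_muleDr//; last first.
    by apply: integral_ge0 => t _; case: ifP.
  congr (_ + _); rewrite -ge0_integralZl//.
  - by apply: eq_integral => t _; case: ifP; rewrite ?mule0 ?mul0e.
  - by apply: measurable_funTS; apply: measurable_fun_ifT; [exact: mless|exact: mk|exact: measurable_cst].
  - by move=> t _; case: ifP.
rewrite big_split/=; congr (_ + _).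
rewrite -ge0_integral_sum//; last by move=> m; apply: measurable_funTS; exact: mF.
apply: eq_integral => t; rewrite inE/= in_itv/= => /andP[_ tT].
rewrite /F -ge0_sume_distrl; last first.
  by move=> m _; case: ifP => // _; rewrite lee_fin jump_ge0.
by rewrite !muleA past_ind// [_ * (\sum_(_ < _) _)]muleC.
Qed.

(** Half of [C^2 = 2 int C dC]: after [integral_square_le] the inner stopped integral is bounded by
    the unstopped [cumul]. *)
Lemma comp_square w : compens w * compens w <=
  2%:E * \int[mu]_(t in `[0%R, T]) (ind n t w * (cumul t w * elp t w)).
Proof.
apply: le_trans (integral_square_le T (mk w) (k0 ^~ w)) _.
rewrite lee_wpmul2l ?lee_fin//; apply: ge0_le_integral.
- exact: measurable_itv.
- by move=> s _; apply: mule_ge0 => //; apply: integral_ge0 => r _; case: ifP.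
- apply: measurable_funTS; apply: emeasurable_funM; first exact: mk.
  apply: (measurable_integral_in (m2 := mu) (measurable_itv `[0%R, T])
     (fun z : R * R => if (z.2 <= z.1)%R then ind n z.2 w * elp z.2 w else 0)).
    apply: measurable_fun_ifT => //; first exact: measurable_fun_ler.
    by apply: (measurableT_comp (mk w)); exact: measurable_snd.
  by move=> z; case: ifP.
- apply: measurable_funTS; apply: emeasurable_funM; first exact: mI.
  apply: emeasurable_funM; last exact: mE.
  have mc := measurable_integral_in (m2 := mu) measurableT
     (fun z : R * R => if (0 <= z.2)%R && (z.2 <= z.1)%R then elp z.2 w else 0).
  apply: (eq_measurable_fun _ _ (mc _ _)).
  + move=> s _; rewrite /cumul [RHS]integral_mkcond; apply: eq_integral => t _.
    by rewrite patchE mem_setE in_itv.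
  + apply: measurable_fun_ifT => //.
      by apply: measurable_and; apply: measurable_fun_ler.
    by apply: (@measurableT_comp _ _ _ _ _ _ (elp ^~ w) _ snd (mE w)); exact: measurable_snd.
  + by move=> z; case: ifP.
- move=> s _; rewrite -muleA [X in _ <= _ * X]muleC; apply: lee_wpmul2l => //.
  apply: lee_wpmul2l => //.
  rewrite /cumul integral_mkcond [leRHS]integral_mkcond.
  apply: ge0_le_integral.
  + exact: measurableT.
  + by move=> r _; rewrite patchE; case: ifP => // _; case: ifP.
  + apply/(measurable_restrictT _ (measurable_itv _)); apply: measurable_funTS.
    apply: measurable_fun_ifT; [exact: measurable_fun_ler|exact: mk|exact: measurable_cst].
  + by apply/(measurable_restrictT _ (measurable_itv _)); apply: measurable_funTS; exact: mE.
  + move=> r _; rewrite !patchE !mem_setE !in_itv/=; case: (leP 0%R r) => //= r0.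
    case: (leP r T) => //= rT; case: (leP r s) => //= rs.
    by rewrite /ind; case: ifP; rewrite ?mul1e ?mul0e.
Qed.

End second_moment.

(** * Variance bound *)

Section variance.
Local Open Scope ereal_scope.
Context (d : measure_display) (Omega : measurableType d) (R : realType).
Variable P : probability Omega R.
Variables (tau : nat -> Omega -> \bar R) (xi : nat -> Omega -> R).
Hypothesis pp : is_point_process tau xi.
Local Notation nsum := (nsum tau xi).
Local Notation ind := (ind tau).
Local Notation mu := (@lebesgue_measure R).
Variables (l h : R -> R) (W : R -> R -> R) (C a : R).
Hypothesis par : hawkes_params l h W C a.
Local Notation lam := (lam tau xi l h W).
Local Notation ell := (ell tau xi l h W).
Hypothesis intensity : has_conditional_intensity P tau xi lam.

Variable phi : R -> R.
Hypothesis tp : test_fun phi.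
Local Notation elp := (ell phi).
Local Notation cumul := (cumul tau xi l h W phi).
Local Notation past := (past tau xi phi).

Let l0 t w : 0 <= elp t w := ell_ge0 tau xi par t w tp.
Let phi0 y : 0 <= (phi y)%:E.
Proof. by rewrite lee_fin (test_ge0 tp). Qed.
Let ind0 n t w : 0 <= ind n t w := ind_ge0 tau n t w.
Let past0 s w : 0 <= past s w := past_ge0 tau xi tp s w.
Let cumul0 s w : 0 <= cumul s w := cumul_ge0 tau xi par tp s w.

Variables (n : nat) (T : R).
Hypothesis T0 : (0 <= T)%R.

Local Notation jump := (jump tau xi phi T).
Local Notation jumps := (jumps tau xi phi n T).
Local Notation compens := (compens tau xi l h W phi n T).

Let j0 m w : (0 <= jump m w)%R.
Proof. exact: jump_ge0. Qed.
Let js0 w : (0 <= jumps w)%R.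
Proof. exact: jumps_ge0. Qed.
Let c0 w : 0 <= compens w.
Proof. exact: (comp_ge0 tau xi par tp). Qed.

Local Notation jumps_sq w := (\sum_(m < n.+1) (jump m w) ^+ 2)%R.

Lemma measurable_jump m : measurable_fun setT (jump m).
Proof.
have mt := pp_time_measurable pp m; have mx := pp_location_measurable pp m.
apply: measurable_fun_ifT => //; last exact: (measurableT_comp (test_meas tp)).
rewrite (_ : (fun w => _) = (fun w => ~~ (T%:E < tau m w))); last first.
  by apply/funext => w; rewrite leNgt.
by apply: measurableT_comp => //; exact: measurable_fun_lte.
Qed.

Lemma measurable_jumps : measurable_fun setT jumps.
Proof. by apply: measurable_sum => m; exact: measurable_jump. Qed.

Lemma measurable_compens : measurable_fun setT compens.
Proof.
apply: (measurable_integral_in (m2 := mu) (measurable_itv _)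
  (fun z : Omega * R => ind n z.2 z.1 * elp z.2 z.1)).
  by apply: emeasurable_funM; [exact: (measurable_ind pp n)|exact: (measurable_ell pp par tp)].
by move=> z; exact: mule_ge0.
Qed.

Let mcumul : measurable_fun setT (fun z : Omega * R => cumul z.2 z.1).
Proof.
pose f (q : Omega * R * R) := if (0 <= q.2)%R && (q.2 <= q.1.2)%R then elp q.2 q.1.1 else 0.
have f0 z : 0 <= f z by rewrite /f; case: ifP.
have mf : measurable_fun setT f.
  apply: measurable_fun_ifT => //.
    apply: measurable_and; apply: measurable_fun_ler => //.
    by apply: measurableT_comp.
  apply: (@measurableT_comp _ _ _ _ _ _ (fun z : Omega * R => elp z.2 z.1) _
    (fun q : Omega * R * R => (q.1.1, q.2)) (measurable_ell pp par tp)).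
  by apply: measurable_fun_pair => //; apply: measurableT_comp.
apply: (eq_measurable_fun _ _ (measurable_integral_in (m2 := mu) measurableT f mf f0)).
move=> z _; rewrite /cumul [RHS]integral_mkcond.
apply: eq_integral => t _; rewrite patchE /f/=.
by rewrite mem_setE in_itv.
Qed.

Let mpast : measurable_fun setT (fun z : Omega * R => past z.2 z.1).
Proof.
apply: (measurable_event_sum pp (om := fst) (f := fun q : (Omega * R) * (R * R) =>
  if (q.2.1 < q.1.2)%R then (phi q.2.2)%:E else 0)) => //.
  apply: measurable_fun_ifT => //.
    by apply: measurable_fun_ltr; apply: measurableT_comp.
  apply/measurable_EFinP; apply: (measurableT_comp (test_meas tp)).
  by apply: measurableT_comp.
by move=> z; case: ifP.
Qed.

Let mterm (G : Omega * R -> \bar R) : measurable_fun setT G -> measurable_fun setT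
  (fun w => nsum n (fun s y => if (s <= T)%R then (phi y)%:E * G (w, s) else 0) w).
Proof.
move=> mG; apply: emeasurable_sum => m.
have mt := pp_time_measurable pp m; have mx := pp_location_measurable pp m.
have mft : measurable_fun setT (fun w => fine (tau m w)) by exact: measurableT_comp.
apply: measurable_fun_ifT => //; first by apply: measurable_fun_lte.
apply: measurable_fun_ifT => //; first by apply: measurable_fun_ler.
apply: emeasurable_funM.
  by apply/measurable_EFinP; exact: (measurableT_comp (test_meas tp)).
by apply: (measurableT_comp mG); exact: measurable_fun_pair.
Qed.

Let mint (G : Omega * R -> \bar R) : measurable_fun setT G -> (forall z, 0 <= G z) ->
  measurable_fun setT (fun w => \int[mu]_(t in `[0%R, T]) (ind n t w * (G (w, t) * elp t w))).
Proof.
move=> mG G0; apply: (measurable_integral_in (m2 := mu) (measurable_itv _)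
  (fun z : Omega * R => ind n z.2 z.1 * (G z * elp z.2 z.1))).
  apply: emeasurable_funM; first exact: (measurable_ind pp n).
  apply: emeasurable_funM; [|exact: (measurable_ell pp par tp)].
  by apply: eq_measurable_fun mG => -[].
by move=> z; rewrite !mule_ge0.
Qed.

Lemma jumps_nsum w : (jumps w)%:E = nsum n (fun s y => if (s <= T)%R then (phi y)%:E else 0) w.
Proof. by rewrite (nsum_jump pp n T (fun s y => phi y)). Qed.

(** Let [J] be the count, [C] its compensator, [D = (J - C)^2], [p = int J_- dC] and [q = int C dJ].
    The intensity identity exchanges [dJ] and [dC] under predictable integrands, so
    [E J^2 = E sum (dJ)^2 + 2 E p], [E JC = E q + E p] and [E C^2 <= 2 E q]. Then [E D = E J^2 + E
    C^2 - 2 E JC <= E sum (dJ)^2], the subtraction being justified by the finiteness of [E p] and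
    [E q]. *)
Lemma variance_le : \int[P]_w (((jumps w)%:E - compens w) * ((jumps w)%:E - compens w)) <=
  \int[P]_w (jumps_sq w)%:E.
Proof.
have [B0 [B00 jB]] : exists B : R, (0 <= B)%R /\ forall w, (jumps w <= B)%R.
  have [B b] := test_bnd tp; have B0 : (0 <= B)%R := le_trans (test_ge0 tp 0%R) (b 0%R).
  exists (\sum_(m < n.+1) B)%R; split; first by apply: sumr_ge0.
  by move=> w; apply: ler_sum => m _; rewrite /jump; case: ifP.
have mjump := measurable_jump; have mjumps := measurable_jumps; have mcomp := measurable_compens.
have jsq0 w : (0 <= jumps_sq w)%R by apply: sumr_ge0 => m _; exact: sqr_ge0.
pose p w := \int[mu]_(t in `[0%R, T]) (ind n t w * (past t w * elp t w)).
pose q w := nsum n (fun s y => if (s <= T)%R then (phi y)%:E * cumul s w else 0) w.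
pose D w := ((jumps w)%:E - compens w) * ((jumps w)%:E - compens w).
have p0 w : 0 <= p w by apply: integral_ge0 => t _; rewrite !mule_ge0.
have q0 w : 0 <= q w by apply: sume_ge0 => m _; case: ifP => // _; case: ifP => // _; rewrite mule_ge0.
have D0 w : 0 <= D w by exact: sqre_ge0.
have sc0 w : 0 <= (jumps w)%:E * compens w by rewrite mule_ge0 // lee_fin js0.
have mS : measurable_fun setT (fun w => (jumps w)%:E) by exact/measurable_EFinP.
have mSC : measurable_fun setT (fun w => (jumps w)%:E * compens w) by exact: emeasurable_funM.
have mDD : measurable_fun setT D.
  by apply: emeasurable_funM; apply: emeasurable_funB.
have mC2 : measurable_fun setT (fun w => compens w * compens w) by exact: emeasurable_funM.
have mSQ : measurable_fun setT (fun w => (jumps_sq w)%:E).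
  by apply/measurable_EFinP; apply: measurable_sum => m; exact: measurable_funX.
have mS2 : measurable_fun setT (fun w => ((jumps w) ^+ 2)%:E).
  by apply/measurable_EFinP; exact: measurable_funX.
(* The square is expanded without subtraction, so the identity survives when [compens w] is
   infinite: both sides are then infinite. *)
have ID w : ((jumps w) ^+ 2)%:E + compens w * compens w = 2%:E * ((jumps w)%:E * compens w) + D w.
  have jw := js0 w; have := c0 w; rewrite /D.
  case: (compens w) => [r _|_|//].
    by rewrite -EFinB -!EFinM -!EFinD; congr (_%:E); ring.
  rewrite /= mulyy mulNyNy !addey//.
  by rewrite gt_eqF// (lt_le_trans ltNy0)// !mule_ge0// ?lee_fin// leey.
have stop G := @intensity_stop _ _ _ P _ _ pp _ _ _ _ _ par intensity n phi G T tp.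
have Ep : \int[P]_w nsum n (fun s y => if (s <= T)%R then (phi y)%:E * past s w else 0) w =
    \int[P]_w p w.
  by apply: (stop (fun z => past z.2 z.1)) => //; exact: predictable_past.
have Eq : \int[P]_w q w = \int[P]_w \int[mu]_(t in `[0%R, T]) (ind n t w * (cumul t w * elp t w)).
  by apply: (stop (fun z => cumul z.2 z.1)) => //; exact: (predictable_cumul pp par).
have EC : \int[P]_w compens w = \int[P]_w (jumps w)%:E.
  transitivity (\int[P]_w \int[mu]_(t in `[0%R, T]) (ind n t w * (cst 1 (w, t) * elp t w))).
    by apply: eq_integral => w _; apply: eq_integral => t _; rewrite mul1e.
  rewrite -stop//; last exact: (@measurable_cst _ _ (g_sigma_algebraType (predictable_rectangle tau xi))).
  apply: eq_integral => w _; rewrite jumps_nsum; apply: eq_bigr => m _.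
  by case: ifP => // _; case: ifP => // _; rewrite mule1.
have mp : measurable_fun setT p by exact: (mint mpast).
have mq : measurable_fun setT q by exact: (mterm mcumul).
have mq' := mint mcumul (fun z => cumul0 z.2 z.1).
have np0 w : 0 <= nsum n (fun s y => if (s <= T)%R then (phi y)%:E * past s w else 0) w.
  by apply: sume_ge0 => m _; case: ifP => // _; case: ifP => // _; rewrite mule_ge0.
have eS2 : \int[P]_w ((jumps w) ^+ 2)%:E = \int[P]_w (jumps_sq w)%:E + 2%:E * \int[P]_w p w.
  rewrite -Ep -ge0_integralZl//; last exact: (mterm mpast).
  rewrite -ge0_integralD//.
  - by apply: eq_integral => w _; rewrite (jumps_square pp tp).
  - by move=> w _; rewrite lee_fin.
  - by move=> w _; rewrite mule_ge0.
  - by apply: emeasurable_funM; [exact: measurable_cst|exact: (mterm mpast)].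
have eSC : \int[P]_w ((jumps w)%:E * compens w) = \int[P]_w q w + \int[P]_w p w.
  rewrite -ge0_integralD//.
  by apply: eq_integral => w _; rewrite (jumps_comp pp par tp).
have eC2 : \int[P]_w (compens w * compens w) <= 2%:E * \int[P]_w q w.
  rewrite Eq -ge0_integralZl; last 4 first.
  - exact: measurableT.
  - exact: mq'.
  - by move=> w _; apply: integral_ge0 => t _; rewrite !mule_ge0.
  - by rewrite lee_fin.
  apply: ge0_le_integral.
  - exact: measurableT.
  - by move=> w _; rewrite mule_ge0.
  - exact: mC2.
  - by apply: emeasurable_funM; [exact: measurable_cst|exact: mq'].
  - by move=> w _; exact: (comp_square pp par tp).
have EID : \int[P]_w ((jumps w) ^+ 2)%:E + \int[P]_w (compens w * compens w) =
    2%:E * (\int[P]_w q w + \int[P]_w p w) + \int[P]_w D w.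
  rewrite -eSC -ge0_integralZl// -!ge0_integralD//.
  - by apply: eq_integral => w _; exact: ID.
  - by move=> w _; rewrite mule_ge0.
  - by apply: emeasurable_funM => //; exact: measurable_cst.
  - by move=> w _; rewrite lee_fin sqr_ge0.
  - by move=> w _; rewrite mule_ge0.
have PB (X : Omega -> \bar R) (M : R) : measurable_fun setT X -> (forall w, 0 <= X w) ->
    (forall w, X w <= M%:E) -> \int[P]_w X w <= M%:E.
  move=> mX X0 XM; apply: (@le_trans _ _ (\int[P]_w (cst M%:E w))).
    by apply: ge0_le_integral.
  rewrite integral_cst// [X in _ * X](_ : _ = 1) ?mule1//; exact: probability_setT.
have ip0 : 0 <= \int[P]_w p w by exact: integral_ge0.
have iq0 : 0 <= \int[P]_w q w by exact: integral_ge0.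
(* The term [2 E p] is part of [E J^2], and [J <= B0]. *)
have pfin : \int[P]_w p w < +oo.
  apply: (@le_lt_trans _ _ (B0 ^+ 2)%:E); last exact: ltry.
  apply: (@le_trans _ _ (\int[P]_w ((jumps w) ^+ 2)%:E)).
    rewrite eS2; apply: (@le_trans _ _ (2%:E * \int[P]_w p w)).
      by rewrite -[leLHS]mul1e lee_wpmul2r// lee_fin ler1n.
    by rewrite leeDr// integral_ge0// => w _; rewrite lee_fin.
  apply: PB => //; first by move=> w; rewrite lee_fin sqr_ge0.
  by move=> w; rewrite lee_fin lerXn2r ?nnegrE.
(* Here [E q <= E JC <= B0 * E C = B0 * E J], the last equality being the intensity identity with
   integrand 1. *)
have qfin : \int[P]_w q w < +oo.
  apply: (@le_lt_trans _ _ (B0%:E * B0%:E)); last by rewrite -EFinM ltry.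
  apply: (@le_trans _ _ (\int[P]_w ((jumps w)%:E * compens w))).
    by rewrite eSC leeDl.
  apply: (@le_trans _ _ (\int[P]_w (B0%:E * compens w))).
    apply: ge0_le_integral => //.
    - by apply: emeasurable_funM => //; exact: measurable_cst.
    - by move=> w _; rewrite lee_wpmul2r// lee_fin.
  rewrite ge0_integralZl// lee_wpmul2l ?lee_fin// EC.
  by apply: PB => // w; rewrite lee_fin.
have Xfin : 2%:E * (\int[P]_w q w + \int[P]_w p w) \is a fin_num.
  rewrite ge0_fin_numE; last by rewrite mule_ge0// adde_ge0.
  by rewrite lte_mul_pinfty// lte_add_pinfty.
have iD0 : 0 <= \int[P]_w D w by exact: integral_ge0.
rewrite -(leeD2lE _ _ Xfin) -EID eS2 -addeA [leRHS]addeC leeD2l//.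
by rewrite (ge0_muleDr _ iq0 ip0) [leRHS]addeC leeD2l.
Qed.

End variance.

(** * Deviation from the compensator, and bounds on the compensator *)

Section deviation.
Local Open Scope ereal_scope.
Context (d : measure_display) (Omega : measurableType d) (R : realType).
Variable P : probability Omega R.
Variables (tau : nat -> Omega -> \bar R) (xi : nat -> Omega -> R).
Hypothesis pp : is_point_process tau xi.
Local Notation nsum := (nsum tau xi).
Local Notation mu := (@lebesgue_measure R).
Variables (l h : R -> R) (W : R -> R -> R) (C a : R).
Hypothesis par : hawkes_params l h W C a.
Local Notation lam := (lam tau xi l h W).
Local Notation ell := (ell tau xi l h W).
Local Notation vphi := (vphi W).
Local Notation kap := (Kop (fun x y => W y x) a).
Hypothesis intensity : has_conditional_intensity P tau xi lam.

Variable lb : R -> R.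
Hypothesis lb_L1 : L1 lb.
Hypothesis lb_ge0 : (forall x, 0 <= x <= 1 -> 0 <= lb x)%R.
Hypothesis lb_eq : (forall x, 0 <= x <= 1 -> lb x = l x + Kop W a lb x)%R.
Hypothesis hK : no_subinvariant W a 1.

Local Notation cumul := (cumul tau xi l h W).
Local Notation ecount := (ecount tau xi).

Lemma markov_set (A : set Omega) (X : Omega -> \bar R) (c : R) : measurable A ->
  measurable_fun setT X -> (forall w, 0 <= X w) -> (forall w, A w -> c%:E <= X w) ->
  c%:E * P A <= \int[P]_w X w.
Proof.
move=> mA mX X0 cX; have [c0|c0] := leP 0%R c; last first.
  apply: (@le_trans _ _ 0); last exact: integral_ge0.
  by rewrite mule_le0_ge0// lee_fin ltW.
apply: (@le_trans _ _ (\int[P]_(w in A) X w)); last first.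
  by apply: ge0_subset_integral.
rewrite -integral_cst//; apply: ge0_le_integral => //.
exact: measurable_funTS.
Qed.

Lemma measurable_cumul phi s : test_fun phi -> measurable_fun setT (cumul phi s).
Proof.
move=> tp; apply: (measurable_integral_in (m2 := mu) (measurable_itv _)
  (fun z : Omega * R => ell phi z.2 z.1)).
  exact: (measurable_ell pp par tp).
by move=> z; exact: (ell_ge0 tau xi par _ _ tp).
Qed.

Definition deviation phi (T : R) w : \bar R := `|ecount phi T w - cumul phi T w|.

Lemma measurable_deviation phi T : test_fun phi -> measurable_fun setT (deviation phi T).
Proof.
move=> tp; apply: measurableT_comp => //; apply: emeasurable_funB.
  exact: (measurable_ecount pp).
exact: measurable_cumul.
Qed.

Lemma measurable_ge (X : Omega -> \bar R) (c : \bar R) : measurable_fun setT X ->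
  measurable [set w | c <= X w].
Proof.
move=> mX; rewrite (_ : [set w | _] = setT `&` [set w | c <= X w]); last by rewrite setTI.
exact: emeasurable_fun_c_infty.
Qed.

Lemma measurable_gt (X : Omega -> \bar R) (c : \bar R) : measurable_fun setT X ->
  measurable [set w | c < X w].
Proof.
move=> mX; rewrite (_ : [set w | _] = setT `&` [set w | c < X w]); last by rewrite setTI.
exact: emeasurable_fun_o_infty.
Qed.

Lemma measurable_lt (X : Omega -> \bar R) (c : \bar R) : measurable_fun setT X ->
  measurable [set w | X w < c].
Proof.
move=> mX; rewrite (_ : [set w | _] = setT `&` [set w | X w < c]); last by rewrite setTI.
exact: emeasurable_fun_infty_o.
Qed.

Lemma stopped_deviation phi n (T : R) w : test_fun phi -> (0 <= T)%R -> T%:E < tau n w ->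
  ((jumps tau xi phi n T w)%:E - compens tau xi l h W phi n T w) *
  ((jumps tau xi phi n T w)%:E - compens tau xi l h W phi n T w) =
  deviation phi T w * deviation phi T w.
Proof.
move=> tp T0 Tn.
have -> : (jumps tau xi phi n T w)%:E = ecount phi T w.
  rewrite (jumps_nsum pp) /ecount (event_sum_trunc (n := n))//.
    move=> m nm tm; rewrite leNgt -lte_fin (fine_tau pp tm).
    by rewrite (lt_le_trans Tn)// (tau_mono pp)// ltnW.
  by move=> s y; case: ifP => // _; rewrite lee_fin (test_ge0 tp).
have -> : compens tau xi l h W phi n T w = cumul phi T w.
  apply: eq_integral => t; rewrite inE/= in_itv/= => /andP[_ tT].
  by rewrite /ind (le_trans _ (ltW Tn)) ?lee_fin// mul1e.
by rewrite /deviation -abseM gee0_abs// sqre_ge0.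
Qed.

(** Chebyshev on the event [T < tau n], where stopping is not felt; the bound is uniform in [n] and
    these events increase to the whole space. The inequality [phi^2 <= B phi] reduces the variance
    to the mean count. *)
Lemma deviation_prob phi (B eta T : R) : test_fun phi -> (forall x, phi x <= B)%R ->
  (0 < eta)%R -> (0 < T)%R ->
  P [set w | (eta * T)%:E <= deviation phi T w] <= (B * pairing phi lb / (eta ^+ 2 * T))%:E.
Proof.
move=> tp phiB eta0 T0; have B0 : (0 <= B)%R := le_trans (test_ge0 tp 0%R) (phiB 0%R).
set E := [set w | _]; have mE : measurable E by apply: measurable_ge; exact: measurable_deviation.
pose F n := E `&` [set w | T%:E < tau n w].
have mF n : measurable (F n).
  by apply: measurableI => //; apply: measurable_gt; exact: (pp_time_measurable pp).
have EF : E = \bigcup_n F n.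
  apply/seteqP; split => [w Ew|w [n _ []]//].
  by have [n nt] := tau_gt pp T w; exists n.
have Fcv : P (F n) @[n --> \oo] --> P E.
  rewrite EF; apply: nondecreasing_cvg_mu => //; first by rewrite -EF.
  move=> m n mn; apply/subsetPset => w [Ew Tm]; split => //.
  exact: lt_le_trans Tm (tau_mono pp w mn).
rewrite -(cvg_lim _ Fcv)//; apply: lime_le; first exact: (cvgP _ Fcv).
apply: nearW => n.
have c0 : (0 < (eta * T) ^+ 2)%R by rewrite exprn_gt0// mulr_gt0.
have H : ((eta * T) ^+ 2)%:E * P (F n) <= (B * (T * pairing phi lb))%:E.
  pose D w := ((jumps tau xi phi n T w)%:E - compens tau xi l h W phi n T w) *
    ((jumps tau xi phi n T w)%:E - compens tau xi l h W phi n T w).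
  apply: (@le_trans _ _ (\int[P]_w D w)).
    apply: markov_set => //.
    - apply: emeasurable_funM; apply: emeasurable_funB;
        [apply/measurable_EFinP; exact: (measurable_jumps pp tp)|exact: (measurable_compens pp par tp)|
         apply/measurable_EFinP; exact: (measurable_jumps pp tp)|exact: (measurable_compens pp par tp)].
    - by move=> w; exact: sqre_ge0.
    - move=> w [Ew Tn]; rewrite /D stopped_deviation// ?(ltW T0)//.
      by rewrite expr2 EFinM lee_pmul// lee_fin ltW// mulr_gt0.
  apply: (le_trans (variance_le pp par intensity tp n T)).
  apply: (@le_trans _ _ (\int[P]_w (B%:E * nsum n (fun s y => if (s <= T)%R then (phi y)%:E else 0) w))).
    apply: ge0_le_integral => //.
    - by move=> w _; rewrite lee_fin sumr_ge0// => m _; exact: sqr_ge0.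
    - apply/measurable_EFinP; apply: measurable_sum => m; apply: measurable_funX.
      exact: (measurable_jump pp tp).
    - apply: emeasurable_funM; first exact: measurable_cst.
      by apply: emeasurable_sum => m; exact: (measurable_count_term pp _ _ tp).
    - move=> w _; rewrite -(jumps_nsum pp) -EFinM lee_fin mulr_sumr.
      apply: ler_sum => m _; rewrite expr2 ler_wpM2r ?(jump_ge0 tau xi tp)//.
      by rewrite /jump; case: ifP.
  rewrite ge0_integralZl//; last first.
  - by move=> w _; apply: (nsum_ge0 tau xi) => s y; case: ifP => // _; rewrite lee_fin (test_ge0 tp).
  - by apply: emeasurable_sum => m; exact: (measurable_count_term pp _ _ tp).
  rewrite [leRHS]EFinM lee_wpmul2l ?lee_fin//.
  exact: (nsum_mean_le pp par intensity lb_L1 lb_ge0 lb_eq hK n (ltW T0) tp).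
rewrite -(@lee_pmul2l _ ((eta * T) ^+ 2)%:E)//.
apply: (le_trans H); rewrite -EFinM lee_fin le_eqVlt; apply/orP; left; apply/eqP.
by field; rewrite !gt_eqF.
Qed.

Lemma kapE phi y : kap phi y = (a * vphi phi y)%R.
Proof. by rewrite /vphi /Kop mul1r. Qed.

Let v0 phi y : test_fun phi -> 0 <= (vphi phi y)%:E.
Proof. by move=> tp; rewrite lee_fin (test_ge0 (test_vphi par tp)). Qed.

(** By time [T] an event has released at most the whole mass [a] of its kernel, and nothing if it is
    later than [T]. *)
Lemma cumul_le phi (T : R) w : test_fun phi -> (0 <= T)%R ->
  cumul phi T w <= (T * pairing phi l)%:E + ecount (kap phi) T w.
Proof.
move=> tp T0; rewrite (cumulE pp par tp)// leeD2l//.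
apply: le_event_sum => [s y|m _]; first by rewrite mule_ge0 ?v0// (hcum_ge0 par).
set s := fine _; case: (leP s T) => sT; last by rewrite (hcum_eq0 par)// ?mule0// ltW.
by rewrite kapE [(a * _)%:E]EFinM muleC lee_wpmul2r ?v0//; exact: (hcum_le par).
Qed.

(** An event up to time [S] has at least [T - S] units of time left, enough to release the fraction
    [c] of its kernel mass. Events after [S] are dropped. *)
Lemma cumul_ge phi (T S c : R) w : test_fun phi -> (0 <= S <= T)%R -> (0 <= c)%R ->
  (c * a)%:E <= \int[mu]_(t in `[0%R, (T - S)%R]) (h t)%:E ->
  (T * pairing phi l)%:E + c%:E * ecount (kap phi) S w <= cumul phi T w.
Proof.
move=> tp /andP[S0 ST] c0 ca; rewrite (cumulE pp par tp) ?(le_trans S0)// leeD2l//.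
have tk := test_kap (par_W_meas par) (par_W_ge0 par) (par_W_le par) (a_ge0 par) tp.
rewrite /ecount -event_sumZ; last first.
  by move=> s y; case: ifP => // _; rewrite lee_fin (test_ge0 tk).
apply: le_event_sum => [s y|m tm].
  by rewrite mule_ge0// ?lee_fin//; case: ifP => // _; rewrite lee_fin (test_ge0 tk).
set s := fine _; case: (leP s S) => sS; last by rewrite mule0 mule_ge0 ?v0// (hcum_ge0 par).
rewrite kapE -EFinM mulrA [(c * a * _)%:E]EFinM muleC lee_wpmul2l ?v0//.
apply: (le_trans ca).
have s0 : (0 <= s)%R by rewrite fine_ge0// (pp_time_ge0 pp).
(* Shifted by [s], the window [[0, T - S]] still lies inside [[0, T]], because [0 <= s <= S]. *)
pose f t := if t \in `[0%R, (T - S)%R] then (h t)%:E else 0.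
have h0 t : 0 <= (h t)%:E by rewrite lee_fin (par_h_ge0 par).
have mh : measurable_fun setT (fun t => (h t)%:E) by apply/measurable_EFinP; exact: (par_h_meas par).
have mf : measurable_fun setT f.
  have -> : f = ((fun t => (h t)%:E) \_ (`[0%R, (T - S)%R]%classic)).
    by apply/funext => t; rewrite patchE mem_setE.
  by apply/(measurable_restrictT _ (measurable_itv _)); exact: measurable_funTS.
have f0 t : 0 <= f t by rewrite /f; case: ifP.
have -> : \int[mu]_(t in `[0%R, (T - S)%R]) (h t)%:E = \int[mu]_t f t.
  by rewrite integral_mkcond; apply: eq_integral => t _; rewrite patchE mem_setE.
rewrite -(integral_shift s mf f0) /hcum [leRHS]integral_mkcond.
apply: ge0_le_integral => //.
- by apply: (measurableT_comp mf); exact: measurable_funB.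
- apply/(measurable_restrictT _ (measurable_itv _)); apply: measurable_funTS.
  exact: (measurable_hshift par).
- move=> t _; rewrite patchE mem_setE /f !in_itv/=; case: ifP => [/andP[ts tsS]|_].
    by rewrite ifT//; apply/andP; split; lra.
  by case: ifP.
Qed.

(** The integrals over [[0, n]] increase to [a], which exceeds [c a] when [a > 0]; the case [a = 0]
    is separate because that gap closes. *)
Lemma h_tail (c : R) : (c < 1)%R -> (0 <= c)%R -> exists n : nat,
  (c * a)%:E <= \int[mu]_(t in `[0%R, n%:R]) (h t)%:E.
Proof.
move=> c1 c0; have h0 t : 0 <= (h t)%:E by rewrite lee_fin (par_h_ge0 par).
have := a_ge0 par; rewrite le_eqVlt => /predU1P[<-|a0].
  by exists 0%N; rewrite mulr0; exact: integral_ge0.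
apply: contrapT => /forallNP H.
have cv := ge0_cvgn_integral (mu := mu) (par_h_ge0 par) (par_h_meas par).
have E : \int[mu]_(t in `[0%R, +oo[) (h t)%:E = a%:E.
  rewrite -(par_h_int par) integral_mkcond; apply: eq_integral => t _.
  rewrite patchE mem_setE in_itv/= andbT; case: ifPn => //.
  by rewrite -ltNge => /ltW t0; rewrite (par_h_neg par).
have : a%:E <= (c * a)%:E.
  rewrite -E -(cvg_lim _ cv)//; apply: lime_le; first exact: (cvgP _ cv).
  by apply: nearW => n; apply: ltW; rewrite ltNge; apply/negP/H.
by rewrite lee_fin -[leLHS]mul1r ler_pM2r// leNgt c1.
Qed.

End deviation.

(** * Law of large numbers *)

Section law_of_large_numbers.
Local Open Scope ereal_scope.
Context (d : measure_display) (Omega : measurableType d) (R : realType).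
Variable P : probability Omega R.
Variables (tau : nat -> Omega -> \bar R) (xi : nat -> Omega -> R).
Hypothesis pp : is_point_process tau xi.
Local Notation mu := (@lebesgue_measure R).
Variables (l h : R -> R) (W : R -> R -> R) (C a : R).
Hypothesis par : hawkes_params l h W C a.
Local Notation lam := (lam tau xi l h W).
Local Notation kap := (Kop (fun x y => W y x) a).
Hypothesis intensity : has_conditional_intensity P tau xi lam.

Variable lb : R -> R.
Hypothesis lb_L1 : L1 lb.
Hypothesis lb_ge0 : (forall x, 0 <= x <= 1 -> 0 <= lb x)%R.
Hypothesis lb_eq : (forall x, 0 <= x <= 1 -> lb x = l x + Kop W a lb x)%R.
Hypothesis hK : no_subinvariant W a 1.

Local Notation cumul := (cumul tau xi l h W).
Local Notation ecount := (ecount tau xi).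
Local Notation deviation := (deviation tau xi l h W).

Definition for_large (Q : R -> Prop) : Prop := exists M : R, forall T, (M < T)%R -> Q T.

Lemma for_largeI (Q1 Q2 : R -> Prop) : for_large Q1 -> for_large Q2 ->
  for_large (fun T => Q1 T /\ Q2 T).
Proof.
move=> [M1 h1] [M2 h2]; exists (Num.max M1 M2) => T; rewrite gt_max => /andP[m1 m2].
by split; [exact: h1|exact: h2].
Qed.

Lemma for_large_imp (Q1 Q2 : R -> Prop) : (forall T, (0 < T)%R -> Q1 T -> Q2 T) ->
  for_large Q1 -> for_large Q2.
Proof.
move=> Q12 [M h1]; exists (Num.max M 0%R) => T; rewrite gt_max => /andP[m1 m2].
by apply: Q12 => //; exact: h1.
Qed.

Lemma for_largeZ (c : R) (Q : R -> Prop) : (0 < c)%R -> for_large Q ->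
  for_large (fun T => Q (c * T)%R).
Proof.
by move=> c0 [M h1]; exists (M / c)%R => T; rewrite ltr_pdivrMr// mulrC; exact: h1.
Qed.

Lemma prob_union (A B E : set Omega) (p q : R) : measurable A -> measurable B ->
  measurable E -> E `<=` A `|` B -> P A <= p%:E -> P B <= q%:E -> P E <= (p + q)%:E.
Proof.
move=> mA mB mE EAB pA qB; apply: (@le_trans _ _ (P (A `|` B))).
  by apply: le_measure => //; rewrite inE//; exact: measurableU.
apply: (le_trans (measureU2 _ mA mB)).
by rewrite EFinD leeD.
Qed.

Lemma prob_subset (A E : set Omega) : measurable A ->
  measurable E -> E `<=` A -> P E <= P A.
Proof. by move=> mA mE EA; apply: le_measure => //; rewrite inE. Qed.

Lemma dist_bounds (X Y : \bar R) (r : R) : 0 <= X -> 0 <= Y -> `|X - Y| < r%:E ->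
  X <= Y + r%:E /\ Y <= X + r%:E.
Proof.
case: X => [x| |]; case: Y => [y| |]//= _ _; rewrite ?ltNge ?leey//.
rewrite -ltNge !lee_fin lte_fin ltr_norml => /andP[h1 h2]; split; lra.
Qed.

Lemma deviation_small phi (e eta : R) : test_fun phi -> (0 < e)%R -> (0 < eta)%R ->
  for_large (fun T => P [set w | (e * T)%:E <= deviation phi T w] <= eta%:E).
Proof.
move=> tp e0 eta0; have [B b] := test_bnd tp.
(* The bound of [deviation_prob] decays like [1 / T], and drops below [eta] past this threshold. The
   absolute value makes the threshold nonnegative, hence [T > 0]. *)
exists (`|B * pairing phi lb| / (e ^+ 2 * eta))%R => T.
have e2 : (0 < e ^+ 2)%R by rewrite exprn_gt0.
rewrite ltr_pdivrMr ?mulr_gt0// => H.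
have T0 : (0 < T)%R.
  have : (0 < T * (e ^+ 2 * eta))%R by apply: le_lt_trans H.
  by rewrite pmulr_lgt0// mulr_gt0.
apply: le_trans (deviation_prob pp par intensity lb_L1 lb_ge0 lb_eq hK tp b e0 T0) _.
rewrite lee_fin ler_pdivrMr ?mulr_gt0//; apply: le_trans (ler_norm _) _.
apply: le_trans (ltW H) _; rewrite le_eqVlt; apply/orP; left; apply/eqP; ring.
Qed.

(** The parameter [p] is a probability of failure that does not vanish with [T]: the recursion
    starts from Markov's inequality, which leaves one, and the steps carry it along unchanged. The
    lower bound starts from nonnegativity and needs no such term. *)
Definition upper_rate phi (c p : R) : Prop := forall e eta : R, (0 < e)%R -> (0 < eta)%R ->
  for_large (fun T => P [set w | ((c + e) * T)%:E < ecount phi T w] <= (p + eta)%:E).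

Definition lower_rate phi (c : R) : Prop := forall e eta : R, (0 < e)%R -> (0 < eta)%R ->
  for_large (fun T => P [set w | ecount phi T w < ((c - e) * T)%:E] <= eta%:E).

Let tk phi : test_fun phi -> test_fun (kap phi) :=
  @test_kap _ _ _ _ (par_W_meas par) (par_W_ge0 par) (par_W_le par) (a_ge0 par) phi.
Let mN phi T : test_fun phi -> measurable_fun setT (ecount phi T) :=
  @measurable_ecount _ _ _ _ _ pp phi T.
Let N0 phi T w : test_fun phi -> 0 <= ecount phi T w := @ecount_ge0 _ _ _ tau xi phi T w.
Let mdev phi (T c : R) : test_fun phi -> measurable [set w | c%:E <= deviation phi T w].
Proof. by move=> tp; apply: measurable_ge; exact: (measurable_deviation pp par). Qed.
Let cumul0 phi T w : test_fun phi -> 0 <= cumul phi T w.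
Proof. by move=> tp; exact: (cumul_ge0 tau xi par tp). Qed.

Lemma upper_rate_step phi c p : test_fun phi -> upper_rate (kap phi) c p ->
  upper_rate phi (pairing phi l + c)%R p.
Proof.
move=> tp H e eta e0 eta0.
have e20 : (0 < e / 2)%R by rewrite divr_gt0.
have eta20 : (0 < eta / 2)%R by rewrite divr_gt0.
apply: for_large_imp (for_largeI (deviation_small tp e20 eta20) (H _ _ e20 eta20)).
move=> T T0 [h1 h2].
have -> : (p + eta = eta / 2 + (p + eta / 2))%R by field.
apply: (prob_union _ _ _ _ h1 h2).
- exact: mdev.
- by apply: measurable_gt; exact: mN (tk tp).
- by apply: measurable_gt; exact: mN.
move=> w /=; have [hd|hd] := leP (e / 2 * T)%:E (deviation phi T w); first by left.
move=> Nw; right; rewrite ltNge; apply/negP => kw.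
move: Nw; rewrite ltNge => /negP; apply.
have [h' _] := dist_bounds (N0 T w tp) (cumul0 T w tp) hd.
apply: (le_trans h'); apply: (@le_trans _ _ ((T * pairing phi l)%:E + ((c + e / 2) * T)%:E + (e / 2 * T)%:E)).
  rewrite leeD2r//; apply: (le_trans (cumul_le pp par w tp (ltW T0))).
  by rewrite leeD2l.
rewrite -!EFinD lee_fin le_eqVlt; apply/orP; left; apply/eqP. by field.
Qed.

Lemma lower_rate_step phi c : test_fun phi -> lower_rate (kap phi) c ->
  lower_rate phi (pairing phi l + c)%R.
Proof.
move=> tp H e eta e0 eta0.
have e30 : (0 < e / 3)%R by rewrite divr_gt0.
have eta20 : (0 < eta / 2)%R by rewrite divr_gt0.
(* The fraction of time given up. The factor [1 - dl] enters twice, through the kernel mass and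
   through the shorter horizon, at a cost of at most [2 dl |c| <= e / 3] in the rate. The cap
   [1 / 2] keeps [1 - dl] positive. *)
pose dl := (Num.min (1 / 2) (e / (6 * (`|c| + 1))))%R.
have c10 : (0 < `|c| + 1)%R by rewrite ltr_wpDl.
have d0 : (0 < dl)%R by rewrite lt_min divr_gt0//= divr_gt0// mulr_gt0.
have d12 : (dl <= 1 / 2)%R by rewrite ge_min lexx.
have dc : (2 * dl * `|c| <= e / 3)%R.
  have : (dl * (6 * (`|c| + 1)) <= e)%R.
    by rewrite -ler_pdivlMr ?mulr_gt0// ge_min lexx orbT.
  have : (0 <= dl * (1:R))%R by rewrite mulr1 ltW.
  rewrite mulr1 => ? ?; nra.
have [n hn] := @h_tail _ l h W C a par (1 - dl)%R ltac:(lra) ltac:(lra).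
have ev3 : for_large (fun T => (n%:R <= dl * T)%R).
  exists (n%:R / dl)%R => T; rewrite ltr_pdivrMr// => h1; rewrite mulrC; exact: ltW.
have d10 : (0 < 1 - dl)%R by lra.
apply: for_large_imp (for_largeI ev3 (for_largeI (deviation_small tp e30 eta20)
  (for_largeZ d10 (H _ _ e30 eta20)))).
move=> T T0 [h3 [h1 h2]].
have -> : eta = (eta / 2 + eta / 2)%R by field.
apply: (prob_union _ _ _ _ h1 h2).
- exact: mdev.
- by apply: measurable_lt; exact: mN (tk tp).
- by apply: measurable_lt; exact: mN.
move=> w /=; have [h4|h4] := leP (e / 3 * T)%:E (deviation phi T w); first by left.
move=> Nw; right; rewrite ltNge; apply/negP => kw.
have [_ h'] := dist_bounds (N0 T w tp) (cumul0 T w tp) h4.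
have ST : (0 <= (1 - dl) * T <= T)%R by apply/andP; split; [exact: mulr_ge0 (ltW d10) (ltW T0)|apply: ler_piMl; [exact: ltW|lra]].
have hh : ((1 - dl) * a)%:E <= \int[mu]_(t in `[0%R, (T - (1 - dl) * T)%R]) (h t)%:E.
  apply: (le_trans hn); apply: ge0_subset_integral => //.
  - by apply: measurable_funTS; apply/measurable_EFinP; exact: (par_h_meas par).
  - by move=> t _; rewrite lee_fin (par_h_ge0 par).
  - move=> t /=; rewrite !in_itv/= => /andP[-> tn]; rewrite (le_trans tn)//.
    have -> : (T - (1 - dl) * T = dl * T)%R by ring.
    exact: h3.
have := le_trans (cumul_ge pp par w tp ST (ltW d10) hh) h'.
move: Nw kw; have := N0 ((1 - dl) * T)%R w (tk tp).
have := N0 T w tp.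
case: (ecount phi T w) => [x| |]//.
case: (ecount (kap phi) _ w) => [y| |]//; last first.
  by move=> _ _ _ _; rewrite gt0_muley ?lte_fin// addey// leye_eq.
rewrite !lee_fin lte_fin => x0 y0 Nw kw hx.
have {}hx : (T * pairing phi l + (1 - dl) * y <= x + e / 3 * T)%R by exact: hx.
(* For small or negative [c] it is enough that [y >= 0]. Otherwise [c - e / 3] is positive and the
   two factors [1 - dl] can be multiplied out. *)
have [ce|ce] := leP c (e / 3)%R.
  have : (0 <= (1 - dl) * y)%R by rewrite mulr_ge0// ltW.
  have : (c * T <= e / 3 * T)%R by rewrite ler_pM2r.
  nra.
have c0 : (`|c| = c)%R by rewrite gtr0_norm//; lra.
rewrite c0 in dc.
have yy : ((1 - dl) * ((c - e / 3) * ((1 - dl) * T)) <= (1 - dl) * y)%R by rewrite ler_pM2l.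
have : ((c - 2 * e / 3) * T <= (1 - dl) * ((c - e / 3) * ((1 - dl) * T)))%R.
  rewrite (_ : (1 - dl) * _ = ((1 - dl) ^+ 2 * (c - e / 3)) * T)%R; last by ring.
  rewrite ler_pM2r//.
  have : (0 <= dl ^+ 2 * (c - e / 3))%R by rewrite mulr_ge0 ?sqr_ge0//; lra.
  have : (0 <= dl * (e / 3))%R by rewrite mulr_ge0// ltW.
  lra.
lra.
Qed.

(** Markov's inequality from the mean bound. It is crude for [phi] itself, but it will be applied to
    [iter k kap phi], whose pairing with [lb] is small. *)
Lemma upper_rate_base phi (rho : R) : test_fun phi -> (0 < rho)%R ->
  upper_rate phi rho (pairing phi lb / rho)%R.
Proof.
move=> tp r0 e eta e0 eta0; exists 0%R => T T0.
set E := [set w | _].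
have mE : measurable E by apply: measurable_gt; exact: mN.
have H : (rho * T)%:E * P E <= (T * pairing phi lb)%:E.
  apply: le_trans (ecount_mean_le pp par intensity lb_L1 lb_ge0 lb_eq hK (ltW T0) tp).
  apply: markov_set => //; first exact: mN.
    by move=> w; exact: N0.
  move=> w Ew; apply: le_trans (ltW Ew); rewrite lee_fin ler_pM2r//; lra.
have rT : (0 < rho * T)%R by rewrite mulr_gt0.
rewrite -(@lee_pmul2l _ (rho * T)%:E)//; apply: (le_trans H).
rewrite -EFinM lee_fin.
have -> : (rho * T * (pairing phi lb / rho + eta) = T * pairing phi lb + rho * T * eta)%R.
  by field; rewrite gt_eqF.
by rewrite lerDl mulr_ge0// ltW.
Qed.

Let fixpoint phi : test_fun phi ->
  (pairing phi lb = pairing phi l + pairing (kap phi) lb)%R.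
Proof.
exact: (pairing_fixpoint (par_W_meas par) (par_W_ge0 par) (par_W_le par) (a_ge0 par)
  (par_l_L1 par) lb_L1 lb_ge0 lb_eq).
Qed.

Let remainder phi k := pairing (iter k kap phi) lb.

Let remainderS phi k : remainder phi k.+1 = remainder (kap phi) k.
Proof. by rewrite /remainder iterSr. Qed.

(** By the fixed point equation, [pairing phi lb - remainder phi k] telescopes to the sum over
    [j < k] of [pairing (iter j kap phi) l], one term per step. *)
Lemma upper_rate_iter k phi (rho : R) : test_fun phi -> (0 < rho)%R ->
  upper_rate phi (pairing phi lb - remainder phi k + rho)%R (remainder phi k / rho)%R.
Proof.
move=> + r0; elim: k phi => [|k IH] phi tp.
  by rewrite /remainder/= subrr add0r; exact: upper_rate_base.
have := upper_rate_step tp (IH _ (tk tp)).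
by rewrite -remainderS (fixpoint tp) -!addrA.
Qed.

Lemma lower_rate_iter k phi : test_fun phi ->
  lower_rate phi (pairing phi lb - remainder phi k)%R.
Proof.
elim: k phi => [|k IH] phi tp.
  rewrite /remainder/= subrr => e eta e0 eta0; exists 0%R => T T0.
  rewrite (_ : [set w | _] = set0) ?measure0 ?lee_fin ?(ltW eta0)//.
  apply/seteqP; split => // w /=; rewrite ltNge => /negP; apply.
  apply: le_trans (N0 T w tp); rewrite lee_fin sub0r mulNr oppr_le0 mulr_ge0// ltW//.
have := lower_rate_step tp (IH _ (tk tp)).
by rewrite -remainderS (fixpoint tp) -addrA.
Qed.

Lemma remainder_small phi (e : R) : test_fun phi -> (0 < e)%R ->
  exists k, (0 <= remainder phi k <= e)%R.
Proof.
move=> tp e0.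
have cv := pairing_iter_cvg (par_W_meas par) (par_W_ge0 par) (par_W_le par) (a_ge0 par)
  (fun x _ => par_l_ge0 par x) lb_L1 lb_ge0 lb_eq hK tp.
have /cvgrPdist_le/(_ e e0) [k _ hk] := cv; exists k.
have tik : test_fun (iter k kap phi).
  by elim: k {hk} => //= k; exact: tk.
have r0 : (0 <= remainder phi k)%R by exact: pairing_ge0.
rewrite r0/=; have := hk k (leqnn k).
by rewrite /= sub0r normrN ger0_norm.
Qed.

Theorem ecount_upper phi (e eta : R) : test_fun phi -> (0 < e)%R -> (0 < eta)%R ->
  for_large (fun T => P [set w | ((pairing phi lb + e) * T)%:E < ecount phi T w] <= eta%:E).
Proof.
move=> tp e0 eta0; pose rho := (e / 2)%R.
have r0 : (0 < rho)%R by rewrite divr_gt0.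
have eta20 : (0 < eta / 2)%R by rewrite divr_gt0.
(* The number of steps is chosen after [rho]: [remainder <= rho * eta / 2] brings the leftover
   probability [remainder / rho] down to [eta / 2]. *)
have [k /andP[k0 kr]] := remainder_small tp (mulr_gt0 r0 eta20).
apply: for_large_imp (upper_rate_iter k tp r0 r0 eta20) => T T0 H.
apply: (@le_trans _ _ (remainder phi k / rho + eta / 2)%:E); last first.
  have : (remainder phi k / rho <= eta / 2)%R by rewrite ler_pdivrMr// mulrC.
  rewrite lee_fin; lra.
apply: le_trans H; apply: prob_subset; [apply: measurable_gt; exact: mN..|].
move=> w /=; apply: le_lt_trans; rewrite lee_fin ler_pM2r// /rho; lra.
Qed.

Theorem ecount_lower phi (e eta : R) : test_fun phi -> (0 < e)%R -> (0 < eta)%R ->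
  for_large (fun T => P [set w | ecount phi T w < ((pairing phi lb - e) * T)%:E] <= eta%:E).
Proof.
move=> tp e0 eta0.
have e20 : (0 < e / 2)%R by rewrite divr_gt0.
have [k /andP[k0 kr]] := remainder_small tp e20.
apply: for_large_imp (lower_rate_iter k tp e20 eta0) => T T0 H.
apply: le_trans H; apply: prob_subset; [apply: measurable_lt; exact: mN..|].
move=> w /= Nw; apply: lt_le_trans Nw _; rewrite lee_fin ler_pM2r//; lra.
Qed.

End law_of_large_numbers.

(** * Uniformity over the time interval *)

Section uniformity.
Local Open Scope ereal_scope.
Context (d : measure_display) (Omega : measurableType d) (R : realType).
Variable P : probability Omega R.
Variables (tau : nat -> Omega -> \bar R) (xi : nat -> Omega -> R).
Hypothesis pp : is_point_process tau xi.
Variables (phi : R -> R) (L : R).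
Hypothesis tp : test_fun phi.
Hypothesis L0 : (0 <= L)%R.
Local Notation N := (ecount tau xi phi).
Hypothesis N_upper : forall e eta : R, (0 < e)%R -> (0 < eta)%R ->
  for_large (fun T => P [set w | ((L + e) * T)%:E < N T w] <= eta%:E).
Hypothesis N_lower : forall e eta : R, (0 < e)%R -> (0 < eta)%R ->
  for_large (fun T => P [set w | N T w < ((L - e) * T)%:E] <= eta%:E).

Let N0 T w : 0 <= N T w := @ecount_ge0 _ _ _ tau xi phi T w tp.
Let mN T : measurable_fun setT (N T) := @measurable_ecount _ _ _ _ _ pp phi T tp.

Lemma ecount_mono s t w : (s <= t)%R -> N s w <= N t w.
Proof.
move=> st; apply: le_event_sum => [u y|m _].
  by case: ifP => // _; rewrite lee_fin (test_ge0 tp).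
case: ifP => us; first by rewrite (le_trans us st).
by case: ifP => // _; rewrite lee_fin (test_ge0 tp).
Qed.

(** The count is constant from [t] up to the first event time after [t], which is the witness and
    may be infinite. *)
Lemma ecount_right t w : exists2 r : \bar R, t%:E < r &
  forall s, (t <= s)%R -> s%:E < r -> N s w = N t w.
Proof.
have ex : exists n, t%:E < tau n w := tau_gt pp t w.
case: (ex_minnP ex) => n nt nmin; exists (tau n w) => // s ts sn.
apply: eq_event_sum => m tm; rewrite -!lee_fin (fine_tau pp tm).
have [mt|mt] := leP (tau m w) t%:E; first by rewrite (le_trans mt)// lee_fin.
rewrite ifF//; apply/negbTE; rewrite -ltNge; apply: lt_le_trans sn _.
by apply: (tau_mono pp); exact: nmin.
Qed.

Lemma ecount_fin t w : N t w \is a fin_num.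
Proof.
have [n nt] := tau_gt pp t w.
rewrite /ecount (event_sum_trunc (n := n)).
- by apply/sum_fin_numP => m _ _; do 2?case: ifP.
- move=> m nm tm; rewrite leNgt -lte_fin (fine_tau pp tm).
  by rewrite (lt_le_trans nt)// (tau_mono pp)// ltnW.
- by move=> s y; case: ifP => // _; rewrite lee_fin (test_ge0 tp).
Qed.

Definition error (T : R) (w : Omega) (v : R) : \bar R :=
  `| N (T * v)%R w * (T^-1)%:E - (v * L)%:E |.

Lemma errorE T w v : error T w v = `| fine (N (T * v)%R w) / T - v * L |%:E.
Proof. by rewrite /error -(fineK (ecount_fin _ _)). Qed.

Lemma measurable_error T v : measurable_fun setT (error T ^~ v).
Proof.
apply: measurableT_comp => //; apply: emeasurable_funB => //.
by apply: emeasurable_funM.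
Qed.

(** Right-continuity moves a large error at [v] to a rational slightly to the right. At [v = 1]
    there is no room on the right within [0,1], so this endpoint is listed apart. *)
Lemma error_rat (T e : R) w v : (0 < T)%R -> (0 <= v <= 1)%R -> e%:E < error T w v ->
  (e%:E < error T w 1%R) \/
  exists q : rat, (0 <= (ratr q : R) <= 1)%R /\ e%:E < error T w (ratr q).
Proof.
move=> T0 /andP[v0 v1] ev; move: v1; rewrite le_eqVlt => /predU1P[<-|v1]; first by left.
right; have [r tr hr] := ecount_right (T * v)%R w.
move: ev; rewrite errorE lte_fin; set A := (fine _ / T)%R => ev.
have [g gE gap] : exists2 g : R, (`|A - v * L| = e + g)%R & (0 < g)%R.
  by exists (`|A - v * L| - e)%R; [ring|rewrite subr_gt0].
have L1 : (0 < L + 1)%R by rewrite ltr_wpDl.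
have [b vb br] : exists2 b : R, (v < b)%R & forall q : R, (q < b)%R -> (T * q)%:E < r.
  case: r tr {hr} => [r| |]//.
    rewrite lte_fin => tr; exists (r / T)%R; first by rewrite ltr_pdivlMr// mulrC.
    by move=> q; rewrite ltr_pdivlMr// mulrC lte_fin.
  by move=> _; exists (v + 1)%R => [|q _]; [lra|rewrite ltry].
(* Below [b'] the count has not changed, the point stays in [0,1], and [v * L] moves by less than
   the gap [g]. Dividing by [L + 1] avoids the case [L = 0]. *)
pose b' := (Num.min (Num.min b 1) (v + g / (L + 1)))%R.
have vb' : (v < b')%R by rewrite !lt_min vb v1/= ltrDl divr_gt0.
have [q] := rat_in_itvoo vb'; rewrite in_itv/= => /andP[vq].
rewrite !lt_min => /andP[/andP[qb q1] qg].
exists q; split; first by rewrite (ltW q1) (le_trans v0 (ltW vq)).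
rewrite errorE hr ?br ?ler_pM2l ?ltW// lte_fin.
have qL : ((ratr q - v) * (L + 1) < g)%R.
  by rewrite -ltr_pdivlMr// ltrBlDl.
have h1 : (0 <= (ratr q - v : R))%R by rewrite subr_ge0 ltW.
rewrite -/A.
have : (`|A - v * L| <= `|A - ratr q * L| + (ratr q - v) * L)%R.
  rewrite -[X in (_ <= _ + X)%R]ger0_norm ?mulr_ge0//.
  have -> : (A - v * L = (A - ratr q * L) + (ratr q - v) * L)%R by ring.
  exact: ler_normD.
nra.
Qed.

(** By [error_rat] the supremum over [0,1] exceeds [e] only if the error does so at a rational or at
    1. Measurability is required by the union bound in [sup_error_small]. *)
Lemma measurable_sup_error (T e : R) : (0 < T)%R ->
  measurable [set w | e%:E < `|ereal_sup [set error T w v | v in I01 R] - 0%:E|].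
Proof.
move=> T0; rewrite (_ : [set w | _] = [set w | e%:E < error T w 1%R] `|`
    \bigcup_(q : rat) ([set w | (0 <= (ratr q : R) <= 1)%R] `&`
                       [set w | e%:E < error T w (ratr q)])).
  have mg v : measurable [set w | e%:E < error T w v].
    by apply: measurable_gt; exact: measurable_error.
  apply: measurableU => //; apply: bigcupT_measurable_rat => q; apply: measurableI => //.
  have [h|h] := boolP (0 <= (ratr q : R) <= 1)%R.
    by rewrite (_ : [set w | _] = setT)//; apply/seteqP; split.
  by rewrite (_ : [set w | _] = set0)//; apply/seteqP; split.
have sup0 w : 0 <= ereal_sup [set error T w v | v in I01 R].
  apply: (@le_trans _ _ (error T w 0%R)); first exact: abse_ge0.
  by apply: ereal_sup_ubound; exists 0%R => //=; rewrite in_itv/= lexx ler01.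
apply/seteqP; split => w /=; rewrite sube0 gee0_abs//.
  move=> /ereal_sup_gt[_ [v /= v01 <-] ev]; rewrite in_itv/= in v01.
  have [h|[q [q01 h]]] := error_rat T0 v01 ev; first by left.
  by right; exists q.
move=> [h|[q _ [q01 h]]]; apply: lt_le_trans h _; apply: ereal_sup_ubound.
  by exists 1%R => //=; rewrite in_itv/= lexx ler01.
by exists (ratr q) => //=; rewrite in_itv/=.
Qed.

(** Between neighbouring grid points the count is monotone and [v * L] varies by at most
    [L / k <= e]; the grid points themselves contribute the other [e]. *)
Lemma grid_bound (T e : R) (k : nat) w : (0 < T)%R -> (0 < e)%R -> (0 < k)%N ->
  (L / k%:R <= e)%R ->
  (forall i, (i < k)%N -> ~ (((L + e) * (i.+1%:R / k%:R * T))%:E < N (i.+1%:R / k%:R * T)%R w)) ->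
  (forall i, (i < k)%N -> ~ (N (i.+1%:R / k%:R * T)%R w < ((L - e) * (i.+1%:R / k%:R * T))%:E)) ->
  forall v, (0 <= v <= 1)%R -> error T w v <= (e + e)%:E.
Proof.
move=> T0 e0 k0 Lk Hu Hl v /andP[v0 v1].
have kR : (0 < k%:R :> R)%R by rewrite ltr0n.
have [i [ik iv vi]] : exists i : nat, [/\ (i < k)%N, (i%:R / k%:R <= v)%R & (v <= i.+1%:R / k%:R)%R].
  move: v1; rewrite le_eqVlt => /predU1P[->|v1].
    exists k.-1; rewrite prednK// divff ?gt_eqF//; split => //.
    by rewrite ler_pdivrMr// mul1r ler_nat leq_pred.
  have vk0 : (0 <= v * k%:R)%R by rewrite mulr_ge0// ltW.
  have /andP[t1 t2] := truncn_itv vk0.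
  exists (Num.truncn (v * k%:R)); split; last 2 first.
  - by rewrite ler_pdivrMr.
  - by rewrite ler_pdivlMr// ltW.
  rewrite -(ltr_nat R); apply: le_lt_trans t1 _.
  by rewrite -[ltRHS]mul1r ltr_pM2r.
rewrite errorE lee_fin ler_norml.
set A := fine _; have AE : N (T * v)%R w = A%:E by rewrite fineK// ecount_fin.
have ik1 : (i.+1%:R / k%:R <= 1 :> R)%R by rewrite ler_pdivrMr// mul1r ler_nat.
have iS : (i.+1%:R / k%:R = i%:R / k%:R + k%:R^-1 :> R)%R.
  by rewrite -natr1 mulrDl mul1r.
have Lk' : (L * k%:R^-1 <= e)%R by exact: Lk.
set a := (i%:R / k%:R)%R in iv iS *.
have a0 : (0 <= a)%R by rewrite divr_ge0.
have kk : (0 < k%:R^-1 :> R)%R by rewrite invr_gt0.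
have av1 : (a <= 1)%R := le_trans iv v1.
have lowA : ((L - e) * a <= A / T)%R.
  rewrite ler_pdivlMr// -mulrA -lee_fin -AE.
  apply: (@le_trans _ _ (N (a * T)%R w)); last by apply: ecount_mono; rewrite mulrC ler_pM2l.
  (* The left end 0 of the first cell is not among the controlled grid points; there the lower bound
     is 0 and holds by nonnegativity. *)
  rewrite /a; case: (i) ik => [_|j jk]; first by rewrite !mul0r mulr0.
  by rewrite leNgt; apply/negP; apply: Hl; exact: ltnW.
have uppA : (A / T <= (L + e) * (a + k%:R^-1))%R.
  rewrite ler_pdivrMr// -mulrA -lee_fin -AE.
  apply: (@le_trans _ _ (N ((a + k%:R^-1) * T)%R w)).
    by apply: ecount_mono; rewrite mulrC ler_pM2r// -iS.
  by rewrite -iS leNgt; apply/negP; exact: Hu.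
have Lva : (L * (v - a) <= L * k%:R^-1)%R by rewrite ler_wpM2l//; lra.
have Lav : (L * (a - v) <= 0)%R by rewrite mulr_ge0_le0//; lra.
have ea : (e * a <= e * 1)%R by rewrite ler_pM2l.
have eak : (e * (a + k%:R^-1) <= e * 1)%R by rewrite ler_pM2l// -iS.
apply/andP; split; lra.
Qed.

Lemma for_large_all (Q : nat -> R -> Prop) k :
  (forall i, (i < k)%N -> for_large (Q i)) ->
  for_large (fun T => forall i, (i < k)%N -> Q i T).
Proof.
elim: k => [|k IH] H; first by exists 0%R.
have := for_largeI (IH (fun i ik => H i (ltnW ik))) (H k (ltnSn k)).
move=> [M hM]; exists M => T MT i; have [h1 h2] := hM T MT.
by rewrite ltnS leq_eqVlt => /predU1P[->//|]; exact: h1.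
Qed.

Lemma sup_error_small (e eta : R) : (0 < e)%R -> (0 < eta)%R -> for_large (fun T =>
  P [set w | e%:E < `|ereal_sup [set error T w v | v in I01 R] - 0%:E|] <= eta%:E).
Proof.
move=> e0 eta0; have e20 : (0 < e / 2)%R by rewrite divr_gt0.
pose k := (Num.truncn (L / (e / 2))).+1.
have kR : (0 < k%:R :> R)%R by rewrite ltr0n.
have Lk : (L / k%:R <= e / 2)%R.
  by rewrite ler_pdivrMr// mulrC -ler_pdivrMr// ltW// truncnS_gt.
(* Each of the [2 k] bad events, an upper and a lower one per grid point, receives an equal share of
   [eta]. *)
have d0 : (0 < eta / (k%:R + k%:R))%R by rewrite divr_gt0// addr_gt0.
have c0 i : (0 < i.+1%:R / k%:R :> R)%R by rewrite divr_gt0.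
have HU := for_large_all (k := k) (fun i _ => for_largeZ (c0 i) (N_upper e20 d0)).
have HL := for_large_all (k := k) (fun i _ => for_largeZ (c0 i) (N_lower e20 d0)).
apply: for_large_imp (for_largeI HU HL) => T T0 [hU hL].
pose U i := [set w | ((L + e / 2) * (i.+1%:R / k%:R * T))%:E < N (i.+1%:R / k%:R * T)%R w].
pose V i := [set w | N (i.+1%:R / k%:R * T)%R w < ((L - e / 2) * (i.+1%:R / k%:R * T))%:E].
have mU i : measurable (U i) by apply: measurable_gt.
have mV i : measurable (V i) by apply: measurable_lt.
apply: (@le_trans _ _ (\sum_(i < k) P (U i `|` V i))).
  apply: (content_subadditive P (F := fun i => U i `|` V i)).
  - by move=> i _; exact: measurableU.
  - exact: measurable_sup_error.
  move=> w /= ew; apply: contrapT => nw.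
  have ni i : (i < k)%N -> ~ (U i w \/ V i w).
    move=> ik UV; apply: nw; rewrite -(bigcup_mkord k (fun i => U i `|` V i)); exists i => //.
  have := @grid_bound T (e / 2)%R k w T0 e20 isT Lk
    (fun i ik h => ni i ik (or_introl h)) (fun i ik h => ni i ik (or_intror h)) => gb.
  move: ew; rewrite ltNge => /negP; apply; rewrite sube0 gee0_abs; last first.
    apply: (@le_trans _ _ (error T w 0%R)); first exact: abse_ge0.
    by apply: ereal_sup_ubound; exists 0%R => //=; rewrite in_itv/= lexx ler01.
  apply: ge_ereal_sup => _ [v /= v01 <-]; rewrite in_itv/= in v01.
  apply: (le_trans (gb v v01)); rewrite lee_fin; lra.
apply: (@le_trans _ _ (\sum_(i < k) (eta / (k%:R + k%:R) + eta / (k%:R + k%:R))%:E)).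
  apply: lee_sum => i _; apply: (le_trans (measureU2 _ (mU i) (mV i))).
  by rewrite EFinD leeD//; [exact: hU|exact: hL].
rewrite sumEFin sumr_const card_ord lee_fin -mulr_natr le_eqVlt.
apply/orP; left; apply/eqP; field; rewrite -natrD pnatr_eq0 -lt0n addn_gt0//.
Qed.

Lemma uniform_convergence :
  cvg_in_probability P (fun T w => ereal_sup [set error T w v | v in I01 R]) 0.
Proof.
move=> e e0.
pose p T := P [set w | e%:E < `|ereal_sup [set error T w v | v in I01 R] - 0%:E|].
have small eta : (0 < eta)%R -> \forall T \near +oo%R, p T <= eta%:E.
  move=> eta0; have [M hM] := sup_error_small e0 eta0.
  by exists M; split; [exact: num_real|exact: hM].
have p0 T : 0 <= p T by exact: measure_ge0.
apply/fine_cvgP; split.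
  apply: filterS (small 1%R ltr01) => T p1.
  by rewrite ge0_fin_numE//; apply: le_lt_trans p1 _; exact: ltry.
apply/cvgrPdist_le => eta eta0; apply: filterS (small eta eta0) => T pT.
rewrite /= sub0r normrN ger0_norm ?fine_ge0//.
rewrite -lee_fin fineK// ge0_fin_numE//; apply: le_lt_trans pT _; exact: ltry.
Qed.

End uniformity.

(** * Reduction to parameters defined everywhere *)

Section patching.
Variable R : realType.
Local Notation mu := (@lebesgue_measure R).
Variables (linf h : R -> R) (W : R -> R -> R) (CW : R).
Hypothesis linf_ge0 : forall x, 0 <= x <= 1 -> 0 <= linf x.
Hypothesis linf_meas : measurable_fun (I01 R) linf.
Hypothesis linf_bounded : exists M : R,
  {ae mu, forall x, 0 <= x <= 1 -> `|linf x| <= M}.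
Hypothesis h_ge0 : forall t, 0 <= t -> 0 <= h t.
Hypothesis h_L1 : mu.-integrable `[0, +oo[ (EFin \o h).
Hypothesis W_ge0 : forall x y, 0 <= x <= 1 -> 0 <= y <= 1 -> 0 <= W x y.
Hypothesis W_meas : measurable_fun ((I01 R) `*` (I01 R)) (fun z : R * R => W z.1 z.2).
Hypothesis W_le : forall x y, 0 <= x <= 1 -> 0 <= y <= 1 -> W x y <= CW.

(* The parameters are only constrained on their domains, so they are extended
   by zero; [h] is also cut at [0], which the intensity does not see because
   only events with [s < t] contribute. *)
Definition patch_l : R -> R := linf \_ (I01 R).
Definition patch_h : R -> R := h \_ (`]0, +oo[%classic : set R).
Definition patch_W (x y : R) : R :=
  ((fun z : R * R => W z.1 z.2) \_ ((I01 R) `*` (I01 R))) (x, y).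
Local Notation a := (L1_norm_half_line h).

Lemma patch_lE x : 0 <= x <= 1 -> patch_l x = linf x.
Proof. by move=> x01; rewrite /patch_l patchE mem_set//= in_itv. Qed.

Lemma patch_WE x y : 0 <= x <= 1 -> 0 <= y <= 1 -> patch_W x y = W x y.
Proof.
by move=> x01 y01; rewrite /patch_W patchE mem_set//=; split; rewrite /= in_itv.
Qed.

Lemma patch_hE t : 0 < t -> patch_h t = h t.
Proof. by move=> t0; rewrite /patch_h patchE mem_setE in_itv/= t0. Qed.

Lemma patch_h_neg t : t <= 0 -> patch_h t = 0.
Proof. by move=> t0; rewrite /patch_h patchE mem_setE in_itv/= ltNge t0. Qed.

Lemma patch_h_ge0 t : 0 <= patch_h t.
Proof.
have [t0|t0] := leP t 0; first by rewrite patch_h_neg.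
by rewrite patch_hE// h_ge0// ltW.
Qed.

Lemma patch_W_ge0 x y : 0 <= patch_W x y.
Proof.
rewrite /patch_W patchE; case: ifP => //; rewrite inE => -[]/=.
by rewrite !in_itv/=; exact: W_ge0.
Qed.

Lemma patch_W_le x y : patch_W x y <= CW.
Proof.
(* Off the unit square the patched kernel is 0, which is below [CW] because [0 <= W 0 0 <= CW]. *)
have i0 : 0 <= (0 : R) <= 1 by rewrite lexx ler01.
rewrite /patch_W patchE; case: ifP => [|_]; last exact: le_trans (W_ge0 i0 i0) (W_le i0 i0).
by rewrite inE => -[]/=; rewrite !in_itv/=; exact: W_le.
Qed.

Lemma measurable_patch_W : measurable_fun setT (fun z : R * R => patch_W z.1 z.2).
Proof.
rewrite (_ : (fun z => _) = ((fun z : R * R => W z.1 z.2) \_ ((I01 R) `*` (I01 R)))).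
  by apply/(measurable_restrictT _ (measurableX (measurable_itv _) (measurable_itv _))).
by apply/funext => -[].
Qed.

Lemma measurable_patch_h : measurable_fun setT patch_h.
Proof.
apply/(measurable_restrictT _ (measurable_itv _)).
have mh : measurable_fun (`[0, +oo[%classic : set R) h.
  by apply/measurable_EFinP; exact: (measurable_int mu h_L1).
apply: measurable_funS mh => //.
by move=> t /=; rewrite !in_itv/= !andbT; exact: ltW.
Qed.

Lemma integral_patch_h : (\int[mu]_t (patch_h t)%:E = a%:E)%E.
Proof.
have mI : measurable (`[0, +oo[%classic : set (measurableTypeR R)) by exact: measurable_itv.
rewrite /L1_norm_half_line /Rintegral fineK; last first.
  exact: integrable_fin_num mI _ (integrable_norm h_L1).
transitivity (\int[mu]_(t in `[0%R, +oo[) (patch_h t)%:E)%E.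
  rewrite [RHS]integral_mkcond; apply: eq_integral => t _.
  rewrite patchE mem_setE in_itv/= andbT; case: ifPn => //.
  by rewrite -ltNge => /ltW t0; rewrite patch_h_neg.
have mp : measurable_fun setT (fun t => (patch_h t)%:E).
  by apply/measurable_EFinP; exact: measurable_patch_h.
have mn : measurable_fun (`[0, +oo[%classic : set R) (fun t => `|h t|%:E).
  exact: measurable_int (integrable_norm h_L1).
rewrite -integral_itv_obnd_cbnd; last exact: measurable_funTS.
rewrite -[RHS]integral_itv_obnd_cbnd; last first.
  by apply: measurable_funS mn => // t /=; rewrite !in_itv/= !andbT; exact: ltW.
apply: eq_integral => t; rewrite inE/= in_itv/= andbT => t0.
by rewrite patch_hE// ger0_norm// h_ge0// ltW.
Qed.

Lemma L1_patch_l : L1 patch_l.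
Proof.
have [M hM] := linf_bounded.
have mI := @measurable_I01 R.
have L1linf : L1 linf.
  apply/integrableP; split; first exact/measurable_EFinP.
  apply: (@le_lt_trans _ _ (\int[mu]_(x in I01 R) `|M|%:E)%E).
    apply: ae_ge0_le_integral => //.
    - by apply/measurable_EFinP; apply: measurableT_comp.
    - apply: ae_imp hM => x h1; rewrite /= in_itv/= => x01.
      by rewrite lee_fin (le_trans (h1 x01))// ler_norm.
  rewrite integral_cst// [X in (_ * X)%E]lebesgue_measure_itv/= lte01 oppr0 adde0 mule1.
  exact: ltry.
apply: eq_integrable L1linf => // x; rewrite inE/= in_itv/= => x01.
by rewrite /= patch_lE.
Qed.

Lemma patch_params : hawkes_params patch_l patch_h patch_W CW a.
Proof.
split.
- by apply/(measurable_restrictT _ (measurable_itv _)).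
- move=> x; rewrite /patch_l patchE; case: ifP => //.
  by rewrite inE/= in_itv/=; exact: linf_ge0.
- exact: L1_patch_l.
- exact: measurable_patch_h.
- exact: patch_h_ge0.
- exact: patch_h_neg.
- exact: integral_patch_h.
- exact: measurable_patch_W.
- exact: patch_W_ge0.
- exact: patch_W_le.
Qed.

Lemma T_hom_patch f x : 0 <= x <= 1 -> T_hom h W f x = Kop patch_W a f x.
Proof.
move=> x01; congr (_ * _); apply: eq_Rintegral => y; rewrite inE/= in_itv/= => y01.
by rewrite patch_WE.
Qed.

Context (d : measure_display) (Omega : measurableType d) (P : probability Omega R).
Variables (tau : nat -> Omega -> \bar R) (xi : nat -> Omega -> R).
Hypothesis pp : is_point_process tau xi.

Lemma lam_patch t x w : 0 <= x <= 1 ->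
  hawkes_intensity linf h W tau xi t x w = lam tau xi patch_l patch_h patch_W t x w.
Proof.
move=> x01; rewrite /hawkes_intensity /lam patch_lE//; congr (_ + _)%E.
apply: eq_event_sum => n _; rewrite patch_WE//; last exact: (pp_location01 pp).
case: ltP => st; first by rewrite patch_hE// subr_gt0.
by rewrite patch_h_neg ?mulr0// subr_le0.
Qed.

Lemma intensity_patch :
  has_conditional_intensity P tau xi (hawkes_intensity linf h W tau xi) ->
  has_conditional_intensity P tau xi (lam tau xi patch_l patch_h patch_W).
Proof.
move=> int H pH H0; transitivity (\int[P]_w \int[mu]_(t in `[0%R, +oo[) \int[mu]_(x in I01 R)
  (H (w, t, x) * hawkes_intensity linf h W tau xi t x w))%E; first exact: int.
apply: eq_integral => w _.
apply: eq_integral => t _; apply: eq_integral => x; rewrite inE/= in_itv/= => x01.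
by rewrite lam_patch.
Qed.

End patching.

Theorem theorem4 (R : realType) (d : measure_display) (Omega : measurableType d)
  (P : probability Omega R)
  (linf h : R -> R) (W : R -> R -> R) (CW : R)
  (linf_ge0 : forall x, 0 <= x <= 1 -> 0 <= linf x)
  (linf_meas : measurable_fun (I01 R) linf)
  (linf_bounded : exists M : R,
     {ae @lebesgue_measure R, forall x, 0 <= x <= 1 -> `|linf x| <= M})
  (linf_TV : (TV01 linf < +oo)%E)
  (h_ge0 : forall t, 0 <= t -> 0 <= h t)
  (h_L1 : (@lebesgue_measure R).-integrable `[0, +oo[ (EFin \o h))
  (W_ge0 : forall x y, 0 <= x <= 1 -> 0 <= y <= 1 -> 0 <= W x y)
  (W_meas : measurable_fun ((I01 R) `*` (I01 R)) (fun z : R * R => W z.1 z.2))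
  (W_le : forall x y, 0 <= x <= 1 -> 0 <= y <= 1 -> W x y <= CW)
  (W_TV : forall y, 0 <= y <= 1 -> (TV01 (W ^~ y) < +oo)%E)
  (W_supTV : (ereal_sup [set TV01 (W ^~ y) | y in I01 R] < +oo)%E)
  (tau : nat -> Omega -> \bar R) (xi : nat -> Omega -> R)
  (N_hawkes : is_graphon_hawkes P linf h W tau xi)
  (rho_lt1 : (spectral_radius (T_hom h W) < 1)%E)
  (lbar : R -> R)
  (lbar_L1 : L1 lbar)
  (lbar_eq : lbar = (fun x => linf x + L1_norm_half_line h *
                       \int[@lebesgue_measure R]_(y in I01 R) (W x y * lbar y))
             %[ae @lebesgue_measure R in I01 R])
  (A : set R) (A_meas : measurable A) (A_sub : A `<=` (I01 R)) :
  cvg_in_probability P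
    (fun T w => ereal_sup
       [set `| N_count tau xi (T * v) A w * (T^-1)%:E
               - (v * \int[@lebesgue_measure R]_(x in A) lbar x)%:E |%E
       | v in I01 R])
    0.
Proof.
have [pp intensity] := N_hawkes.
set a := L1_norm_half_line h.
pose l := patch_l linf; pose g := patch_h h; pose V := patch_W W.
have par : hawkes_params l g V CW a by exact: patch_params.
have intV : has_conditional_intensity P tau xi (lam tau xi l g V) by exact: intensity_patch.
have a0 := a_ge0 par; have V0 := par_W_ge0 par; have VC := par_W_le par.
have mV := par_W_meas par.
have K0 x : Kop V a (cst 0) x = 0.
  rewrite /Kop (_ : \int[_]_(y in _) _ = \int[@lebesgue_measure R]_(y in I01 R) 0).
    by rewrite Rintegral_cst ?mul0r ?mulr0//; exact: measurable_I01.
  by apply: eq_Rintegral => y _; rewrite mulr0.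
have hK : no_subinvariant V a 1.
  apply: (no_subinvariant1 mV V0 VC a0) => r r1.
  exact: (real_resolvent (T_hom_patch h W) K0 rho_lt1 r1).
(* The given [lbar] solves its equation only almost everywhere. Applying the right-hand side once
   gives a representative for which the equation holds at every point of [0,1], because the operator
   ignores null sets. *)
pose lb := (fun x => l x + Kop V a lbar x) \_ (I01 R).
have LKb : L1 (Kop V a lbar) by exact: (@L1_Kop _ V CW).
have lbE x : 0 <= x <= 1 -> lb x = l x + Kop V a lbar x.
  by move=> x01; rewrite /lb patchE mem_set//= in_itv.
have lbar_lb : lbar = lb %[ae @lebesgue_measure R in I01 R].
  apply: ae_imp lbar_eq => x + Dx => /(_ Dx) ->.
  have x01 : 0 <= x <= 1 by move: Dx; rewrite /= in_itv.
  by rewrite lbE// /l patch_lE// -T_hom_patch.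
have lbar_lb_ge : le_ae lbar lb by apply: ae_imp lbar_lb => x + Dx => /(_ Dx) ->.
have lbar_lb_le : le_ae lb lbar by apply: ae_imp lbar_lb => x + Dx => /(_ Dx) ->.
have lb_L1 : L1 lb.
  have := L1D (par_l_L1 par) LKb; apply: eq_integrable; first exact: measurable_I01.
  by move=> x; rewrite inE/= in_itv/= => x01; rewrite lbE.
have Klb x : Kop V a lbar x = Kop V a lb x.
  by apply/eqP; rewrite eq_le !(le_Kop mV V0 VC).
have lb_eq x : 0 <= x <= 1 -> lb x = l x + Kop V a lb x.
  by move=> x01; rewrite lbE// Klb.
(* The minimum principle at [r = 1] applies because [Kop V a lb = lb - l <= lb]. The equation then
   turns the sign almost everywhere into a sign at every point. *)
have lb_ge0ae : le_ae (cst 0) lb.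
  apply: (no_subinvariant_pos mV V0 VC a0 ltr01 hK) => //.
  by apply: aeW => x; rewrite /= in_itv/= => x01; rewrite mul1r lb_eq// lerDr (par_l_ge0 par).
have lb_ge0 x : 0 <= x <= 1 -> 0 <= lb x.
  move=> x01; rewrite lb_eq// addr_ge0 ?(par_l_ge0 par)//.
  exact: (Kop_ge0 mV V0 VC).
have tA : test_fun (\1_A : R -> R).
  split; [by exact: measurable_indic|by move=> x; rewrite indicE|].
  by exists 1 => x; rewrite indicE; case: (_ \in _).
have L0 : 0 <= pairing \1_A lb by exact: pairing_ge0.
have Alb : \int[@lebesgue_measure R]_(x in A) lbar x = pairing \1_A lb.
  transitivity (\int[@lebesgue_measure R]_(x in I01 R `&` A) lbar x); first by rewrite setIidr.
  rewrite Rintegral_mkcondr; congr fine; apply: ae_eq_integral.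
  - exact: measurable_I01.
  - apply/measurable_EFinP; apply/measurable_restrict => //.
    by apply: measurable_funS (L1_meas lbar_L1) => // x [].
  - exact: measurable_int (L1_testM tA lb_L1).
  apply: ae_imp lbar_lb => x + Dx => /(_ Dx) <-.
  by rewrite patchE indicE; case: (x \in A); rewrite ?mul1r ?mul0r.
have NA t w : N_count tau xi t A w = ecount tau xi \1_A t w.
  apply: eq_eseriesr => n _; have [tn|tn] := ltP (tau n w) +oo%E; last first.
    by rewrite leNgt (lt_le_trans _ tn)// ltry.
  rewrite -lee_fin (fine_tau pp tn) indicE.
  by case: ifP.
rewrite Alb.
rewrite [X in cvg_in_probability _ X](_ : _ = fun T w => ereal_sup
    [set error tau xi \1_A (pairing \1_A lb) T w v | v in I01 R]); last first.
  apply/funext => T; apply/funext => w; congr ereal_sup.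
  by apply: eq_imagel => v _; rewrite /error NA.
apply: (uniform_convergence pp tA L0) => e eta e0 eta0.
- exact: (ecount_upper pp par intV lb_L1 lb_ge0 lb_eq hK tA e0 eta0).
- exact: (ecount_lower pp par intV lb_L1 lb_ge0 lb_eq hK tA e0 eta0).
Qed.
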